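(* Let $T\ge1$ be an integer, $\delta\in(0,1)$, $\eta>0$ and $G_0>0$ arbitrary. Let $f:\mathbb{R}^d\to\mathbb{R}$ be $L$-smooth and convex with a minimizer $x^*$ (so $f(x^* )=f^*$), and suppose that Assumptions 1, 2 and 3 hold (with constants $A,B,C>0$). Let $\{\overline{x}_t\}_{t\in[T]}$ be generated by AdaGrad-Norm or by RSAG with the adaptive step size $\eta_t=\eta/\left(G_0^2+\sum_{k=1}^t\|g_k\|^2\right)^{1/2}$. Put $\overline{\Delta}_1=f(x_1)-f^*$, $X=2A+4LB+4L$, $$\mathcal{F}=\log\left(1+\frac{(X\overline{\Delta}_1+2C)T+X\left(3\eta\|\nabla f(x_1)\|+\frac{9L\eta^2}{2}\right)T^2+\frac{9L\eta^2}{2}XT^3}{G_0^2}\right),$$ $$\overline{\Delta}_L=4\overline{\Delta}_1+8L\eta^2\mathcal{F}+36\eta^2(A+2BL)\log^2\frac T\delta+12\eta\sqrt C\log\frac T\delta+64\eta^2(A+2BL)\mathcal{F}^2+16\eta\sqrt C\mathcal{F}+10L\eta^2,$$ $$A_{T,\delta}=16\log\left(\frac{60\log_2(4T)\log(6T)}{\delta}\right),\quad B_{T,\delta}=16\log^2\left(\frac{60\log_2(4T)\log(6T)}{\delta}\right),\quad \mathcal{W}_L=\frac{\eta\sqrt{A\overline{\Delta}_L+C}}{G_0}+\eta\sqrt B,$$ $$R_L=2\eta^2\log\left(1+\frac{T(A\overline{\Delta}_L+2BL\overline{\Delta}_L+C)}{2G_0^2}\right)+\frac{7\eta^2}{G_0^2}(A\overline{\Delta}_L+2BL\overline{\Delta}_L+C)\log\frac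 T\delta,$$ $$D_L^2=2\|x_1-x^*\|^2+4R_L+10\eta^2\mathcal{F}+\frac{\eta^2}{2}+32\left(A_{T,\delta}R_L+\mathcal{W}_L^2B_{T,\delta}\right)+\frac{8}{\eta^2}R_L^2,\quad D_L>0.$$ Then, with probability at least $1-4\delta$, $$\begin{aligned}f\left(\frac1T\sum_{t=1}^T\overline{x}_t\right)-f^*\le{}&\left(12(A+2BL)(D_L+\eta)^2\log\frac1\delta+\frac{2G_0\|x_1-x^*\|^2}{\eta}\right)\frac1T\\&+\left(4\left(2\eta+\frac{D_L^2}{\eta}+\eta\mathcal{F}\right)^2\left(A+2(B+1)L\right)+4\eta\mathcal{F}G_0\right)\frac1T\\&+\frac{7(D_L+\eta)\sqrt{C\log\frac1\delta}+4\left(2\eta+\frac{D_L^2}{\eta}+\eta\mathcal{F}\right)\sqrt{2C}}{\sqrt T}.\end{aligned}$$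
   Context: Notation: $\|\cdot\|$ is the Euclidean norm on $\mathbb{R}^d$, $[T]=\{1,\dots,T\}$, $\log$ is the natural logarithm. The objective is $f(x)=\mathbb{E}_{z\sim\mathcal D}[f_z(x;z)]$, differentiable, with stochastic gradient oracle $\nabla f_z(x;z)$; $z_1,\dots,z_T$ are independent samples from $\mathcal D$. $L$-smoothness ($L>0$): $\|\nabla f(x)-\nabla f(y)\|\le L\|x-y\|$ for all $x,y\in\mathbb{R}^d$. Assumption 1: $f^*:=\inf_{x}f(x)>-\infty$. Assumption 2: $\mathbb{E}_z[\nabla f_z(x;z)]=\nabla f(x)$ for all $x$. Assumption 3: for constants $A,B,C>0$, for all $x$, almost surely $\|\nabla f_z(x;z)-\nabla f(x)\|^2\le A(f(x)-f^* )+B\|\nabla f(x)\|^2+C$. Generic AGD template: given (deterministic) $\tilde x_1=x_1\in\mathbb{R}^d$, $\alpha_t\in(0,1]$ and step sizes $\theta_t,\gamma_t$, for $t=1,\dots,T$: $\overline{x}_t=\alpha_tx_t+(1-\alpha_t)\tilde x_t$; $g_t=\nabla f_z(\overline{x}_t;z_t)$; $x_{t+1}=x_t-\theta_tg_t$; $\tilde x_{t+1}=\overline{x}_t-\gamma_tg_t$ (in particular $\overline{x}_1=x_1$). RSAG with adaptive step size: $\theta_t=\eta_t$, $\alpha_t=\frac{2}{t+1}$, $\gamma_t=(1+\alpha_t)\theta_t$. AdaGrad-Norm: $\gamma_t=\theta_t=\eta_t$ (so $\overline{x}_t=x_t$). Here $\eta_t=\eta/(G_0^2+\sum_{k=1}^t\|g_k\|^2)^{1/2}$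 with constants $\eta,G_0>0$. *)

(* Defs.v *)
From HB Require Import structures.
From mathcomp Require Import all_boot all_order all_algebra.
From mathcomp Require Import all_classical all_reals all_analysis.

Set Implicit Arguments.
Unset Strict Implicit.
Unset Printing Implicit Defensive.

Import Order.TTheory GRing.Theory Num.Theory.
Import numFieldNormedType.Exports.

Local Open Scope classical_set_scope.
Local Open Scope ring_scope.

(* The Euclidean norm: the library norm [`|x|] on ['rV[R]_d] is the sup norm. *)
Definition enorm (R : realType) (d : nat) (x : 'rV[R]_d) : R :=
  Num.sqrt (\sum_(i < d) x 0 i ^+ 2).

(* Meaningful where [f] is differentiable; partial derivatives that do not
   exist take the default value of ['D_v f]. *)
Definition grad (R : realType) (d : nat) (f : 'rV[R]_d -> R) (x : 'rV[R]_d) :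
    'rV[R]_d :=
  \row_(i < d) 'D_(delta_mx 0 i) f x.

Definition L_smooth (R : realType) (d : nat) (L : R) (f : 'rV[R]_d -> R) : Prop :=
  forall x y, enorm (grad f x - grad f y) <= L * enorm (x - y).

(* ['rV[R]_d] carries no sigma-algebra in the library. *)
Definition borel_rV (R : realType) (d : nat) :=
  g_sigma_algebraType (@open 'rV[R]_d).

Definition is_mean_of (R : realType) (d : nat) (dZ : measure_display)
    (Z : measurableType dZ) (D : probability Z R)
    (fz : 'rV[R]_d -> Z -> R) (f : 'rV[R]_d -> R) : Prop :=
  forall x, D.-integrable setT (EFin \o fz x) /\ 'E_D[fz x]%E = (f x)%:E.

(* [G x z] stands for the gradient of [fz] in its first argument. As only the
   mean [f] is assumed differentiable, [G x z] is pinned down where the gradient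
   of [fz ^~ z] exists and is otherwise an arbitrary measurable choice. Joint
   measurability makes the iterates of the methods below random variables. *)
Definition stochastic_gradient (R : realType) (d : nat) (dZ : measure_display)
    (Z : measurableType dZ) (fz : 'rV[R]_d -> Z -> R)
    (G : 'rV[R]_d -> Z -> 'rV[R]_d) : Prop :=
  (forall x z, differentiable (fz ^~ z) x -> G x z = grad (fz ^~ z) x) /\
  (forall i, measurable_fun [set: borel_rV R d * Z]
    (fun p : borel_rV R d * Z => G p.1 p.2 0 i)).

Definition unbiased (R : realType) (d : nat) (dZ : measure_display)
    (Z : measurableType dZ) (D : probability Z R)
    (G : 'rV[R]_d -> Z -> 'rV[R]_d) (f : 'rV[R]_d -> R) : Prop :=
  forall x i, D.-integrable setT (EFin \o (fun z => G x z 0 i)) /\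
    'E_D[fun z => (G x z 0 i)%R]%E = (grad f x 0 i)%:E.

Definition relaxed_noise (R : realType) (d : nat) (dZ : measure_display)
    (Z : measurableType dZ) (D : probability Z R)
    (G : 'rV[R]_d -> Z -> 'rV[R]_d) (f : 'rV[R]_d -> R) (A B C : R) : Prop :=
  forall x, {ae D, forall z, enorm (G x z - grad f x) ^+ 2 <=
    A * (f x - inf (range f)) + B * enorm (grad f x) ^+ 2 + C}.

Definition mutually_independent (R : realType) (dO dZ : measure_display)
    (Omega : measurableType dO) (Z : measurableType dZ)
    (P : probability Omega R) (I : finType) (X : I -> Omega -> Z) : Prop :=
  forall (J : {set I}) (E : I -> set Z), (forall i, measurable (E i)) ->
    P (\bigcap_(i in [set` J]) (X i @^-1` E i)) =
      (\prod_(i in J) P (X i @^-1` E i))%E.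

(* Sequences are indexed from 1; values at other indices than those mentioned
   are irrelevant. The sample [z_t], for [1 <= t <= T], is [z t]. *)
Definition iid_samples (R : realType) (dO dZ : measure_display)
    (Omega : measurableType dO) (Z : measurableType dZ)
    (P : probability Omega R) (D : probability Z R) (T : nat)
    (z : nat -> {RV P >-> Z}) : Prop :=
  (forall t, (1 <= t <= T)%N ->
    forall E, measurable E -> distribution P (z t) E = D E) /\
  mutually_independent P (fun i : 'I_T => z i.+1 : Omega -> Z).

(* A run of the generic accelerated template, for every outcome [w]; [xt] and
   [xb] are the tilde and bar sequences. *)
Record agd_run (R : realType) (d : nat) (Omega Z : Type)
    (G : 'rV[R]_d -> Z -> 'rV[R]_d) (z : nat -> Omega -> Z) (T : nat)
    (x1 : 'rV[R]_d) (alpha : nat -> R) (theta gamma : nat -> Omega -> R)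
    (x xt xb g : nat -> Omega -> 'rV[R]_d) : Prop := AgdRun {
  agd_alpha : forall t, (1 <= t <= T)%N -> 0 < alpha t <= 1;
  agd_x1 : forall w, x 1%N w = x1;
  agd_xt1 : forall w, xt 1%N w = x1;
  agd_xb : forall t w, (1 <= t <= T)%N ->
    xb t w = alpha t *: x t w + (1 - alpha t) *: xt t w;
  agd_g : forall t w, (1 <= t <= T)%N -> g t w = G (xb t w) (z t w);
  agd_x : forall t w, (1 <= t <= T)%N -> x t.+1 w = x t w - theta t w *: g t w;
  agd_xt : forall t w, (1 <= t <= T)%N ->
    xt t.+1 w = xb t w - gamma t w *: g t w }.

Definition adaptive_step (R : realType) (d : nat) (Omega : Type) (eta G0 : R)
    (g : nat -> Omega -> 'rV[R]_d) (t : nat) (w : Omega) : R :=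
  eta / Num.sqrt (G0 ^+ 2 + \sum_(1 <= k < t.+1) enorm (g k w) ^+ 2).

Definition adagrad_norm (R : realType) (d : nat) (Omega : Type) (eta G0 : R)
    (T : nat) (theta gamma : nat -> Omega -> R)
    (g : nat -> Omega -> 'rV[R]_d) : Prop :=
  forall t w, (1 <= t <= T)%N ->
    theta t w = adaptive_step eta G0 g t w /\
    gamma t w = adaptive_step eta G0 g t w.

Definition rsag (R : realType) (d : nat) (Omega : Type) (eta G0 : R) (T : nat)
    (alpha : nat -> R) (theta gamma : nat -> Omega -> R)
    (g : nat -> Omega -> 'rV[R]_d) : Prop :=
  forall t w, (1 <= t <= T)%N ->
    [/\ theta t w = adaptive_step eta G0 g t w,
        alpha t = 2 / (t%:R + 1) &
        gamma t w = (1 + alpha t) * theta t w].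

(* Main.v *)
(* With [q t] the sum of the squared gradients seen before time [t], four scalar
   processes built from the iterates and the noise have exponentials that are
   supermartingales: given the past, the exponential of an increment is at most
   an affine function of the centred noise, by Hoeffding's lemma for bounded
   noise or by [exp (y - y^2) <= 1 + y] for small [y]. By Ville's inequality each
   of their partial sums stays below [ln (1 / delta)] outside an event of
   probability [delta], and on the remaining event the argument is deterministic:
   - the descent lemma, run with step sizes that do not depend on the current
     sample, bounds the gaps [f (xb t) - inf f] by [DeltaL], by induction on [t];
   - the noise is then uniformly bounded, and comparing its energy with that of
     the gradients bounds the weighted sum of the squared noise by [R_L];
   - this bounds the distances of the iterates to [xstar] by [D_L], by induction;
   - the regret bound for the adaptive step sizes, convexity, and the inequality
     [|grad f|^2 <= 2 L (f - inf f)] give a quadratic inequality for the sum of the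
     gaps, hence the rate.
   AdaGrad-Norm and RSAG differ only in the distance of [xb t] to [x t], whose
   squares sum to at most twice the sum of the squared steps in both cases. For
   [delta >= 1 / 4] there is nothing to prove. *)
Require Import Defs.
From HB Require Import structures.
From mathcomp Require Import all_boot all_order all_algebra.
From mathcomp Require Import all_classical all_reals all_analysis.
From mathcomp Require Import measurable_realfun.
From mathcomp Require Import ring lra.

Set Implicit Arguments.
Unset Strict Implicit.
Unset Printing Implicit Defensive.

Import Order.TTheory GRing.Theory Num.Theory.
Import numFieldNormedType.Exports.

Local Open Scope classical_set_scope.
Local Open Scope ring_scope.

(** * Scalar inequalities *)

Section Scalar.
Context {R : realType}.
Implicit Types (k x y a b : R).

(** Two circularities shape the proof. The step size at time [t] contains [g t], so it is correlated
    with the noise that it multiplies; and the noise is bounded only where the gap is, while the gap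
    is bounded only if the noise is. Against the first, a step that multiplies noise is exchanged
    for one known before the sample: the previous step, at a cost that telescopes, or a step with
    the worst-case gradient in place of [g t], at a cost of the order of the squared step. Against
    the second, each process is set to zero at states where the gap or the distance to [xstar]
    exceeds its target. It is then fair at every state, reachable or not, and the inductions show
    afterwards that the cut-off never acts. As the targets are fixed numbers, so are the multipliers
    [lam], and one application of Ville's inequality per process covers all times. No filtration is
    built: the two iterates and the sum of squared gradients form a Markov chain driven by the
    samples, and conditioning on the past is integration over the fresh sample. *)

Lemma mvt_le0 (h dh : R -> R) k : 0 <= k ->
  (forall s : R, is_derive (s : R) (1 : R) h (dh s)) ->
  (forall s, 0 <= s -> dh s <= 0) -> h k <= h 0.
Proof.
move=> k0 dhE dh0; move: k0; rewrite le_eqVlt => /predU1P[<-//|k0].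
have hc : {within `[0 : R, k], continuous h}.
  apply: derivable_within_continuous => s _.
  exact: (@ex_derive _ _ _ _ _ _ _ (dhE s)).
have [c c01 E] := MVT k0 (fun s _ => dhE s) hc.
rewrite -subr_le0 E subr0 mulr_le0_ge0 ?(ltW k0)// dh0//.
by move: c01; rewrite in_itv/= => /andP[/ltW ].
Qed.

(** The function [exp (- s ^ 2 / 2) * cosh s] is nonincreasing on [s >= 0]: its derivative has the
    sign of [sinh s - s * cosh s], which vanishes at 0 and has derivative [- s * sinh s <= 0]. *)
Lemma cosh_le k : 0 <= k -> (expR k + expR (- k)) / 2 <= expR (k ^+ 2 / 2).
Proof.
have S (s : R) : 0 <= s -> expR (- s) <= expR s by move=> s0; rewrite ler_expR; lra.
have H (s : R) : 0 <= s -> expR s - expR (- s) - s * (expR s + expR (- s)) <= 0.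
  move=> s0.
  pose h (s : R) := expR s - expR (- s) - s * (expR s + expR (- s)).
  pose dh (s : R) := - s * (expR s - expR (- s)).
  have dhE t : is_derive (t : R) (1 : R) h (dh t).
    by apply: is_derive_eq; rewrite /dh /GRing.scale/=; ring.
  have : h s <= h 0.
    apply: (mvt_le0 s0 dhE) => t t0.
    by rewrite /dh mulNr oppr_le0 mulr_ge0// subr_ge0 S.
  by rewrite {2}/h oppr0 subrr mul0r subr0.
move=> k0.
pose h (s : R) := expR (- (s ^+ 2 / 2)) * (expR s + expR (- s)).
pose dh (s : R) := expR (- (s ^+ 2 / 2)) * (expR s - expR (- s) - s * (expR s + expR (- s))).
have dhE t : is_derive (t : R) (1 : R) h (dh t).
  by apply: is_derive_eq; rewrite /dh /GRing.scale/=; field.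
have : h k <= h 0.
  by apply: (mvt_le0 k0 dhE) => t t0; rewrite /dh mulr_ge0_le0 ?expR_ge0// H.
rewrite /h expr0n/= mul0r oppr0 expR0 mul1r expRN mulrC ler_pdivrMr ?expR_gt0//.
rewrite ler_pdivrMr//; lra.
Qed.

(* The chord of [exp] over [[-k, k]], rescaled so that its value at 0 is at
   most 1 by [cosh k <= exp (k ^ 2 / 2)]. *)
Lemma hoeffding_chord k : 0 <= k -> exists s, forall y, `|y| <= k ->
  expR (y - k ^+ 2 / 2) <= 1 + s * y.
Proof.
rewrite le_eqVlt => /predU1P[<-|k0].
  exists 0 => y; rewrite normr_le0 => /eqP ->.
  by rewrite expr0n/= mul0r subrr expR0 mul0r addr0.
pose e := expR (- (k ^+ 2 / 2)).
have e0 : 0 < e by exact: expR_gt0.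
exists (e * ((expR k - expR (- k)) / (2 * k))) => y; rewrite ler_norml => /andP[y1 y2].
rewrite expRD -/e.
have E : e * ((expR k + expR (- k)) / 2) <= 1.
  by rewrite /e expRN mulrC ler_pdivrMr ?expR_gt0// mul1r cosh_le// ltW.
pose t := (y + k) / (2 * k).
have t01 : 0 <= t <= 1.
  rewrite /t divr_ge0 ?ler_pdivrMr ?mulr_gt0//; lra.
have := convex_expR (Itv01 (andP t01).1 (andP t01).2) k (- k).
rewrite !convRE/= /unlock/= => H.
have {}H : expR y <= t * expR k + (1 - t) * expR (- k).
  apply: le_trans H; rewrite ler_expR le_eqVlt; apply/orP; left; apply/eqP.
  rewrite -[RHS]/(t * k + (1 - t) * - k) /t; field; lra.
apply: le_trans (_ : (t * expR k + (1 - t) * expR (- k)) * e <= _); first by rewrite ler_wpM2r// ltW.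
apply: le_trans (lerD E (lexx _)).
rewrite le_eqVlt; apply/orP; left; apply/eqP; rewrite /t; field; lra.
Qed.

(** For [y >= 0], [exp (y ^ 2 - y) >= 1 - y + y ^ 2] suffices because
    [(1 + y) * (1 - y + y ^ 2) = 1 + y ^ 3]. For [y = - s < 0] the same first-order bound only
    yields [1 - s ^ 3], so it is applied to a third of the exponent and cubed. *)
Lemma expR_sub_sqr_le y : `|y| <= 1 / 3 -> expR (y - y ^+ 2) <= 1 + y.
Proof.
rewrite ler_norml => /andP[y1 y2].
have [y0|y0] := leP 0 y.
  have p0 : 0 < 1 - y + y ^+ 2 by nra.
  have := expR_ge1Dx (y ^+ 2 - y) => H.
  rewrite -opprB expRN; apply: le_trans (_ : (1 - y + y ^+ 2)^-1 <= _).
    rewrite lef_pV2 ?posrE ?expR_gt0//; lra.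
  by rewrite -div1r ler_pdivrMr//; nra.
pose s := - y; have -> : y = - s by rewrite opprK.
have s0 : 0 < s by rewrite /s; lra.
have s1 : s <= 1 / 3 by rewrite /s; lra.
have -> : - s - (- s) ^+ 2 = - (3%:R * ((s + s ^+ 2) / 3)) by field.
rewrite expRN expRM_natl.
have := expR_ge1Dx ((s + s ^+ 2) / 3).
set q := expR _ => qs.
have r1 : 0 <= (s + s ^+ 2) / 3 by nra.
set r := (s + s ^+ 2) / 3 in qs r1.
have q3 : (1 + r) ^+ 3 <= q ^+ 3 by rewrite lerXn2r// nnegrE; lra.
have r3 : 1 <= (1 - s) * (1 + r) ^+ 3.
  have : 1 + 3 * r + 3 * r ^+ 2 <= (1 + r) ^+ 3.
    have -> : (1 + r) ^+ 3 = 1 + 3 * r + 3 * r ^+ 2 + r ^+ 3 by ring.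
    by rewrite lerDl exprn_ge0.
  have -> : 1 + 3 * r + 3 * r ^+ 2 = 1 + s + 4 / 3 * s ^+ 2 + 2 / 3 * s ^+ 3 + 1 / 3 * s ^+ 4.
    by rewrite /r; field.
  have s1' : 0 <= 1 - s by lra.
  move=> /(ler_wpM2l s1'); apply: le_trans.
  have -> : (1 - s) * (1 + s + 4 / 3 * s ^+ 2 + 2 / 3 * s ^+ 3 + 1 / 3 * s ^+ 4) =
    1 + s ^+ 2 / 3 * (1 - 2 * s - s ^+ 2 - s ^+ 3) by field.
  rewrite lerDl mulr_ge0 ?divr_ge0 ?sqr_ge0//.
  have : s ^+ 2 <= 1 / 9 by nra.
  have : s ^+ 3 <= 1 / 9 by rewrite exprS; nra.
  lra.
have q0 : 0 < q ^+ 3 by rewrite exprn_gt0// expR_gt0.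
rewrite -div1r ler_pdivrMr//; apply: le_trans r3 _.
by rewrite ler_wpM2l//; lra.
Qed.

Lemma ln_ge1BV x : 0 < x -> 1 - x^-1 <= ln x.
Proof.
move=> x0; have := @le_ln1Dx R (x^-1 - 1).
have x'0 : 0 < x^-1 by rewrite invr_gt0.
have -> : 1 + (x^-1 - 1) = x^-1 by ring.
by rewrite lnV ?posrE// => H; have : - ln x <= x^-1 - 1; [apply: H|]; lra.
Qed.

Lemma ln_increment x a : 0 <= a -> 0 < x -> a / (x + a) <= ln (x + a) - ln x.
Proof.
move=> a0 x0; have xa : 0 < x + a by lra.
rewrite -ln_div ?posrE//; apply: le_trans (ln_ge1BV _); last exact: divr_gt0.
rewrite invf_div le_eqVlt; apply/orP; left; apply/eqP; field; lra.
Qed.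

Lemma sqrt_increment x a : 0 <= a -> 0 < x ->
  a / Num.sqrt (x + a) <= 2 * (Num.sqrt (x + a) - Num.sqrt x).
Proof.
move=> a0 x0; have xa : 0 < x + a by lra.
rewrite ler_pdivrMr ?sqrtr_gt0//.
have p := sqrtr_gt0 x; have q := sqrtr_gt0 (x + a); rewrite x0 in p; rewrite xa in q.
have E1 := sqr_sqrtr (ltW x0); have E2 := sqr_sqrtr (ltW xa).
set p' := Num.sqrt x in p E1 *; set q' := Num.sqrt _ in q E2 *.
have : 0 <= (q' - p') ^+ 2 by exact: sqr_ge0.
nra.
Qed.

Lemma sqrtD_le x a : 0 <= x -> 0 <= a ->
  Num.sqrt (x + a) <= Num.sqrt x + Num.sqrt a.
Proof.
move=> x0 a0; rewrite -(@ler_pXn2r _ 2%N) ?nnegrE ?addr_ge0 ?sqrtr_ge0//.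
rewrite sqrrD !sqr_sqrtr ?addr_ge0//.
have : 0 <= Num.sqrt x * Num.sqrt a by rewrite mulr_ge0 ?sqrtr_ge0.
lra.
Qed.

Lemma young x y c : 0 < c -> x * y <= c / 2 * x ^+ 2 + y ^+ 2 / (2 * c).
Proof.
move=> c0; rewrite -subr_ge0.
have -> : c / 2 * x ^+ 2 + y ^+ 2 / (2 * c) - x * y =
   (c * x - y) ^+ 2 / (2 * c) by field; rewrite gt_eqF.
by rewrite divr_ge0 ?sqr_ge0// mulr_ge0// ltW.
Qed.

End Scalar.

(** * Euclidean geometry and smooth functions *)

Definition dotv (R : realType) (d : nat) (u v : 'rV[R]_d) : R :=
  \sum_(i < d) u 0 i * v 0 i.

Section Euclid.
Context {R : realType} {d : nat}.
Implicit Types (u v w : 'rV[R]_d) (a : R).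

Lemma dotvC u v : dotv u v = dotv v u.
Proof. by apply: eq_bigr => i _; rewrite mulrC. Qed.

Lemma dotvDl u v w : dotv (u + v) w = dotv u w + dotv v w.
Proof. by rewrite -big_split; apply: eq_bigr => i _; rewrite mxE mulrDl. Qed.

Lemma dotvZl a u v : dotv (a *: u) v = a * dotv u v.
Proof. by rewrite mulr_sumr; apply: eq_bigr => i _; rewrite mxE mulrA. Qed.

Lemma dotv0l u : dotv 0 u = 0.
Proof. by rewrite -(scale0r 0) dotvZl mul0r. Qed.

Lemma dotvNl u v : dotv (- u) v = - dotv u v.
Proof. by rewrite -scaleN1r dotvZl mulN1r. Qed.

Lemma dotvBl u v w : dotv (u - v) w = dotv u w - dotv v w.
Proof. by rewrite dotvDl dotvNl. Qed.

Lemma dotvDr u v w : dotv w (u + v) = dotv w u + dotv w v.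
Proof. by rewrite dotvC dotvDl !(dotvC w). Qed.

Lemma dotvZr a u v : dotv u (a *: v) = a * dotv u v.
Proof. by rewrite dotvC dotvZl dotvC. Qed.

Lemma dotvNr u v : dotv u (- v) = - dotv u v.
Proof. by rewrite dotvC dotvNl dotvC. Qed.

Lemma dotvBr u v w : dotv w (u - v) = dotv w u - dotv w v.
Proof. by rewrite dotvDr dotvNr. Qed.

Lemma sqr_enorm u : enorm u ^+ 2 = dotv u u.
Proof.
rewrite /enorm sqr_sqrtr; last by apply: sumr_ge0 => i _; exact: sqr_ge0.
by apply: eq_bigr => i _; rewrite expr2.
Qed.

Lemma enorm_ge0 u : 0 <= enorm u. Proof. exact: sqrtr_ge0. Qed.

Lemma enormN u : enorm (- u) = enorm u.
Proof. by congr Num.sqrt; apply: eq_bigr => i _; rewrite mxE sqrrN. Qed.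

Lemma enorm0 : enorm (0 : 'rV[R]_d) = 0.
Proof. by rewrite /enorm big1 ?sqrtr0// => i _; rewrite mxE expr0n. Qed.

Lemma enormZ a u : enorm (a *: u) = `|a| * enorm u.
Proof.
apply/eqP; rewrite -(@eqrXn2 _ 2%N) ?mulr_ge0 ?enorm_ge0//.
by rewrite exprMn !sqr_enorm dotvZl dotvZr real_normK ?num_real// mulrA expr2.
Qed.

Lemma sqr_enormD u v :
  enorm (u + v) ^+ 2 = enorm u ^+ 2 + 2 * dotv u v + enorm v ^+ 2.
Proof. by rewrite !sqr_enorm dotvDl !dotvDr (dotvC v u); ring. Qed.

Lemma sqr_enormB u v :
  enorm (u - v) ^+ 2 = enorm u ^+ 2 - 2 * dotv u v + enorm v ^+ 2.
Proof. by rewrite sqr_enormD dotvNr enormN mulrN. Qed.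

Lemma enorm_eq0 u : enorm u = 0 -> u = 0.
Proof.
move=> u0; have := sqr_enorm u; rewrite u0 expr0n/= => /esym/psumr_eq0P u00.
apply/rowP => i; rewrite mxE; apply/eqP.
by rewrite -sqrf_eq0 expr2 u00// => j _; rewrite -expr2 sqr_ge0.
Qed.

Lemma dotv_le_enorm u v : dotv u v <= enorm u * enorm v.
Proof.
have [/enorm_eq0 ->|u0] := eqVneq (enorm u) 0; first by rewrite dotv0l enorm0 mul0r.
have [/enorm_eq0 ->|v0] := eqVneq (enorm v) 0.
  by rewrite dotvC dotv0l enorm0 mulr0.
have up : 0 < enorm u by rewrite lt_neqAle eq_sym u0 enorm_ge0.
have vp : 0 < enorm v by rewrite lt_neqAle eq_sym v0 enorm_ge0.
have := sqr_ge0 (enorm (enorm v *: u - enorm u *: v)).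
rewrite sqr_enormB !enormZ dotvZl dotvZr !ger0_norm ?enorm_ge0//.
have -> : forall a b c : R, (b * a) ^+ 2 - 2 * (b * (a * c)) + (a * b) ^+ 2 =
   (2 * a * b) * (a * b - c) by move=> *; ring.
by rewrite pmulr_rge0 ?subr_ge0// !mulr_gt0.
Qed.

Lemma normr_dotv u v : `|dotv u v| <= enorm u * enorm v.
Proof.
rewrite ler_norml dotv_le_enorm andbT lerNl -dotvNl.
by apply: le_trans (dotv_le_enorm _ _) _; rewrite enormN.
Qed.

Lemma ler_enormD u v : enorm (u + v) <= enorm u + enorm v.
Proof.
rewrite -(@ler_pXn2r _ 2%N) ?nnegrE ?addr_ge0 ?enorm_ge0//.
rewrite sqr_enormD; have := dotv_le_enorm u v; lra.
Qed.

Lemma dotv_young u v (c : R) : 0 < c ->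
  dotv u v <= c / 2 * enorm u ^+ 2 + enorm v ^+ 2 / (2 * c).
Proof. by move=> c0; apply: le_trans (dotv_le_enorm u v) (young _ _ c0). Qed.

Lemma coord_le_enorm u i : `|u 0 i| <= enorm u.
Proof.
rewrite -(@ler_pXn2r _ 2%N) ?nnegrE ?enorm_ge0 ?normr_ge0//.
rewrite real_normK ?num_real// sqr_enorm /dotv (bigD1 i)//= -expr2 lerDl.
by apply: sumr_ge0 => j _; rewrite -expr2 sqr_ge0.
Qed.

End Euclid.

(** * Gradient inequalities for smooth and convex functions *)

Section Smooth.
Context {R : realType} {d : nat}.
Variables (f : 'rV[R]_d -> R) (L : R).
Hypotheses (df : forall y, differentiable f y) (sf : L_smooth L f).

Lemma grad_derive x v : 'D_v f x = dotv (grad f x) v.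
Proof.
rewrite deriveE// [in LHS](row_sum_delta v) linear_sum; apply: eq_bigr => i _.
by rewrite linearZ mxE deriveE// mulrC.
Qed.

Lemma is_derive_line x v (t : R) :
  is_derive t 1 (fun s => f (x + s *: v)) (dotv (grad f (x + t *: v)) v).
Proof.
have E : (fun h : R => h^-1 *: (((fun s => f (x + s *: v)) \o shift t) (h *: 1) - f (x + t *: v))) =
    (fun h : R => h^-1 *: ((f \o shift (x + t *: v)) (h *: v) - f (x + t *: v))).
  apply/funext => h /=; congr (_ *: (f _ - _)).
  by rewrite -[h *: 1]/(h * 1) mulr1 scalerDl addrCA.
split; first by rewrite /derivable E; exact: diff_derivable.
by rewrite -grad_derive /derive E.
Qed.

(** One mean value identity serves both quadratic bounds: with [K = L * |v| ^ 2] or its opposite,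
    smoothness bounds the inner product on the right by exactly [|K| * c]. *)
Lemma mvt_line x v (K : R) : exists2 c : R, 0 <= c <= 1 &
  f (x + v) - f x - dotv (grad f x) v - K / 2 =
  dotv (grad f (x + c *: v) - grad f x) v - K * c.
Proof.
pose a := dotv (grad f x) v.
pose h (s : R) := f (x + s *: v) - s * a - K / 2 * s ^+ 2.
pose dh (s : R) := dotv (grad f (x + s *: v)) v - a - K * s.
have dhE s : is_derive (s : R) (1 : R) h (dh s).
  rewrite /h /dh; have H := is_derive_line x v s.
  by apply: is_derive_eq; rewrite /GRing.scale/=; field.
have hc : {within `[0 : R, 1], continuous h}.
  apply: derivable_within_continuous => s _.
  exact: (@ex_derive _ _ _ _ _ _ _ (dhE s)).
have [c c01 E] := MVT (@ltr01 R) (fun s _ => dhE s) hc.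
exists c.
  by move: c01; rewrite in_itv/= => /andP[/ltW -> /ltW ->].
move: E; rewrite /h /dh dotvBl -/a scale1r scale0r addr0.
rewrite subr0 mulr1 => <-; ring.
Qed.

Lemma descent_le x v :
  f (x + v) <= f x + dotv (grad f x) v + L / 2 * enorm v ^+ 2.
Proof.
have [c /andP[c0 _] E] := mvt_line x v (L * enorm v ^+ 2).
suff : dotv (grad f (x + c *: v) - grad f x) v - L * enorm v ^+ 2 * c <= 0 by lra.
have H := dotv_le_enorm (grad f (x + c *: v) - grad f x) v.
have := sf (x + c *: v) x; rewrite addrAC subrr add0r enormZ ger0_norm// => G.
have := ler_wpM2r (enorm_ge0 v) G; lra.
Qed.

Lemma descent_ge x v :
  f x + dotv (grad f x) v - L / 2 * enorm v ^+ 2 <= f (x + v).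
Proof.
have [c /andP[c0 _] E] := mvt_line x v (- (L * enorm v ^+ 2)).
suff : 0 <= dotv (grad f (x + c *: v) - grad f x) v + L * enorm v ^+ 2 * c by lra.
have H := normr_dotv (grad f (x + c *: v) - grad f x) v.
have := sf (x + c *: v) x; rewrite addrAC subrr add0r enormZ ger0_norm// => G.
have := ler_wpM2r (enorm_ge0 v) G.
have := lerNnormlW H; lra.
Qed.

Lemma sqr_grad_le m x : 0 < L -> (forall y, m <= f y) ->
  enorm (grad f x) ^+ 2 <= 2 * L * (f x - m).
Proof.
move=> L0 mf; have := descent_le x (- (L^-1 *: grad f x)).
rewrite dotvNr dotvZr enormN enormZ gtr0_norm ?invr_gt0// -sqr_enorm.
have -> : forall a : R, L / 2 * (L^-1 * a) ^+ 2 = (2 * L)^-1 * a ^+ 2.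
  by move=> a; field; rewrite gt_eqF.
set u := x - _; have := mf u; set n := _ ^+ 2 => mfu fu.
rewrite -ler_pdivrMl ?mulr_gt0// .
have -> : (2 * L)^-1 * n = L^-1 * n - (2 * L)^-1 * n by field; rewrite gt_eqF.
lra.
Qed.

Hypothesis cf : convex_function [set: convex_lmodType 'rV[R]_d] f.

Lemma convex_comb x y (t : R) : 0 <= t -> t <= 1 ->
  f (t *: x + (1 - t) *: y) <= t * f x + (1 - t) * f y.
Proof.
move=> t0 t1; have t01 : 0 <= t <= 1 by rewrite t0.
exact: (@cf (Itv01 t0 t1) x y (in_setT _) (in_setT _)).
Qed.

(** Convexity bounds [f] from above at a point of the chord and smoothness bounds it from below
    there, with a remainder of order [t ^ 2]. The point [t] is chosen so that the remainder is at
    most [t * e], and [t] is divided out. *)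
Lemma convex_grad_le x y : f x + dotv (grad f x) (y - x) <= f y.
Proof.
apply/ler_addgt0Pl => e e0.
pose n := enorm (y - x) ^+ 2.
have n0 : 0 <= n by exact: sqr_ge0.
pose k := `|L| / 2 * n.
have k0 : 0 <= k by rewrite mulr_ge0// divr_ge0.
pose t := Num.min 1 (e / (k + 1)).
have t0 : 0 < t by rewrite lt_min ltr01 divr_gt0// ltr_wpDl.
have t1 : t <= 1 by rewrite ge_min lexx.
have tk : t * k <= e.
  apply: le_trans (_ : e / (k + 1) * k <= _).
    by rewrite ler_wpM2r// ge_min lexx orbT.
  by rewrite mulrAC ler_pdivrMr ?ltr_wpDl// ler_wpM2l ?(ltW e0)// lerDl.
have H1 := convex_comb y x (ltW t0) t1.
have H2 := descent_ge x (t *: (y - x)).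
move: H2; have -> : x + t *: (y - x) = t *: y + (1 - t) *: x.
  by rewrite scalerBl scale1r scalerBr addrCA addrA.
rewrite dotvZr enormZ gtr0_norm// exprMn -/n => H2.
have H3 : L / 2 * (t ^+ 2 * n) <= t * e.
  apply: le_trans (_ : t * (t * k) <= _); last by rewrite ler_wpM2l// ltW.
  rewrite /k; have := ler_norm L; have tn : 0 <= t ^+ 2 * n by rewrite mulr_ge0// sqr_ge0.
  by move=> /(ler_wpM2r tn); lra.
have : t * (f x + dotv (grad f x) (y - x)) <= t * (e + f y) by lra.
by rewrite ler_pM2l.
Qed.

End Smooth.

(** * Processes driven by independent samples *)

(** Rectangles form a pi-system generating the product sigma-algebra, so two finite measures that
    agree on them are equal. [F] stands for an event on the samples still to come and [c] for its
    probability. *)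
Lemma joint_law (R : realType) (dO dS dZ : measure_display)
    (Omega : measurableType dO) (S : measurableType dS) (Z : measurableType dZ)
    (P : probability Omega R) (D : probability Z R)
    (X : {mfun Omega >-> S}) (Y : {mfun Omega >-> Z}) (F : set Omega)
    (c : {nonneg R}) : measurable F ->
  (forall A B, measurable A -> measurable B ->
    P (X @^-1` A `&` Y @^-1` B `&` F) =
      (c%:num%:E * (distribution P X A * D B))%E) ->
  forall C : set (S * Z), measurable C ->
    P ((fun w => (X w, Y w)) @^-1` C `&` F) =
      (c%:num%:E * (distribution P X \x D) C)%E.
Proof.
move=> mF H C mC.
have mXY : measurable_fun setT (fun w => (X w, Y w)).
  exact: measurable_fun_pair.
pose m1f : {measure set (S * Z) -> \bar R} :=
  pushforward (mrestr P mF) (fun w => (X w, Y w)).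
pose m1 := m1f mXY.
pose m2 : {measure set (S * Z) -> \bar R} := mscale c (distribution P X \x D)%E.
pose G := [set A `*` B | A in @measurable _ S & B in @measurable _ Z].
suff : m1 C = m2 C by [].
apply: (measure_unique G (fun=> setT)) => //.
- exact: measurable_prod_measurableType.
- move=> _ _ [A1 mA1 [B1 mB1 <-]] [A2 mA2 [B2 mB2 <-]].
  exists (A1 `&` A2); first exact: measurableI.
  by exists (B1 `&` B2); [exact: measurableI|rewrite setXI].
- by move=> _; exists setT => //; exists setT => //; rewrite setXTT.
- by rewrite bigcup_const//.
- move=> _ [A mA [B mB <-]].
  have E2 : (distribution P X \x D)%E (A `*` B) = (distribution P X A * D B)%E.
    exact: product_measure1E.
  exact: (etrans (H A B mA mB) (congr1 (mule _) (esym E2))).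
- move=> _; apply: le_lt_trans (ltry 1) => /=.
  rewrite /pushforward /mrestr preimage_setT setTI.
  exact: probability_le1.
Qed.

(** * Independence of the current state from the unseen samples *)

Section Markov.
Context {R : realType} {dO dS dZ : measure_display}.
Context {Omega : measurableType dO} {S : measurableType dS} {Z : measurableType dZ}.
Variables (P : probability Omega R) (D : probability Z R) (T : nat).
Variable (z : nat -> {RV P >-> Z}).
Hypothesis iid : iid_samples D T z.
Variables (s1 : S) (s : nat -> Omega -> S) (Psi : nat -> S * Z -> S).
Hypothesis mPsi : forall t, measurable_fun setT (Psi t).
Hypothesis s1E : forall w, s 1%N w = s1.
Hypothesis sSE : forall t w, (1 <= t <= T)%N -> s t.+1 w = Psi t (s t w, z t w).

Let future (E : nat -> set Z) (t : nat) : set Omega :=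
  \bigcap_(k in [set k | (t <= k <= T)%N]) z k @^-1` E k.

Let mfuture E t : (forall k, measurable (E k)) -> measurable (future E t).
Proof.
move=> mE; apply: bigcap_measurableType => // k _.
rewrite -[X in measurable X]setTI; exact: (measurable_funP (z k)).
Qed.

Lemma measurable_state t : (1 <= t <= T.+1)%N -> measurable_fun setT (s t).
Proof.
elim: t => // t IH /andP[_]; case: t => [|t] in IH *.
  by move=> _; rewrite (_ : s 1%N = cst s1)//; apply/funext => w; exact: s1E.
move=> tT; rewrite (_ : s t.+2 = Psi t.+1 \o (fun w => (s t.+1 w, z t.+1 w))); last first.
  by apply/funext => w; rewrite sSE//.
apply: measurableT_comp => //; apply: measurable_fun_pair => //.
by apply: IH; rewrite //= ltnW.
Qed.

(** By induction: the next state is a function of the current state and the current sample, whose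
    joint law, restricted to any event on the later samples, is a product by [joint_law]. The base
    case is mutual independence, as the initial state is deterministic. *)
Lemma state_future_indep t : (1 <= t <= T.+1)%N ->
  forall A E, measurable A -> (forall k, measurable (E k)) ->
  P (s t @^-1` A `&` future E t) =
    (P (s t @^-1` A) * \prod_(t <= k < T.+1) D (E k))%E.
Proof.
elim: t => // t IH tT; case: t => [|t] in IH tT *.
  move=> A E mA mE.
  have E1 : P (future E 1) = (\prod_(1 <= k < T.+1) D (E k))%E.
    have [idz indz] := iid.
    have := indz [set: 'I_T]%SET (fun i => E i.+1) (fun i => mE _).
    rewrite big_add1/= big_mkord => H.
    transitivity (P (\bigcap_(i in [set` [set: 'I_T]%SET]) z i.+1 @^-1` E i.+1)).
      congr (P _); apply/seteqP; split => w /=.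
        by move=> H1 i _; apply: H1 => /=; rewrite ltn_ord.
      move=> H1 [//|k] /= kT.
      have kT' : (k < T)%N by [].
      by have /= := H1 (Ordinal kT'); apply; rewrite inE.
    rewrite H; apply: eq_big => i; rewrite ?inE// => _.
    by rewrite -[LHS]/(distribution P (z i.+1) (E i.+1)) idz//= ltn_ord.
  have [As1|As1] := pselect (A s1).
    have -> : s 1%N @^-1` A = setT by apply/seteqP; split => // w _ /=; rewrite s1E.
    by rewrite setTI probability_setT mul1e.
  have -> : s 1%N @^-1` A = set0 by apply/seteqP; split => // w /=; rewrite s1E.
  by rewrite set0I measure0 mul0e.
have tT' : (t.+1 <= T)%N by case/andP: tT.
have tT2 : (1 <= t.+1 <= T.+1)%N by rewrite /= ltnW.
have ms : measurable_fun setT (s t.+1) by apply: measurable_state; rewrite /= ltnW.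
pose X : {mfun Omega >-> S} := HB.pack (s t.+1) (isMeasurableFun.Build _ _ _ _ _ ms).
have J E : (forall k, measurable (E k)) -> forall C, measurable C ->
    P ((fun w => (X w, z t.+1 w)) @^-1` C `&` future E t.+2) =
    (\prod_(t.+2 <= k < T.+1) D (E k) * (distribution P X \x D) C)%E.
  move=> mE C mC.
  have /andP[p0 p1] : (0 <= \prod_(t.+2 <= k < T.+1) D (E k) <= 1)%E.
    elim/big_ind : _ => [|x y /andP[x0 x1] /andP[y0 y1]|i _].
    - by rewrite lexx lee01.
    - by rewrite mule_ge0//= -(mule1 1) lee_pmul.
    - by rewrite measure_ge0//= probability_le1.
  have pfin : (\prod_(t.+2 <= k < T.+1) D (E k))%E \is a fin_num.
    by rewrite ge0_fin_numE// (le_lt_trans p1)// ltry.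
  have f0 := fine_ge0 p0.
  have -> : (\prod_(t.+2 <= k < T.+1) D (E k))%E = ((NngNum f0)%:num)%:E by rewrite /= fineK.
  apply: joint_law => //; first exact: mfuture.
  move=> A B mA mB /=; rewrite fineK//.
  (* Placing [B] at index [t.+1] turns the constraint on the sample consumed by this step into part
     of the future seen from [t.+1]. *)
  have := IH tT2 A (fun k => if k == t.+1 then B else E k) mA.
  rewrite (_ : future _ _ = z t.+1 @^-1` B `&` future E t.+2); last first.
    apply/seteqP; split => w /=.
      move=> H; split; first by have := H t.+1; rewrite eqxx; apply => /=; apply/andP; split.
      move=> k /andP[k1 k2]; have := H k; rewrite gtn_eqF//; apply.
      by rewrite /= k2 (ltnW k1).
    move=> [HB HE] k /andP[k1 k2]; case: eqVneq => [->//|kt].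
    by apply: HE; rewrite /= k2 ltn_neqAle eq_sym kt k1.
  rewrite setIA => ->//=; last by move=> k; case: ifP.
  rewrite big_ltn ?ltnS// eqxx muleA [RHS]muleC; congr (_ * _)%E.
  by apply: eq_big_nat => i /andP[ti _]; rewrite gtn_eqF.
move=> A E mA mE.
have -> : s t.+2 @^-1` A = (fun w => (X w, z t.+1 w)) @^-1` (Psi t.+1 @^-1` A).
  by apply/seteqP; split => w /=; rewrite (@sSE t.+1).
have mC : measurable (Psi t.+1 @^-1` A) by rewrite -[X in measurable X]setTI; exact: mPsi.
rewrite J// muleC; congr (_ * _)%E.
(* Without any constraint on the future, [J] identifies the remaining factor as the law of the next
   state. *)
have := J (fun=> setT) (fun=> measurableT) _ mC.
rewrite (_ : future _ _ = setT) ?setIT; last first.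
  by apply/seteqP; split.
by move=> ->; rewrite big1 ?mul1e// => i _; rewrite probability_setT.
Qed.

(** This plays the role of conditional expectation given the past: the state and the fresh sample
    have the product law, so Tonelli integrates the sample out at a frozen state. *)
Lemma integral_step t (h : S * Z -> \bar R) : (1 <= t <= T)%N ->
  measurable_fun [set: S * Z] h -> (forall p, 0 <= h p)%E ->
  (\int[P]_w h (s t w, z t w) = \int[P]_w \int[D]_y h (s t w, y))%E.
Proof.
move=> tT mh h0.
have tT1 : (1 <= t <= T.+1)%N by case/andP: tT => -> /= /leqW.
have ms := measurable_state tT1.
pose X : {mfun Omega >-> S} := HB.pack (s t) (isMeasurableFun.Build _ _ _ _ _ ms).
have mXY : measurable_fun setT (fun w => (X w, z t w)) by exact: measurable_fun_pair.
pose XY : {mfun Omega >-> (S * Z)%type} :=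
  HB.pack (fun w => (X w, z t w)) (isMeasurableFun.Build _ _ _ _ _ mXY).
transitivity (\int[distribution P XY]_p h p)%E.
  by rewrite ge0_integral_distribution.
transitivity (\int[(distribution P X \x D)%E]_p h p)%E.
  apply: eq_measure_integral => C mC _; apply/esym.
  apply: product_measure_unique => // A B mA mB.
  rewrite /distribution /pushforward/=.
  have := state_future_indep tT1 mA (E := fun k => if k == t then B else setT).
  rewrite (_ : future _ _ = z t @^-1` B); last first.
    apply/seteqP; split => w /=.
      by move=> /(_ t); rewrite eqxx; apply => /=; rewrite leqnn; case/andP: tT.
    by move=> H k _; case: eqVneq => [->|].
  move=> E1; transitivity (P (s t @^-1` A `&` z t @^-1` B)) => //.
  rewrite E1; last by move=> k; case: ifP.
  congr (_ * _)%E; case/andP: tT => t1 t2.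
  rewrite big_ltn// eqxx big_nat big1 ?mule1// => i /andP[ti _].
  by rewrite gtn_eqF// probability_setT.
rewrite fubini_tonelli1// -[RHS](@ge0_integral_distribution _ _ _ _ _ P X (fun x => \int[D]_y h (x, y))%E)//.
  exact: measurable_fun_fubini_tonelli_F.
by move=> x; exact: integral_ge0.
Qed.

(** Transfers an almost sure property of the sample, known at each fixed state with its own null
    set, to the random state: [integral_step] for the indicator of [C]. *)
Lemma null_step t (C : set (S * Z)) : (1 <= t <= T)%N -> measurable C ->
  (forall x, D (xsection C x) = 0%E) ->
  P ((fun w => (s t w, z t w)) @^-1` C) = 0%E.
Proof.
move=> tT mC C0.
have tT1 : (1 <= t <= T.+1)%N by case/andP: tT => -> /= /leqW.
have ms := measurable_state tT1.
have mXY : measurable_fun setT (fun w => (s t w, z t w)) by exact: measurable_fun_pair.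
have mXC : measurable ((fun w => (s t w, z t w)) @^-1` C).
  by rewrite -[X in measurable X]setTI; exact: mXY.
have mC1 : measurable_fun setT (fun p : S * Z => (\1_C p : R)%:E).
  by apply/measurable_EFinP; exact: measurable_indic.
have C1_ge0 (p : S * Z) : (0 <= (\1_C p : R)%:E)%E by rewrite lee_fin.
have := integral_step tT mC1 C1_ge0.
rewrite [RHS]integral0_eq; last first.
  move=> w _; rewrite -[RHS](C0 (s t w)) -[in RHS](setIT (xsection _ _)) -integral_indic//.
    by apply: eq_integral => y _; rewrite /= !indicE mem_xsection.
  exact: measurable_xsection.
by move=> <-; rewrite -[in LHS](setIT (_ @^-1` _)) -integral_indic.
Qed.

End Markov.
(* Ville's maximal inequality for the exponential supermartingale
   [exp (\sum_k phi_k)], run until it first exceeds [expR l]. *)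
Lemma exp_supermartingale_bound (R : realType) (dO dS dZ : measure_display)
    (Omega : measurableType dO) (S : measurableType dS) (Z : measurableType dZ)
    (P : probability Omega R) (D : probability Z R) (T : nat)
    (z : nat -> {RV P >-> Z}) (s1 : S) (s : nat -> Omega -> S)
    (Psi : nat -> S * Z -> S) (phi : nat -> S * Z -> R) (l : R) :
  iid_samples D T z ->
  (forall t, measurable_fun setT (Psi t)) ->
  (forall w, s 1%N w = s1) ->
  (forall t w, (1 <= t <= T)%N -> s t.+1 w = Psi t (s t w, z t w)) ->
  (forall t, measurable_fun setT (phi t)) ->
  (forall t x, (\int[D]_y (expR (phi t (x, y)))%:E <= 1)%E) ->
  0 <= l ->
  exists2 B : set Omega, measurable B /\ (P B <= (expR (- l))%:E)%E &
    forall w, ~ B w -> forall n, (n <= T)%N ->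
      \sum_(1 <= k < n.+1) phi k (s k w, z k w) <= l.
Proof.
move=> iid mPsi s1E sSE mphi phi1 l0.
pose a := expR l.
(* [m t] is the exponential of the sum over [k < t], frozen once it exceeds [a]; [m 0] is a filler.
   It is adjoined to the state below so that [integral_step] applies to it. *)
pose m := fix m (t : nat) (w : Omega) : R :=
  if t is t'.+1 then
    if t' is 0 then 1 else
    if m t' w <= a then m t' w * expR (phi t' (s t' w, z t' w)) else m t' w
  else 1.
pose s' t w : S * R := (s t w, m t w).
pose Psi' t (p : S * R * Z) : S * R :=
  (Psi t (p.1.1, p.2),
   if p.1.2 <= a then p.1.2 * expR (phi t (p.1.1, p.2)) else p.1.2).
have msz : measurable_fun setT (fun p : S * R * Z => (p.1.1, p.2)).
  apply: measurable_fun_pair => //.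
  exact: (measurableT_comp measurable_fst measurable_fst).
have mm : measurable_fun setT (fun p : S * R * Z => p.1.2).
  exact: (measurableT_comp measurable_snd measurable_fst).
have mm' t : measurable_fun setT (fun p : S * R * Z =>
    if p.1.2 <= a then p.1.2 * expR (phi t (p.1.1, p.2)) else p.1.2).
  apply: measurable_fun_ifT => //.
    by apply: measurable_fun_ler => //; exact: measurable_cst.
  apply: measurable_funM => //; apply: measurableT_comp => //.
  exact: (measurableT_comp (mphi t)).
have mPsi' t : measurable_fun setT (Psi' t).
  by apply: measurable_fun_pair => //; exact: (measurableT_comp (mPsi t)).
have s1E' w : s' 1%N w = (s1, 1) by rewrite /s' s1E.
have sSE' t w : (1 <= t <= T)%N -> s' t.+1 w = Psi' t (s' t w, z t w).
  by move=> tT; rewrite /s' /Psi'/= sSE//; case: t tT.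
have m0 t w : 0 <= m t w.
  elim: t => [|[|t] IH] //=; case: ifP => // _; apply: mulr_ge0 => //; exact: expR_ge0.
have mT t : (1 <= t <= T.+1)%N -> measurable_fun setT (m t).
  move=> tT; have := measurable_state mPsi' s1E' sSE' tT => H.
  exact: (measurableT_comp measurable_snd H).
have Em t : (1 <= t <= T.+1)%N -> (\int[P]_w (m t w)%:E <= 1)%E.
  elim: t => // t IH /andP[_ tT]; case: t => [|t] in IH tT *.
    rewrite (eq_integral (fun=> 1%:E))// integral_cst//= mul1e.
    exact: probability_le1.
  apply: le_trans (IH _); last by rewrite /= ltnW.
  have tT' : (1 <= t.+1 <= T)%N by [].
  (* [integral_step] needs an integrand that is nonnegative at all states, also at those whose
     second component is negative; along the process the absolute value changes nothing. *)
  have mh : measurable_fun setT (fun p : S * R * Z => (`|(Psi' t.+1 p).2|)%:E).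
    by apply/measurable_EFinP; apply: measurableT_comp => //; exact: mm'.
  have h0 (p : S * R * Z) : (0 <= (`|(Psi' t.+1 p).2|)%:E)%E by rewrite lee_fin.
  have := integral_step iid mPsi' s1E' sSE' tT' mh h0.
  rewrite (eq_integral (fun w => (m t.+2 w)%:E)); last first.
    move=> w _; rewrite -(ger0_norm (m0 t.+2 w)).
    by rewrite -[m t.+2 w]/((s' t.+2 w).2) (@sSE' t.+1).
  move=> ->; apply: ge0_le_integral => //.
  - by move=> x _; exact: integral_ge0.
  - rewrite (_ : (fun _ => _) =
      (fun x : S * R => \int[D]_y (`|(Psi' t.+1 (x, y)).2|)%:E)%E \o s' t.+1)//.
    apply: measurableT_comp; last by apply: (measurable_state mPsi' s1E' sSE'); rewrite /= ltnW.
    exact: (measurable_fun_fubini_tonelli_F (fun p : S * R * Z => (`|(Psi' t.+1 p).2|)%:E)).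
  - by apply/measurable_EFinP; apply: mT; rewrite /= ltnW.
  move=> w _; rewrite /s'; have := m0 t.+1 w.
  move: (m t.+1 w) (s t.+1 w) => q x q0; rewrite /Psi'/=; case: (q <= a); last first.
    have := integral_cst D measurableT q%:E.
    rewrite ger0_norm// /cst => ->.
    by rewrite -[leRHS]mule1 lee_pmul// ?lee_fin// probability_le1.
  rewrite (eq_integral (fun y => q%:E * (expR (phi t.+1 (x, y)))%:E)%E); last first.
    by move=> y _; rewrite ger0_norm// mulr_ge0// expR_ge0.
  rewrite ge0_integralZl_EFin//; last first.
    apply/measurable_EFinP; apply: measurableT_comp => //.
    exact: measurable_fun_pair2.
  by rewrite -[leRHS]mule1 lee_pmul// ?integral_ge0// lee_fin.
have mT1 : measurable_fun setT (EFin \o m T.+1).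
  by apply/measurable_EFinP; apply: mT; rewrite /= ltnSn.
(* Markov's inequality at the single time [T.+1] suffices: a value that has crossed [a] is frozen,
   so the crossing is still visible at the end. *)
exists (setT `&` [set w | (a%:E <= `|(EFin \o m T.+1) w|)%E]).
  split.
    apply: emeasurable_fun_c_infty => //; exact: measurableT_comp.
  have := le_integral_abse P measurableT mT1 (expR_gt0 l).
  rewrite -/a => H.
  have : (a%:E * P (setT `&` [set w | (a%:E <= `|(EFin \o m T.+1) w|)%E]) <= 1)%E.
    apply: le_trans H _; apply: le_trans (Em T.+1 _) => //; last by rewrite /= ltnSn.
    rewrite le_eqVlt; apply/orP; left; apply/eqP; apply: eq_integral => w _.
    by rewrite -[LHS]/((`|m T.+1 w|)%:E) ger0_norm.
  rewrite expRN -/a => H2.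
  have a0 : 0 < a by exact: expR_gt0.
  by rewrite -[leRHS]mule1 lee_pdivlMl.
move=> w wB n nT.
have up k j : (0 < k)%N -> a < m k w -> a < m (k + j)%N w.
  case: k => // k _ mk; elim: j => [|j IH]; first by rewrite addn0.
  rewrite addnS.
  rewrite -[X in a < X]/(if m (k.+1 + j)%N w <= a then _ else m (k.+1 + j)%N w).
  by rewrite leNgt IH.
have mle k : (1 <= k <= T.+1)%N -> m k w <= a.
  move=> /andP[k1 kT]; rewrite leNgt; apply/negP => /(up _ (T.+1 - k)%N k1).
  rewrite subnKC// => H; apply: wB; split => //.
  suff : (a%:E <= (`|m T.+1 w|)%:E)%E by [].
  by rewrite lee_fin ger0_norm// ltW.
have mE k : (k <= T)%N -> m k.+1 w = expR (\sum_(1 <= i < k.+1) phi i (s i w, z i w)).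
  elim: k => [_|k IH kT]; first by rewrite big_geq// expR0.
  rewrite big_nat_recr//= expRD -IH; last exact: ltnW.
  by rewrite -[LHS]/(if m k.+1 w <= a then _ else _) mle//= ltnW.
by rewrite -ler_expR -mE// mle.
Qed.

(** * Borel measurability of vector operations *)

Section BorelVectors.
Context {R : realType} {d : nat} {dT : measure_display} {T : measurableType dT}.

(** An open set is the union of the boxes with rational centre and radius [n.+1^-1] that it
    contains. There are countably many, and the preimage of a box is a finite intersection of
    conditions on coordinates. *)
Lemma measurable_rV (h : T -> borel_rV R d) :
  (forall i, measurable_fun setT (fun t => (h t : 'rV[R]_d) 0 i)) ->
  measurable_fun setT h.
Proof.
move=> mh; apply: (@measurability _ _ T (borel_rV R d) setT h (@open 'rV[R]_d)) => //.
move=> _ [U oU <-]; rewrite setTI.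
pose box (p : {ffun 'I_d -> rat} * nat) : set 'rV[R]_d :=
  [set y | forall i, `|y 0 i - ratr (p.1 i)| < p.2.+1%:R^-1].
pose F n := if unpickle n is Some p then
  if `[< box p `<=` U >] then h @^-1` box p else set0 else set0.
have -> : h @^-1` U = \bigcup_n F n.
  apply/seteqP; split => t /=.
    move=> Uht; have : nbhs (h t : 'rV[R]_d) U by exact: open_nbhs_nbhs.
    move=> /(nbhs_ballP (h t : 'rV[R]_d))[e /= e0 eU].
    (* Two points of a box differ by less than twice its radius in each coordinate, so
       [2 / n.+1 <= e] keeps the box inside the ball. *)
    pose n := Num.trunc (2 / e).
    have n0 : 0 < (n.+1%:R : R)^-1 by rewrite invr_gt0.
    have ne : 2 * n.+1%:R^-1 <= e.
      have := truncnS_gt (2 / e).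
      by rewrite -/n ltr_pdivrMr// mulrC => /ltW; rewrite ler_pdivrMr// mulrC.
    have Q i : exists q : rat, `|(h t : 'rV[R]_d) 0 i - ratr q| < n.+1%:R^-1.
      move: n0; set r : R := _^-1 => n0.
      have /rat_in_itvoo[q] : (h t : 'rV[R]_d) 0 i - r < (h t : 'rV[R]_d) 0 i + r by lra.
      rewrite in_itv/= => /andP[q1 q2]; exists q.
      by rewrite ltr_norml; apply/andP; split; lra.
    pose q := [ffun i => projT1 (cid (Q i))].
    have hq : box (q, n) (h t) by move=> i /=; rewrite ffunE; case: cid.
    exists (pickle (q, n)) => //; rewrite /F pickleK ifT//.
    apply/asboolP => y yq; apply: eU; split => // a i; rewrite ord1.
    have := yq i; have := hq i => /= H1 H2.
    rewrite /ball/= (le_lt_trans (ler_distD (ratr (q i)) _ _))//.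
    rewrite (lt_le_trans _ ne)// mulr_natl mulr2n ltrD// distrC//.
  move=> [n _]; rewrite /F; case: unpickle => // p; case: ifPn => // /asboolP pU.
  exact: pU.
apply: bigcupT_measurable => n; rewrite /F.
case: unpickle => // p; case: ifPn => // _.
have -> : h @^-1` box p = \bigcap_(i in [set: 'I_d])
    (fun t => `|(h t : 'rV[R]_d) 0 i - ratr (p.1 i)|) @^-1` [set x | x < p.2.+1%:R^-1].
  by apply/seteqP; split => t /=; [move=> H i _; exact: H|move=> H i; exact: H].
apply: fin_bigcap_measurable => // i _.
rewrite -[X in measurable X]setTI.
have mf : measurable_fun setT (fun t => `|(h t : 'rV[R]_d) 0 i - ratr (p.1 i)|).
  by apply: measurableT_comp => //; apply: measurable_funB.
apply: mf => //.
rewrite (_ : [set _ | _] = `]-oo, p.2.+1%:R^-1[%classic)//.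
Qed.

Lemma measurable_continuous_rV (f : 'rV[R]_d -> R) : continuous f ->
  measurable_fun [set: borel_rV R d] (f : borel_rV R d -> R).
Proof.
move=> /continuousP cf; apply: (measurability _ (RGenOpens.measurableE R)).
move=> _ [_ [a [b ->] <-]]; rewrite setTI; apply: sub_sigma_algebra.
exact/cf/interval_open.
Qed.

End BorelVectors.

Section BorelOps.
Context {R : realType} {d : nat} {dT : measure_display} {T : measurableType dT}.
Implicit Types (h k : T -> borel_rV R d) (a : T -> R).

Lemma measurable_coord h i : measurable_fun setT h ->
  measurable_fun setT (fun t => (h t : 'rV[R]_d) 0 i).
Proof.
move=> mh; have mc : measurable_fun [set: borel_rV R d]
    (fun u : borel_rV R d => (u : 'rV[R]_d) 0 i).
  by apply: measurable_continuous_rV; exact: coord_continuous.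
exact: (measurableT_comp mc mh).
Qed.

Lemma measurable_rVD h k : measurable_fun setT h -> measurable_fun setT k ->
  measurable_fun setT (fun t => ((h t : 'rV[R]_d) + k t) : borel_rV R d).
Proof.
move=> mh mk; apply: measurable_rV => i.
under eq_fun do rewrite mxE.
by apply: measurable_funD; exact: measurable_coord.
Qed.

Lemma measurable_rVZ a h : measurable_fun setT a -> measurable_fun setT h ->
  measurable_fun setT (fun t => (a t *: (h t : 'rV[R]_d)) : borel_rV R d).
Proof.
move=> ma mh; apply: measurable_rV => i.
under eq_fun do rewrite mxE.
by apply: measurable_funM => //; exact: measurable_coord.
Qed.

Lemma measurable_rVB h k : measurable_fun setT h -> measurable_fun setT k ->
  measurable_fun setT (fun t => ((h t : 'rV[R]_d) - k t) : borel_rV R d).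
Proof.
move=> mh mk; apply: measurable_rV => i.
under eq_fun do rewrite !mxE.
by apply: measurable_funB; exact: measurable_coord.
Qed.

Lemma measurable_dotv h k : measurable_fun setT h -> measurable_fun setT k ->
  measurable_fun setT (fun t => dotv (h t) (k t)).
Proof.
move=> mh mk; apply: measurable_sum => i.
by apply: measurable_funM; exact: measurable_coord.
Qed.

Lemma measurable_sqrtr a : measurable_fun setT a ->
  measurable_fun setT (fun t => Num.sqrt (a t)).
Proof.
move=> ma; apply: (measurableT_comp _ ma); apply: continuous_measurable_fun.
exact: sqrt_continuous.
Qed.

Lemma measurable_enorm h : measurable_fun setT h ->
  measurable_fun setT (fun t => enorm (h t)).
Proof.
move=> mh; apply: measurable_sqrtr; apply: measurable_sum => i.
by apply: measurable_funX; exact: measurable_coord.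
Qed.

Lemma measurable_invr a : measurable_fun setT a ->
  (forall t, 0 < a t) -> measurable_fun setT (fun t => (a t)^-1).
Proof.
(* By positivity the inverse is [exp (- ln a)], a composition of measurable functions. *)
move=> ma a0; under eq_fun => t do rewrite -[a t]lnK ?posrE// -expRN.
apply: measurableT_comp => //; apply: measurableT_comp => //.
exact: (measurableT_comp (@measurable_ln R)).
Qed.

End BorelOps.

(** * Exponential moments of the noise *)

Lemma integral_affine_noise (R : realType) (d : nat) (dZ : measure_display)
    (Z : measurableType dZ) (D : probability Z R)
    (G : 'rV[R]_d -> Z -> 'rV[R]_d) (f : 'rV[R]_d -> R) (x c : 'rV[R]_d) :
  unbiased D G f ->
  D.-integrable setT (EFin \o (fun z => 1 + dotv c (G x z - grad f x))) /\
  (\int[D]_z (1 + dotv c (G x z - grad f x))%:E = 1)%E.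
Proof.
move=> unb.
pose h i z : \bar R := ((c 0 i)%:E * ((G x z 0 i)%:E - (grad f x 0 i)%:E))%E.
have iG i : D.-integrable setT (fun z => (G x z 0 i)%:E) by case: (unb x i).
have ic k : D.-integrable setT (fun=> (k : R)%:E).
  exact: finite_measure_integrable_cst.
have iGB i : D.-integrable setT (fun z => (G x z 0 i)%:E - (grad f x 0 i)%:E)%E.
  by apply: integrableB => //; exact: ic.
have ih i : D.-integrable setT (h i) by exact: integrableZl.
have cst1 k : (\int[D]_z (k : R)%:E = k%:E)%E.
  have := integral_cst D measurableT k%:E.
  by rewrite [X in (_ * X)%E]probability_setT mule1.
have h0 i : (\int[D]_z h i z = 0)%E.
  rewrite integralZl// integralB//.
  have [_ Ei] := unb x i; rewrite unlock in Ei.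
  by rewrite [X in (X - _)%E]Ei cst1 subee// mule0.
have E z : ((1 + dotv c (G x z - grad f x))%:E = 1%:E + \sum_(i < d) h i z)%E.
  rewrite EFinD /dotv -sumEFin; congr (_ + _)%E; apply: eq_bigr => i _.
  have mE (u v : 'rV[R]_d) : (u - v) 0 i = u 0 i - v 0 i by rewrite !mxE.
  by rewrite mE EFinM EFinB.
have isum : D.-integrable setT (fun z => \sum_(i < d) h i z)%E.
  by apply: integrable_sum => // i _; exact: ih.
split.
  rewrite (_ : EFin \o _ = (fun=> 1%:E) \+ (fun z => \sum_(i < d) h i z))%E.
    by apply: integrableD => //; exact: ic.
  by apply/funext => z; rewrite /= E.
under eq_integral do rewrite E.
rewrite integralD// cst1 integral_sum// big1 ?adde0//.
Qed.

Lemma expR_noise_le1 (R : realType) (d : nat) (dZ : measure_display)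
    (Z : measurableType dZ) (D : probability Z R)
    (G : 'rV[R]_d -> Z -> 'rV[R]_d) (f : 'rV[R]_d -> R) (x c : 'rV[R]_d)
    (nu : R) (phi : 'rV[R]_d -> R) :
  unbiased D G f ->
  {ae D, forall z, enorm (G x z - grad f x) ^+ 2 <= nu} ->
  measurable_fun setT (fun z => phi (G x z)) ->
  (forall y, enorm (y - grad f x) ^+ 2 <= nu ->
    expR (phi y) <= 1 + dotv c (y - grad f x)) ->
  (\int[D]_z (expR (phi (G x z)))%:E <= 1)%E.
Proof.
move=> unb hnu mphi hphi.
have [iY EY] := integral_affine_noise x c unb.
pose Y z := 1 + dotv c (G x z - grad f x).
have mY : measurable_fun setT Y by apply/measurable_EFinP; exact: measurable_int iY.
(* The affine majorant is known to be nonnegative only almost surely; truncation at 0 permits the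
   comparison of nonnegative integrals and changes the integrand on a null set only. *)
apply: (@le_trans _ _ (\int[D]_z (Num.max 0 (Y z))%:E)%E).
  apply: ae_ge0_le_integral => //.
  - by apply/measurable_EFinP; exact: measurableT_comp.
  - by move=> z _; rewrite lee_fin le_max lexx.
  - by apply/measurable_EFinP; exact: measurable_maxr.
  by move: hnu; apply: filterS => z hz _; rewrite lee_fin le_max hphi ?orbT.
rewrite le_eqVlt; apply/orP; left; apply/eqP; rewrite -EY.
apply: ae_eq_integral => //.
- by apply/measurable_EFinP; exact: measurable_maxr.
- exact: measurable_int iY.
move: hnu; apply: filterS => z hz _; congr EFin.
by rewrite max_r// (le_trans (expR_ge0 _) (hphi _ hz)).
Qed.

(** * The four supermartingales *)

Section Processes.
Context {R : realType} {d : nat}.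
Variables (f : 'rV[R]_d -> R) (A B C eta G0 fstar cap M lam V : R) (xs : 'rV[R]_d).
Implicit Types (y gv : 'rV[R]_d) (q : R).

Definition noise_bound y :=
  A * (f y - fstar) + B * enorm (grad f y) ^+ 2 + C.

(* A step size that upper-bounds the next gradient by its worst case, so that
   it does not depend on the next sample. The absolute value only matters for
   unreachable states. *)
Definition decorrelated_step y q :=
  eta / Num.sqrt (G0 ^+ 2 + `|q| +
    (enorm (grad f y) + Num.sqrt (noise_bound y)) ^+ 2).

(** The noise term of the descent inequality, scaled by [lam], minus Hoeffding's compensator: half
    the square of the largest absolute value of the linear term. *)
Definition descent_process y q gv : R :=
  if f y - fstar <= cap then
    dotv (- (lam * decorrelated_step y q) *: grad f y) (gv - grad f y) -
    (lam * decorrelated_step y q * enorm (grad f y) *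
      Num.sqrt (noise_bound y)) ^+ 2 / 2
  else 0.

(** With noise of norm at most [Num.sqrt M], the multiplier [- M^-1] makes the compensator equal to
    [|grad f y| ^ 2 / (2 * M)]. So [- 2 * M] times the process is exactly the part of [|gv| ^ 2]
    beyond the squared noise. *)
Definition energy_process y (q : R) gv : R :=
  if f y - fstar <= cap then
    dotv (- M^-1 *: grad f y) (gv - grad f y) -
    (M^-1 * enorm (grad f y) * Num.sqrt M) ^+ 2 / 2
  else 0.

(** The step is the one before the current sample. The compensator is the realised square instead of
    the worst case, since only the realised weighted sum of squared noise has a logarithmic
    bound. *)
Definition distance_process y q gv : R :=
  let s := dotv (- (lam * (eta / Num.sqrt (G0 ^+ 2 + `|q|))) *: (y - xs))
    (gv - grad f y) in
  if (f y - fstar <= cap) && (enorm (y - xs) <= V) then s - s ^+ 2 else 0.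

(** The compensator keeps the noise bound at [y] itself, so that it can later be compared with the
    gap at [y]; hence the cut-off concerns the distance alone. *)
Definition regret_process y (q : R) gv : R :=
  if enorm (y - xs) <= V then
    dotv (- lam *: (y - xs)) (gv - grad f y) -
    (lam * V * Num.sqrt (noise_bound y)) ^+ 2 / 2
  else 0.

(* The property that makes [expR (\sum phi)] a supermartingale under unbiased
   noise of squared norm at most [noise_bound]. *)
Definition fair (phi : 'rV[R]_d -> R -> 'rV[R]_d -> R) := forall y q,
  exists c, forall gv, enorm (gv - grad f y) ^+ 2 <= noise_bound y ->
    expR (phi y q gv) <= 1 + dotv c (gv - grad f y).

Lemma fair0 y : exists c, forall gv, enorm (gv - grad f y) ^+ 2 <= noise_bound y ->
    expR 0 <= 1 + dotv c (gv - grad f y).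
Proof. by exists 0 => gv _; rewrite dotv0l expR0 addr0. Qed.

Lemma fair_hoeffding y c k : 0 <= k ->
  enorm c * Num.sqrt (noise_bound y) <= k ->
  exists c', forall gv, enorm (gv - grad f y) ^+ 2 <= noise_bound y ->
    expR (dotv c (gv - grad f y) - k ^+ 2 / 2) <= 1 + dotv c' (gv - grad f y).
Proof.
move=> k0 ck; have [s hs] := hoeffding_chord k0; exists (s *: c) => gv hgv.
rewrite dotvZl; apply: hs; apply: le_trans (normr_dotv _ _) _; apply: le_trans ck.
rewrite ler_wpM2l ?enorm_ge0// -[leLHS](ger0_norm (enorm_ge0 (gv - grad f y))) -sqrtr_sqr.
exact: ler_wsqrtr.
Qed.

Hypotheses (eta0 : 0 < eta) (G00 : 0 < G0) (lam0 : 0 <= lam) (M0 : 0 < M) (V0 : 0 <= V).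

Lemma decorrelated_step_ge0 y q : 0 <= decorrelated_step y q.
Proof. by rewrite divr_ge0 ?sqrtr_ge0// ltW. Qed.

Lemma fair_descent : fair descent_process.
Proof.
move=> y q; rewrite /descent_process; case: (_ <= cap); last exact: fair0.
have h0 : 0 <= lam * decorrelated_step y q.
  by apply: mulr_ge0 => //; exact: decorrelated_step_ge0.
apply: fair_hoeffding.
  by apply: mulr_ge0; rewrite ?sqrtr_ge0//; apply: mulr_ge0; rewrite ?enorm_ge0.
by rewrite enormZ normrN ger0_norm.
Qed.

Lemma fair_energy : (forall y, f y - fstar <= cap -> noise_bound y <= M) ->
  fair energy_process.
Proof.
move=> hM y q; rewrite /energy_process; case: (boolP (_ <= cap)) => hcap; last exact: fair0.
apply: fair_hoeffding.
  by rewrite !mulr_ge0 ?enorm_ge0 ?sqrtr_ge0// invr_ge0 ltW.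
rewrite enormZ normrN ger0_norm ?invr_ge0 ?(ltW M0)// ler_wpM2l//.
  by rewrite mulr_ge0 ?enorm_ge0// invr_ge0 ltW.
exact/ler_wsqrtr/hM.
Qed.

Lemma fair_distance : (forall y, f y - fstar <= cap -> noise_bound y <= M) ->
  lam * (eta / G0) * V * Num.sqrt M <= 1 / 3 ->
  fair distance_process.
Proof.
move=> hM hl y q; rewrite /distance_process.
case: (boolP (_ && _)) => [/andP[hcap hV]|_]; last exact: fair0.
pose c := - (lam * (eta / Num.sqrt (G0 ^+ 2 + `|q|))) *: (y - xs).
exists c => gv hgv.
apply: expR_sub_sqr_le; apply: le_trans hl.
apply: le_trans (normr_dotv _ _) _.
have l1 : 0 <= lam * (eta / Num.sqrt (G0 ^+ 2 + `|q|)).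
  by rewrite mulr_ge0// divr_ge0 ?sqrtr_ge0// ltW.
rewrite /c enormZ normrN ger0_norm//.
have e1 : lam * (eta / Num.sqrt (G0 ^+ 2 + `|q|)) <= lam * (eta / G0).
  rewrite ler_wpM2l// ler_wpM2l ?(ltW eta0)// lef_pV2 ?posrE ?sqrtr_gt0//; last first.
    by rewrite ltr_wpDr// exprn_gt0.
  by rewrite -[leLHS](ger0_norm (ltW G00)) -sqrtr_sqr ler_wsqrtr// lerDl.
have e2 : enorm (gv - grad f y) <= Num.sqrt M.
  rewrite -[leLHS](ger0_norm (enorm_ge0 (gv - grad f y))) -sqrtr_sqr.
  by apply: ler_wsqrtr; apply: le_trans hgv (hM _ hcap).
apply: ler_pM => //; [exact: mulr_ge0 l1 (enorm_ge0 _) | exact: enorm_ge0 |].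
by apply: ler_pM => //; exact: enorm_ge0.
Qed.

Lemma fair_regret : fair regret_process.
Proof.
move=> y q; rewrite /regret_process; case: (boolP (_ <= V)) => hV; last exact: fair0.
apply: fair_hoeffding; first by rewrite !mulr_ge0 ?sqrtr_ge0.
rewrite enormZ normrN ger0_norm// ler_wpM2r ?sqrtr_ge0// ler_wpM2l//.
Qed.

End Processes.

(** * Sums and constants *)

Section Sums.
Context {R : realType}.
Implicit Types (a q : nat -> R) (r M K : R).

Lemma sum_ge0 a n : (forall k, 0 <= a k) -> 0 <= \sum_(1 <= k < n) a k.
Proof. by move=> a0; apply: sumr_ge0. Qed.

Lemma sum_div_le_ln a r n : 0 < r -> (forall k, 0 <= a k) ->
  \sum_(1 <= k < n.+1) a k / (r + \sum_(1 <= j < k.+1) a j) <=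
  ln (1 + (\sum_(1 <= k < n.+1) a k) / r).
Proof.
move=> r0 a0.
have P m : 0 < r + \sum_(1 <= j < m) a j by rewrite ltr_wpDr// sum_ge0.
suff : \sum_(1 <= k < n.+1) a k / (r + \sum_(1 <= j < k.+1) a j) <=
  ln (r + \sum_(1 <= k < n.+1) a k) - ln r.
  move=> /le_trans; apply; rewrite -ln_div ?posrE// mulrDl divff ?gt_eqF//.
elim: n => [|n IH]; first by rewrite !big_geq// addr0 subrr.
rewrite big_nat_recr//=; apply: le_trans (lerD IH (lexx _)) _.
have := ln_increment (a0 n.+1) (P n.+1).
rewrite -addrA -big_nat_recr//=; lra.
Qed.

Lemma sum_div_sqrt_le a r n : 0 < r -> (forall k, 0 <= a k) ->
  \sum_(1 <= k < n.+1) a k / Num.sqrt (r + \sum_(1 <= j < k.+1) a j) <=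
  2 * (Num.sqrt (r + \sum_(1 <= k < n.+1) a k) - Num.sqrt r).
Proof.
move=> r0 a0.
have P m : 0 < r + \sum_(1 <= j < m) a j by rewrite ltr_wpDr// sum_ge0.
elim: n => [|n IH]; first by rewrite !big_geq// addr0 subrr mulr0.
rewrite big_nat_recr//=; apply: le_trans (lerD IH (lexx _)) _.
have := sqrt_increment (a0 n.+1) (P n.+1).
rewrite -addrA -big_nat_recr//=; lra.
Qed.

(* The partial sums [S] of [a] control [q] only up to the defect [K]: the terms
   with [S <= 2 * (M + K)] are bounded by [a / r], and for the others
   [q >= S / 2]. *)
Lemma sum_div_le_ln_defect a q r M K n : 0 < r -> 0 <= M -> 0 <= K ->
  (forall k, (1 <= k <= n)%N -> 0 <= a k <= M) ->
  (forall k, (1 <= k <= n)%N -> 0 <= q k) ->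
  (forall k, (1 <= k <= n)%N -> \sum_(1 <= j < k) a j - K <= q k) ->
  \sum_(1 <= k < n.+1) a k / (r + q k) <=
  2 * ln (1 + (\sum_(1 <= k < n.+1) a k) / (2 * r)) + 2 * (M + K) / r.
Proof.
move=> r0 M0 K0 aM q0 aq.
pose S m := \sum_(1 <= j < m.+1) a j.
have S0 m : (m <= n)%N -> 0 <= S m.
  move=> mn; rewrite /S big_nat sumr_ge0// => i /andP[i1 im].
  by have /andP[] := aM i (introT andP (conj i1 (leq_trans (im : (i <= m)%N) mn))).
suff H m : (m <= n)%N -> \sum_(1 <= k < m.+1) a k / (r + q k) <=
  2 * (ln (r + S m / 2) - ln r) + Num.min (S m) (2 * (M + K)) / r.
  apply: le_trans (H n (leqnn n)) _; apply: lerD.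
    rewrite ler_pM2l// -ln_div ?posrE//; last by have := S0 n (leqnn n); lra.
    rewrite -/(S n) le_eqVlt; apply/orP; left; apply/eqP; congr ln.
    by field; rewrite gt_eqF.
  by rewrite ler_wpM2r ?invr_ge0 ?(ltW r0)// ge_min lexx orbT.
elim: m => [_|m IH mn].
  rewrite /S !big_geq// mul0r addr0 subrr mulr0 add0r.
  rewrite divr_ge0 ?(ltW r0)// le_min lexx/=.
  by rewrite mulr_ge0// addr_ge0.
have mn1 : (1 <= m.+1 <= n)%N by [].
have /andP[a0 aM1] := aM _ mn1; have qq0 := q0 _ mn1; have aq1 := aq _ mn1.
rewrite big_nat_recr//=.
apply: le_trans (lerD (IH (ltnW mn)) (lexx _)) _.
have SE : S m.+1 = S m + a m.+1 by rewrite /S big_nat_recr.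
have Sm := S0 m (ltnW mn).
rewrite -/(S m) in aq1.
have [c1|c1] := leP (S m.+1) (2 * (M + K)).
  rewrite !min_l//; last by lra.
  have L1 : ln (r + S m / 2) <= ln (r + S m.+1 / 2).
    by rewrite ler_ln ?posrE; lra.
  have : a m.+1 / (r + q m.+1) <= a m.+1 / r.
    by rewrite ler_wpM2l// lef_pV2 ?posrE; lra.
  have -> : S m.+1 / r = S m / r + a m.+1 / r by rewrite SE mulrDl.
  lra.
(* Here [q m.+1 >= S m - K >= S m.+1 - (M + K) >= S m.+1 / 2]. *)
have L1 : a m.+1 / (r + q m.+1) <= 2 * (ln (r + S m.+1 / 2) - ln (r + S m / 2)).
  have h0 : 0 <= a m.+1 / 2 by lra.
  have p0 : 0 < r + S m / 2 by lra.
  have := ln_increment h0 p0.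
  have -> : r + S m / 2 + a m.+1 / 2 = r + S m.+1 / 2 by rewrite SE; lra.
  have : a m.+1 / (r + q m.+1) <= a m.+1 / (r + S m.+1 / 2).
    by rewrite ler_wpM2l// lef_pV2 ?posrE; lra.
  have -> : a m.+1 / 2 / (r + S m.+1 / 2) = (a m.+1 / (r + S m.+1 / 2)) / 2.
    by rewrite mulrAC.
  lra.
have L2 : Num.min (S m) (2 * (M + K)) / r <= 2 * (M + K) / r.
  by rewrite ler_wpM2r ?invr_ge0 ?(ltW r0)// ge_min lexx orbT.
lra.
Qed.

End Sums.

(** * Closing the inequalities between the constants *)

Section Constants.
Context {R : realType}.

Lemma cap_ge0 (D1 eta L m C lT F cap : R) :
  0 <= D1 -> 0 < eta -> 0 < L -> 0 < m -> 0 <= lT -> 0 <= F ->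
  cap = 4 * D1 + 8 * L * eta ^+ 2 * F + 36 * eta ^+ 2 * m * lT ^+ 2
      + 12 * eta * Num.sqrt C * lT + 64 * eta ^+ 2 * m * F ^+ 2
      + 16 * eta * Num.sqrt C * F + 10 * L * eta ^+ 2 ->
  0 <= cap.
Proof.
move=> D0 eta0 L0 m0 lT0 F0 ->; have c0 := sqrtr_ge0 C.
rewrite !addr_ge0//; repeat (apply: mulr_ge0 => //);
  by rewrite ?sqr_ge0 ?(ltW eta0) ?(ltW L0) ?(ltW m0).
Qed.

(** The noise level depends on the cap through [Num.sqrt (m * cap + C)]. Splitting the root and
    applying Young's inequality with weight [4 * m] to its two occurrences returns [cap / 8] each,
    hence half of the cap after the outer factor 2; the explicit terms of the cap cover the rest. *)
Lemma cap_closed (D1 eta L m C l lT F cap : R) :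
  0 <= D1 -> 0 < eta -> 0 < L -> 0 < m -> 0 < C -> 0 <= l -> l <= lT -> 0 <= F ->
  cap = 4 * D1 + 8 * L * eta ^+ 2 * F + 36 * eta ^+ 2 * m * lT ^+ 2
      + 12 * eta * Num.sqrt C * lT + 64 * eta ^+ 2 * m * F ^+ 2
      + 16 * eta * Num.sqrt C * F + 10 * L * eta ^+ 2 ->
  2 * (D1 + eta * Num.sqrt (m * cap + C) * l +
    (2 * Num.sqrt (m * cap + C) / eta + 2 * L) * (eta ^+ 2 * F)) + L * eta ^+ 2
    <= cap.
Proof.
move=> D0 eta0 L0 m0 C0 l0 llT F0 capE.
have lT0 : 0 <= lT by lra.
have c0 := sqrtr_ge0 C.
have cap0 := cap_ge0 D0 eta0 L0 m0 lT0 F0 capE.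
have mc0 : 0 <= m * cap by rewrite mulr_ge0// ltW.
have := sqrtD_le mc0 (ltW C0).
set s := Num.sqrt (m * cap + C); set r := Num.sqrt (m * cap) => sr.
have r2 : r ^+ 2 = m * cap by rewrite sqr_sqrtr.
have m4 : 0 < 4 * m by rewrite mulr_gt0.
have y1 := young (eta * lT) r m4; have y2 := young (2 * eta * F) r m4.
have rE : r ^+ 2 / (2 * (4 * m)) = cap / 8 by rewrite r2; field; rewrite gt_eqF.
rewrite rE in y1 y2.
have s0 : 0 <= s := sqrtr_ge0 _.
have h1 : eta * s * l <= eta * lT * (r + Num.sqrt C).
  have : s * l <= (r + Num.sqrt C) * lT by apply: ler_pM.
  move=> /(ler_wpM2l (ltW eta0)); lra.
have -> : (2 * s / eta + 2 * L) * (eta ^+ 2 * F) = 2 * eta * F * s + 2 * L * eta ^+ 2 * F.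
  by field; rewrite gt_eqF.
have h2 : 2 * eta * F * s <= 2 * eta * F * (r + Num.sqrt C).
  by rewrite ler_wpM2l// !mulr_ge0// ltW.
have p1 : 0 <= eta ^+ 2 * m * lT ^+ 2 by rewrite !mulr_ge0 ?sqr_ge0// ltW.
have p2 : 0 <= eta * Num.sqrt C * lT by rewrite !mulr_ge0// ltW.
have p3 : 0 <= eta ^+ 2 * m * F ^+ 2 by rewrite !mulr_ge0 ?sqr_ge0// ltW.
have p4 : 0 <= eta * Num.sqrt C * F by rewrite !mulr_ge0// ltW.
have p5 : 0 <= L * eta ^+ 2 by rewrite !mulr_ge0 ?sqr_ge0// ltW.
have p6 : 0 <= L * eta ^+ 2 * F by rewrite mulr_ge0.
lra.
Qed.

Lemma noise_sum_ge (eta G0 M lT Rb : R) (T : nat) :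
  0 < G0 -> 0 < M ->
  Rb = 2 * eta ^+ 2 * ln (1 + T%:R * M / (2 * G0 ^+ 2))
      + 7 * eta ^+ 2 / G0 ^+ 2 * M * lT ->
  7 * (eta / G0 * Num.sqrt M) ^+ 2 * lT <= Rb.
Proof.
move=> G00 M0 ->; rewrite !exprMn sqr_sqrtr ?(ltW M0)// exprVn.
have G2 : 0 < G0 ^+ 2 by rewrite exprn_gt0.
have : 0 <= 2 * eta ^+ 2 * ln (1 + T%:R * M / (2 * G0 ^+ 2)).
  apply: mulr_ge0; first by rewrite mulr_ge0 ?sqr_ge0.
  by rewrite ln_ge0// lerDl divr_ge0// mulr_ge0// ltW.
lra.
Qed.

(** The first conjunct is the range condition of [fair_distance]. With [W = eta / G0 * s] it reduces
    to [48 * l * W <= V], where [48 ^ 2 / 7 * l * Rb] is dominated by [512 * th * Rb]; the 512 is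
    [32 * 16], the coefficient of [R_L] hidden in [A_T]. The second closes the induction on
    distances: the choice of [lam] leaves [V ^ 2 * (1 / 8 + 1 / 32)], and by
    [V ^ 2 <= 2 * (DL ^ 2 + eta ^ 2)] less than a third of [DL ^ 2] returns to the left side. *)
Lemma distance_closed (d1 eta G0 s l lT th F Rb DL : R) :
  0 <= d1 -> 0 < eta -> 0 < G0 -> 0 <= s -> 3 / 4 <= l -> l <= lT -> l <= th ->
  0 <= F -> 7 * (eta / G0 * s) ^+ 2 * lT <= Rb -> 0 < DL ->
  2 * d1 + 4 * Rb + 10 * eta ^+ 2 * F + eta ^+ 2 / 2 + 512 * th * Rb <= DL ^+ 2 ->
  let V := DL + eta in let lam := 16 * l / V ^+ 2 in
  lam * (eta / G0) * V * s <= 1 / 3 /\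
  d1 + 2 / lam * l + 2 * lam * V ^+ 2 * Rb + 2 * s * V * (eta / G0)
    + 4 * (eta ^+ 2 * F) <= DL ^+ 2.
Proof.
move=> d0 eta0 G00 s0 l34 llT lth F0; set W := eta / G0 * s => WR DL0 hD V lam.
have l0 : 0 < l by lra.
have V0 : 0 < V by rewrite addr_gt0.
have W0 : 0 <= W by rewrite mulr_ge0// divr_ge0 ?ltW.
have Rb0 : 0 <= Rb.
  have lT0 : 0 <= lT by lra.
  apply: le_trans WR; apply: mulr_ge0 => //; apply: mulr_ge0 => //; exact: sqr_ge0.
have e2F : 0 <= eta ^+ 2 * F by rewrite mulr_ge0 ?sqr_ge0.
have e2 : 0 <= eta ^+ 2 by exact: sqr_ge0.
have thR : l * Rb <= th * Rb by rewrite ler_wpM2r.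
have W2l : W ^+ 2 * l <= Rb / 7.
  have : W ^+ 2 * l <= W ^+ 2 * lT by rewrite ler_wpM2l ?sqr_ge0.
  lra.
have W2 : W ^+ 2 <= 4 / 21 * Rb.
  have : 3 / 4 * W ^+ 2 <= l * W ^+ 2 by rewrite ler_wpM2r ?sqr_ge0.
  lra.
split.
  have WV : 48 * (l * W) <= V.
    apply: (@le_trans _ _ DL); last by rewrite /V lerDl ltW.
    rewrite -(@ler_pXn2r _ 2%N) ?nnegrE ?(ltW DL0)//; last first.
      by apply: mulr_ge0 => //; apply: mulr_ge0 => //; exact: ltW.
    have : l * (W ^+ 2 * l) <= l * (Rb / 7) by rewrite ler_wpM2l// ltW.
    have -> : (48 * (l * W)) ^+ 2 = 2304 * (l * (W ^+ 2 * l)) by ring.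
    have : 0 <= l * Rb by rewrite mulr_ge0// ltW.
    lra.
  have -> : lam * (eta / G0) * V * s = 16 * (l * W) / V.
    by rewrite /lam /W; field; rewrite !gt_eqF.
  by rewrite ler_pdivrMr//; lra.
have -> : 2 / lam * l = V ^+ 2 / 8.
  by rewrite /lam; field; rewrite !gt_eqF.
have -> : 2 * lam * V ^+ 2 * Rb = 32 * (l * Rb).
  by rewrite /lam; field; rewrite gt_eqF.
have -> : 2 * s * V * (eta / G0) = 2 * (V * W) by rewrite /W; field; rewrite gt_eqF.
have VW : 2 * (V * W) <= V ^+ 2 / 32 + 32 * W ^+ 2.
  have c0 : 0 < 1 / 32 :> R by lra.
  have := young V W c0.
  have -> : W ^+ 2 / (2 * (1 / 32)) = 16 * W ^+ 2 by field.
  lra.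
have V2 : V ^+ 2 <= 2 * (DL ^+ 2 + eta ^+ 2).
  by have := sqr_ge0 (DL - eta); rewrite /V sqrrB sqrrD; lra.
have lR : 3 / 4 * Rb <= l * Rb by rewrite ler_wpM2r.
lra.
Qed.

(* The doubly logarithmic term of the theorem is only needed as an upper bound
   of [ln (1 / delta)]. *)
Lemma log_terms (T : nat) (delta : R) : (1 <= T)%N -> 0 < delta -> delta < 1 / 4 ->
  [/\ 3 / 4 <= ln (1 / delta), ln (1 / delta) <= ln (T%:R / delta) &
   ln (1 / delta) <=
     ln (60 * (ln (4 * T%:R) / ln 2) * ln (6 * T%:R) / delta)].
Proof.
move=> T1 d0 d1.
have T0 : 1 <= T%:R :> R by rewrite ler1n.
have di : 0 < delta^-1 by rewrite invr_gt0.
have mon (y : R) : 1 <= y -> ln (1 / delta) <= ln (y / delta).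
  by move=> y1; rewrite ler_ln ?posrE ?divr_gt0 ?ler_pM2r//; lra.
split; [|exact: mon|].
  (* The [3 / 4] is [1 - delta] at the worst [delta = 1 / 4]. *)
  have := @ln_ge1BV R (1 / delta); rewrite div1r invrK => /(_ di); lra.
apply: mon.
have ln2 : 0 < ln 2 :> R by rewrite ln_gt0 ?ltr1n.
have h1 : 1 <= ln (4 * T%:R) / ln 2 :> R.
  by rewrite ler_pdivlMr// mul1r ler_ln ?posrE; lra.
have h2 : 1 / 2 <= ln (6 * T%:R) :> R.
  apply: le_trans (ln_ge1BV _); last by lra.
  have : (6 * T%:R)^-1 <= 1 / 6 :> R by rewrite div1r lef_pV2 ?posrE; lra.
  lra.
have h3 : 1 * (1 / 2) <= ln (4 * T%:R) / ln 2 * ln (6 * T%:R) :> R.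
  by apply: ler_pM => //; lra.
rewrite -mulrA; lra.
Qed.

Lemma average_bound (T : nat) (S d1 eta G0 C l F K V a a' : R) :
  (1 <= T)%N -> 0 <= d1 -> 0 < eta -> 0 < G0 -> 0 <= l -> 0 <= F -> 0 <= C ->
  0 <= K -> 0 <= V -> 0 <= a ->
  S <= G0 / eta * d1 + 2 * eta * F * G0 + 4 * K ^+ 2 * a'
    + 2 * K * Num.sqrt (2 * C * T%:R) + 4 * V ^+ 2 * a * l
    + 3 * V * Num.sqrt (C * T%:R * l) ->
  S / T%:R <= (12 * a * V ^+ 2 * l + 2 * G0 * d1 / eta) * (1 / T%:R)
    + (4 * K ^+ 2 * a' + 4 * eta * F * G0) * (1 / T%:R)
    + (7 * V * Num.sqrt (C * l) + 4 * K * Num.sqrt (2 * C)) / Num.sqrt T%:R.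
Proof.
move=> T1 d0 eta0 G00 l0 F0 C0 K0 V0 a0.
have T0 : 0 < T%:R :> R by rewrite ltr0n.
have r0 : 0 < Num.sqrt T%:R :> R by rewrite sqrtr_gt0.
have r2 : Num.sqrt T%:R ^+ 2 = T%:R :> R by rewrite sqr_sqrtr// ltW.
have -> : Num.sqrt (2 * C * T%:R) = Num.sqrt (2 * C) * Num.sqrt T%:R.
  by rewrite sqrtrM// mulr_ge0.
have -> : Num.sqrt (C * T%:R * l) = Num.sqrt (C * l) * Num.sqrt T%:R.
  by rewrite mulrAC sqrtrM// mulr_ge0.
have p := sqrtr_ge0 (C * l); have p' := sqrtr_ge0 (2 * C).
move: (Num.sqrt (C * l)) (Num.sqrt (2 * C)) (Num.sqrt T%:R) p p' r0 r2.
move=> p p' r p0 p'0 r0 r2 hS.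
have h : S / T%:R <= (G0 / eta * d1 + 2 * eta * F * G0 + 4 * K ^+ 2 * a'
    + 2 * K * (p' * r) + 4 * V ^+ 2 * a * l + 3 * V * (p * r)) / T%:R.
  by rewrite ler_wpM2r// invr_ge0 ltW.
apply: le_trans h _.
have -> : (7 * V * p + 4 * K * p') / r = (7 * V * p * r + 4 * K * p' * r) / T%:R.
  by rewrite -r2; field; rewrite gt_eqF.
rewrite !div1r -!mulrDl ler_wpM2r ?invr_ge0 ?(ltW T0)//.
have q1 : 0 <= G0 / eta * d1 by apply: mulr_ge0 => //; apply: divr_ge0; exact: ltW.
have q2 : 0 <= eta * F * G0 by rewrite !mulr_ge0// ltW.
have q3 : 0 <= V ^+ 2 * a * l by rewrite !mulr_ge0 ?sqr_ge0.
have q4 : 0 <= V * (p * r) by rewrite !mulr_ge0// ltW.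
have q5 : 0 <= K * (p' * r) by rewrite !mulr_ge0// ltW.
have -> : 2 * G0 * d1 / eta = 2 * (G0 / eta * d1) by field; rewrite gt_eqF.
lra.
Qed.

End Constants.

(** * Averages of iterates and the gap between the two sequences *)

Section Template.
Context {R : realType} {d : nat}.

Lemma convex_average (f : 'rV[R]_d -> R) (y : nat -> 'rV[R]_d) (T : nat) :
  convex_function [set: convex_lmodType 'rV[R]_d] f -> (1 <= T)%N ->
  f (T%:R^-1 *: \sum_(1 <= t < T.+1) y t) <= (\sum_(1 <= t < T.+1) f (y t)) / T%:R.
Proof.
move=> cf; case: T => // T _; elim: T => [|T IH].
  by rewrite !big_nat1 invr1 scale1r mulr1.
have T0 : 0 < T.+1%:R :> R by [].
have T1 : 0 < T.+2%:R :> R by [].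
have E : T.+2%:R = T.+1%:R + 1 :> R by rewrite -natr1.
rewrite !(big_nat_recr T.+2)//=.
move: IH; set Y := \sum_(_ <= _ < _) y _; set FY := \sum_(_ <= _ < _) f _ => IH.
pose t : R := T.+1%:R / T.+2%:R.
have t0 : 0 <= t by rewrite divr_ge0.
have t1 : t <= 1 by rewrite ler_pdivrMr// mul1r ler_nat.
have t1E : 1 - t = T.+2%:R^-1 by rewrite /t E; field; rewrite gt_eqF// ltr_wpDl.
have := convex_comb cf (T.+1%:R^-1 *: Y) (y T.+2) t0 t1.
rewrite scalerA t1E (_ : t / T.+1%:R = T.+2%:R^-1); last first.
  by rewrite /t mulrAC divff ?mul1r// gt_eqF.
rewrite -scalerDr => /le_trans; apply.
have := ler_wpM2l t0 IH.
have -> : t * (FY / T.+1%:R) = FY / T.+2%:R.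
  by rewrite /t; field; rewrite !gt_eqF.
have -> : (FY + f (y T.+2)) / T.+2%:R = FY / T.+2%:R + T.+2%:R^-1 * f (y T.+2).
  by rewrite mulrDl [X in _ + X]mulrC.
by rewrite lerD2r.
Qed.

Variables (eta : R) (T : nat) (alpha th gm : nat -> R) (x xt xb g : nat -> 'rV[R]_d).
Hypotheses (eta0 : 0 <= eta) (alpha1 : forall t, (1 <= t <= T)%N -> 0 < alpha t <= 1).
Hypothesis x1 : xt 1%N = x 1%N.
Hypothesis xbE : forall t, (1 <= t <= T)%N ->
  xb t = alpha t *: x t + (1 - alpha t) *: xt t.
Hypothesis xSE : forall t, (1 <= t <= T)%N -> x t.+1 = x t - th t *: g t.
Hypothesis xtSE : forall t, (1 <= t <= T)%N -> xt t.+1 = xb t - gm t *: g t.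
Hypothesis th0 : forall t, (1 <= t <= T)%N -> 0 <= th t.
Hypothesis thg : forall t, (1 <= t <= T)%N -> th t * enorm (g t) <= eta.
Hypothesis mode : (forall t, (1 <= t <= T)%N -> gm t = th t) \/
  (forall t, (1 <= t <= T)%N -> alpha t = 2 / (t%:R + 1) /\ gm t = (1 + alpha t) * th t).

Lemma template_xb_sub t : (1 <= t <= T)%N -> xb t - x t = - ((1 - alpha t) *: (x t - xt t)).
Proof.
move=> tT; rewrite xbE//; apply/rowP => i; rewrite !mxE; ring.
Qed.

Lemma template_gap_step t : (1 <= t <= T)%N -> x t.+1 - xt t.+1 =
  (1 - alpha t) *: (x t - xt t) + (gm t - th t) *: g t.
Proof.
move=> tT; rewrite xSE// xtSE// xbE//; apply/rowP => i; rewrite !mxE; ring.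
Qed.

(* The gap [x t - xt t] is a weighted mean of the past steps, and with
   [alpha t = 2 / (t + 1)] the potential [t * |x t - xt t|^2] absorbs the squared
   distances of [xb] to [x]. *)
Lemma template_gap : (forall t, (1 <= t <= T)%N -> enorm (xb t - x t) <= eta) /\
  (forall n, (n <= T)%N -> \sum_(1 <= k < n.+1) enorm (xb k - x k) ^+ 2 <=
    2 * \sum_(1 <= k < n.+1) (th k ^+ 2 * enorm (g k) ^+ 2)).
Proof.
pose e t := x t - xt t.
pose p k := th k ^+ 2 * enorm (g k) ^+ 2.
have p0 k : 0 <= p k by rewrite mulr_ge0 ?sqr_ge0.
have ubE t : (1 <= t <= T)%N -> enorm (xb t - x t) = (1 - alpha t) * enorm (e t).
  move=> tT; rewrite template_xb_sub// enormN enormZ ger0_norm// subr_ge0.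
  by have /andP[] := alpha1 tT.
(* Equal step sizes keep the two sequences identical from the common start, so the gap vanishes. *)
case: mode => [gmE|gmE].
  have e0 t : (1 <= t <= T.+1)%N -> e t = 0.
    elim: t => // t IH /andP[_ tT]; case: t => [|t] in IH tT *.
      by rewrite /e x1 subrr.
    rewrite /e template_gap_step// gmE// subrr scale0r addr0 -/(e t.+1) IH ?scaler0//.
    by rewrite /= ltnW.
  have ub0 t : (1 <= t <= T)%N -> enorm (xb t - x t) = 0.
    move=> tT; rewrite ubE// e0 ?enorm0 ?mulr0//.
    by case/andP: tT => -> /leqW.
  split=> [t tT|n nT]; first by rewrite ub0.
  rewrite big_nat big1; last first.
    by move=> k /andP[k1 kn]; rewrite ub0 ?expr0n// k1/= (leq_trans _ nT).
  by apply: mulr_ge0 => //; apply: sumr_ge0 => k _; exact: p0.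
(* Since [gm t - th t = alpha t * th t], the new gap is a convex combination of the old gap and the
   step. *)
have eS t : (1 <= t <= T)%N -> e t.+1 = (1 - alpha t) *: e t + alpha t *: (th t *: g t).
  move=> tT; rewrite /e template_gap_step//; have [_ ->] := gmE t tT.
  by rewrite scalerA; congr (_ + _ *: _); ring.
have thg2 t : (1 <= t <= T)%N -> enorm (th t *: g t) = th t * enorm (g t).
  by move=> tT; rewrite enormZ ger0_norm// th0.
have ele t : (1 <= t <= T.+1)%N -> enorm (e t) <= eta.
  elim: t => // t IH /andP[_ tT]; case: t => [|t] in IH tT *.
    by rewrite /e x1 subrr enorm0.
  have tT' : (1 <= t.+1 <= T)%N by [].
  have /andP[a0 a1] := alpha1 tT'.
  rewrite eS//; apply: le_trans (ler_enormD _ _) _.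
  rewrite !enormZ !ger0_norm ?subr_ge0 ?(ltW a0) ?th0//.
  have -> : eta = (1 - alpha t.+1) * eta + alpha t.+1 * eta by ring.
  apply: lerD; first by rewrite ler_wpM2l ?subr_ge0// IH//= ltnW.
  by rewrite ler_wpM2l ?(ltW a0)// thg.
split=> [t tT|n nT].
  rewrite ubE//; have /andP[a0 a1] := alpha1 tT.
  have H : enorm (e t) <= eta by apply: ele; case/andP: tT => -> /leqW.
  apply: le_trans H; rewrite ler_piMl ?enorm_ge0//; lra.
suff H m : (m <= T)%N -> \sum_(1 <= k < m.+1) enorm (xb k - x k) ^+ 2 +
    m.+1%:R * enorm (e m.+1) ^+ 2 <= 2 * \sum_(1 <= k < m.+1) p k.
  apply: le_trans (H n nT); rewrite lerDl mulr_ge0// sqr_ge0//.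
elim: m => [_|m IH mT].
  by rewrite !big_geq// /e x1 subrr enorm0 expr0n !mulr0 addr0.
have mT' : (1 <= m.+1 <= T)%N by [].
have := IH (ltnW mT); rewrite !(big_nat_recr m.+1)//= ubE//.
have [aE _] := gmE _ mT'; have /andP[a0 a1] := alpha1 mT'.
have pE : enorm (th m.+1 *: g m.+1) ^+ 2 = p m.+1.
  by rewrite thg2// exprMn.
have cvx : enorm (e m.+2) ^+ 2 <=
    (1 - alpha m.+1) * enorm (e m.+1) ^+ 2 + alpha m.+1 * p m.+1.
  rewrite eS// -pE; set w := th m.+1 *: g m.+1.
  have Y := dotv_young (e m.+1) w ltr01.
  have c0 : 0 <= alpha m.+1 * (1 - alpha m.+1).
    by rewrite mulr_ge0 ?subr_ge0 ?(ltW a0).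
  rewrite sqr_enormD dotvZl dotvZr 2!enormZ (ger0_norm (ltW a0)).
  rewrite (_ : `|1 - alpha m.+1| = 1 - alpha m.+1) ?ger0_norm ?subr_ge0//.
  have := ler_wpM2l c0 Y; lra.
have m0 : 0 <= m%:R :> R by [].
have m2 : (m.+2%:R : R) = m.+1%:R + 1 by rewrite -natr1.
have m1 : (m.+1%:R : R) = m%:R + 1 by rewrite -natr1.
have cvx2 := ler_wpM2l (ler0n R m.+2) cvx.
have E0 := sqr_ge0 (enorm (e m.+1)).
have aE2 : alpha m.+1 = 2 / m.+2%:R by rewrite aE m2.
(* The weight of the old squared gap drops from [m.+1] to [m.+2 * (1 - alpha m.+1) = m]; the unit
   set free pays for the squared distance of [xb] to [x], and the new step enters with weight 2. *)
have k1 : m.+2%:R * alpha m.+1 = 2 by rewrite aE2 mulrCA divff ?mulr1// pnatr_eq0.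
have k2 : m.+2%:R * (1 - alpha m.+1) = m%:R by rewrite mulrBr k1 m2 m1; ring.
have k3 : (1 - alpha m.+1) ^+ 2 <= 1.
  by rewrite expr_le1 ?subr_ge0//; lra.
have k4 : (1 - alpha m.+1) ^+ 2 * enorm (e m.+1) ^+ 2 <= enorm (e m.+1) ^+ 2.
  by rewrite ler_piMl.
have cvx3 : m.+2%:R * enorm (e m.+2) ^+ 2 <= m%:R * enorm (e m.+1) ^+ 2 + 2 * p m.+1.
  by apply: le_trans cvx2 _; rewrite mulrDr !mulrA k1 k2.
rewrite m1 [((1 - _) * _) ^+ 2]exprMn; lra.
Qed.

End Template.

(** * Bounds along a path *)

Section Path.
Context {R : realType} {d : nat}.
Variables (f : 'rV[R]_d -> R) (L A B C eta G0 fstar : R) (T : nat).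
Variables (x xb g : nat -> 'rV[R]_d).
Hypotheses (df : forall y, differentiable f y) (sf : L_smooth L f).
Hypotheses (L0 : 0 < L) (A0 : 0 < A) (B0 : 0 < B) (C0 : 0 < C).
Hypotheses (eta0 : 0 < eta) (G00 : 0 < G0) (fmin : forall y, fstar <= f y).

Let q t : R := \sum_(1 <= k < t) enorm (g k) ^+ 2.
Let b t : R := Num.sqrt (G0 ^+ 2 + q t).
Let th t : R := eta / b t.+1.
Let p t : R := th t ^+ 2 * enorm (g t) ^+ 2.
Let u t := xb t - x t.
Let xi t := g t - grad f (xb t).
Let Delta y := f y - fstar.
Let nb y := noise_bound f A B C fstar y.

Hypothesis xS : forall t, (1 <= t <= T)%N -> x t.+1 = x t - th t *: g t.
Hypothesis xb1 : xb 1%N = x 1%N.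
Hypothesis u_le : forall t, (1 <= t <= T)%N -> enorm (u t) <= eta.
Hypothesis sum_u : forall n, (n <= T)%N ->
  \sum_(1 <= k < n.+1) enorm (u k) ^+ 2 <= 2 * \sum_(1 <= k < n.+1) p k.
Hypothesis noise : forall t, (1 <= t <= T)%N -> enorm (xi t) ^+ 2 <= nb (xb t).

Lemma path_q_ge0 t : 0 <= q t.
Proof. by apply: sumr_ge0 => k _; exact: sqr_ge0. Qed.

Lemma path_qS t : (0 < t)%N -> q t.+1 = q t + enorm (g t) ^+ 2.
Proof. by move=> t0; rewrite /q big_nat_recr. Qed.

Lemma path_Gq_gt0 t : 0 < G0 ^+ 2 + q t.
Proof. by rewrite ltr_wpDr ?path_q_ge0// exprn_gt0. Qed.

Lemma path_b_gt0 t : 0 < b t.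
Proof. by rewrite sqrtr_gt0 path_Gq_gt0. Qed.

Lemma path_sqr_b t : b t ^+ 2 = G0 ^+ 2 + q t.
Proof. by rewrite sqr_sqrtr// ltW// path_Gq_gt0. Qed.

Lemma path_b1 : b 1 = G0.
Proof. by rewrite /b /q big_geq// addr0 sqrtr_sqr ger0_norm// ltW. Qed.

Lemma path_bS t : (0 < t)%N -> b t <= b t.+1.
Proof. by move=> t0; rewrite ler_wsqrtr// path_qS// addrA lerDl sqr_ge0. Qed.

Lemma path_th_gt0 t : 0 < th t.
Proof. by rewrite divr_gt0// path_b_gt0. Qed.

Lemma path_g_le_b t : (0 < t)%N -> enorm (g t) <= b t.+1.
Proof.
move=> t0; rewrite -[leLHS](ger0_norm (enorm_ge0 (g t))) -sqrtr_sqr ler_wsqrtr//.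
by rewrite path_qS//; have := path_q_ge0 t; have := sqr_ge0 G0; lra.
Qed.

Lemma path_th_g t : (0 < t)%N -> th t * enorm (g t) <= eta.
Proof.
move=> t0; rewrite /th mulrAC ler_pdivrMr ?path_b_gt0//.
by rewrite ler_wpM2l ?(ltW eta0)// path_g_le_b.
Qed.

Lemma path_p_ge0 t : 0 <= p t.
Proof. by rewrite mulr_ge0// sqr_ge0. Qed.

Lemma path_Delta_ge0 y : 0 <= Delta y.
Proof. by rewrite subr_ge0. Qed.

Lemma path_sqr_grad y : enorm (grad f y) ^+ 2 <= 2 * L * Delta y.
Proof. exact: sqr_grad_le. Qed.

Lemma path_nb_le y : nb y <= (A + 2 * B * L) * Delta y + C.
Proof.
rewrite /nb /noise_bound; have := path_sqr_grad y.
move=> /(ler_wpM2l (ltW B0)); rewrite /Delta; lra.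
Qed.

Lemma path_nb_ge0 y : 0 <= nb y.
Proof.
rewrite /nb /noise_bound; have := path_Delta_ge0 y; rewrite /Delta => h.
have [a b0 c] := And3 (ltW A0) (ltW B0) (ltW C0).
apply: addr_ge0 => //; apply: addr_ge0; apply: mulr_ge0 => //; exact: sqr_ge0.
Qed.

Lemma path_sqr_g t : (1 <= t <= T)%N ->
  enorm (g t) ^+ 2 <= 2 * (A + 2 * (B + 1) * L) * Delta (xb t) + 2 * C.
Proof.
move=> tT; have -> : g t = xi t + grad f (xb t) by rewrite /xi subrK.
rewrite sqr_enormD.
have := dotv_young (xi t) (grad f (xb t)) ltr01.
have := noise tT; have := path_nb_le (xb t); have := path_sqr_grad (xb t).
set n1 := enorm (xi t) ^+ 2; set n2 := enorm (grad _ _) ^+ 2; lra.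
Qed.

Lemma path_sum_p n : \sum_(1 <= k < n.+1) p k <= eta ^+ 2 * ln (1 + q n.+1 / G0 ^+ 2).
Proof.
have G2 : 0 < G0 ^+ 2 by rewrite exprn_gt0.
have := @sum_div_le_ln _ (fun k => enorm (g k) ^+ 2) _ n G2 (fun k => sqr_ge0 _).
move=> /(ler_wpM2l (sqr_ge0 eta)); rewrite mulr_sumr; apply: le_trans.
apply: ler_sum => k _; rewrite /p /th exprMn exprVn path_sqr_b.
by rewrite -mulrA [X in _ * X]mulrC.
Qed.

Lemma path_x_dist t : (1 <= t <= T.+1)%N -> enorm (x t - x 1%N) <= eta * (t%:R - 1).
Proof.
elim: t => // t IH /andP[_ tT]; case: t => [|t] in IH tT *.
  by rewrite !subrr enorm0 mulr0.
have tT' : (1 <= t.+1 <= T)%N by [].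
rewrite xS// addrAC; apply: le_trans (ler_enormD _ _) _.
rewrite enormN enormZ ger0_norm ?(ltW (path_th_gt0 _))//.
have := IH (introT andP (conj isT (ltnW tT))); have := path_th_g (t := t.+1) isT.
by rewrite -(natr1 t.+1); lra.
Qed.

Lemma path_xb_dist t : (1 <= t <= T)%N -> enorm (xb t - x 1%N) <= eta * t%:R.
Proof.
move=> tT; have -> : xb t - x 1%N = u t + (x t - x 1%N) by rewrite /u addrA subrK.
apply: le_trans (ler_enormD _ _) _.
have := u_le tT; have /path_x_dist : (1 <= t <= T.+1)%N.
  by case/andP: tT => -> /= /leqW.
lra.
Qed.

(** A crude bound with no martingale input: each step has length at most [eta], so [xb] stays within
    [eta * T] of the start, and smoothness makes the squared gradients grow polynomially in [T]. The
    logarithm defining [F] makes this harmless. *)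
Lemma path_growth n : (n <= T)%N ->
  q n.+1 <= ((2 * A + 4 * L * B + 4 * L) * Delta (x 1%N) + 2 * C) * T%:R
      + (2 * A + 4 * L * B + 4 * L) *
        (3 * eta * enorm (grad f (x 1%N)) + 9 * L * eta ^+ 2 / 2) * T%:R ^+ 2
      + 9 * L * eta ^+ 2 / 2 * (2 * A + 4 * L * B + 4 * L) * T%:R ^+ 3.
Proof.
move=> nT; set X := 2 * A + _ + _; set n1 := enorm _.
have X0 : 0 < X by rewrite /X !addr_gt0 ?mulr_gt0.
have n10 : 0 <= n1 by exact: enorm_ge0.
pose W : R := X * (Delta (x 1%N) + n1 * (eta * T%:R) + L / 2 * (eta * T%:R) ^+ 2) + 2 * C.
have H k : (1 <= k <= T)%N -> enorm (g k) ^+ 2 <= W.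
  move=> kT; apply: le_trans (path_sqr_g kT) _.
  have -> : 2 * (A + 2 * (B + 1) * L) = X by rewrite /X; ring.
  rewrite /W lerD2r ler_wpM2l ?(ltW X0)//.
  have := descent_le df sf (x 1%N) (xb k - x 1%N).
  rewrite addrC subrK => h1.
  have h2 := dotv_le_enorm (grad f (x 1%N)) (xb k - x 1%N).
  have h3 : enorm (xb k - x 1%N) <= eta * T%:R.
    apply: le_trans (path_xb_dist kT) _; rewrite ler_wpM2l ?(ltW eta0)// ler_nat.
    by case/andP: kT.
  have h4 : n1 * enorm (xb k - x 1%N) <= n1 * (eta * T%:R) by rewrite ler_wpM2l.
  have h5 : L / 2 * enorm (xb k - x 1%N) ^+ 2 <= L / 2 * (eta * T%:R) ^+ 2.
    rewrite ler_wpM2l ?divr_ge0 ?(ltW L0)// lerXn2r// nnegrE ?enorm_ge0//.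
    by rewrite mulr_ge0// ltW.
  rewrite /Delta; rewrite -/n1 in h2; lra.
have D0 := path_Delta_ge0 (x 1%N).
have T0 : 0 <= T%:R :> R by [].
have W0 : 0 <= W.
  rewrite /W; have : 0 <= n1 * (eta * T%:R) by rewrite !mulr_ge0// ltW.
  have : 0 <= L / 2 * (eta * T%:R) ^+ 2 by rewrite mulr_ge0 ?sqr_ge0// divr_ge0// ltW.
  move=> h1 h2; apply: addr_ge0; last by rewrite mulr_ge0// ltW.
  apply: mulr_ge0; [exact: ltW|apply: addr_ge0 => //; exact: addr_ge0].
have : q n.+1 <= T%:R * W.
  apply: (@le_trans _ _ (\sum_(1 <= k < n.+1) W)).
    rewrite /q !big_nat ler_sum// => k /andP[k1 kn]; apply: H.
    by rewrite k1/= (leq_trans _ nT).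
  by rewrite sumr_const_nat subn1/= -[leLHS]mulr_natl ler_wpM2r// ler_nat.
move=> /le_trans; apply; rewrite /W.
have e1 : 0 <= X * eta * n1 * T%:R ^+ 2 by rewrite !mulr_ge0// ?sqr_ge0// ltW.
have e2 : 0 <= L * eta ^+ 2 * X * T%:R ^+ 2 by rewrite !mulr_ge0// ?sqr_ge0// ltW.
have e3 : 0 <= L * eta ^+ 2 * X * T%:R ^+ 3 by rewrite !mulr_ge0// ?exprn_ge0 ?sqr_ge0// ltW.
nra.
Qed.

(** The map [y |-> Num.sqrt (r + y ^ 2)] is 1-Lipschitz, so the two steps differ by a second-order
    quantity: their product times [(m - n) / eta] at most. *)
Lemma decorrelation (s m n r : R) : 0 < r -> 0 <= n -> n <= m -> m - n <= 2 * s ->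
  0 <= eta / Num.sqrt (r + n ^+ 2) - eta / Num.sqrt (r + m ^+ 2) <=
  2 * s / eta * (eta / Num.sqrt (r + m ^+ 2)) * (eta / Num.sqrt (r + n ^+ 2)).
Proof.
move=> r0 n0 nm ms.
have P y : 0 < r + y ^+ 2 by rewrite ltr_wpDr ?sqr_ge0.
have Q y : 0 < Num.sqrt (r + y ^+ 2) by rewrite sqrtr_gt0.
have E y : Num.sqrt (r + y ^+ 2) ^+ 2 = r + y ^+ 2 by rewrite sqr_sqrtr// ltW.
have := Q m; have := Q n; have := E m; have := E n.
have nq : n <= Num.sqrt (r + n ^+ 2).
  by rewrite -[leLHS](ger0_norm n0) -sqrtr_sqr ler_wsqrtr// lerDr ltW.
move: (Num.sqrt (r + m ^+ 2)) (Num.sqrt (r + n ^+ 2)) nq => a c nc E1 E2 c0 a0.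
have ca : c <= a.
  by rewrite -(@ler_pXn2r _ 2%N) ?nnegrE ?(ltW c0) ?(ltW a0)// E1 E2 lerD2l lerXn2r// nnegrE; lra.
have ac : a - c <= 2 * s.
  apply: le_trans ms; rewrite lerBlDr -(@ler_pXn2r _ 2%N) ?nnegrE ?(ltW a0)//; last lra.
  by rewrite E2; nra.
have -> : eta / c - eta / a = eta * (a - c) / (a * c) by field; rewrite !gt_eqF.
have -> : 2 * s / eta * (eta / a) * (eta / c) = eta * (2 * s) / (a * c).
  by field; rewrite !gt_eqF.
have ac0 : 0 < a * c by rewrite mulr_gt0.
apply/andP; split; first by rewrite divr_ge0 ?(ltW ac0)// mulr_ge0 ?(ltW eta0)//; lra.
by rewrite ler_pM2r ?invr_gt0// ler_pM2l.
Qed.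

(** * Consequences of a noise level [M] below the cap *)

Section Trajectory.
Variables (cap M : R).
Hypotheses (M0 : 0 < M) (nbM : forall y, Delta y <= cap -> nb y <= M).

Let s := Num.sqrt M.
Let s0 : 0 < s. Proof. by rewrite sqrtr_gt0. Qed.

Lemma path_enorm_xi t : (1 <= t <= T)%N -> enorm (xi t) <= Num.sqrt (nb (xb t)).
Proof.
move=> tT; rewrite -[leLHS](ger0_norm (enorm_ge0 (xi t))) -sqrtr_sqr ler_wsqrtr//.
exact: noise.
Qed.

(** [H2] moves the gradient from [x k] to [xb k]. Of the decrease [h * |D| ^ 2], with [h] the
    decorrelated step, one half pays for exchanging [th k] with [h] up to a multiple of [p k]
    ([H3]), the other for the compensator of the process ([H4]). The multiplier [(eta * s)^-1] fits
    the second payment, because [h * n <= eta] and [n <= s]. *)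
Lemma path_descent_step k : (1 <= k <= T)%N -> Delta (xb k) <= cap ->
  f (x k.+1) <= f (x k) + eta * s *
    descent_process f A B C eta G0 fstar cap (eta * s)^-1 (xb k) (q k) (g k)
    + (2 * s / eta + L) * p k + L / 2 * enorm (u k) ^+ 2.
Proof.
move=> kT hcap; have k0 : (0 < k)%N by case/andP: kT.
rewrite /descent_process hcap.
pose h := decorrelated_step f A B C eta G0 fstar (xb k) (q k).
pose n := Num.sqrt (nb (xb k)).
pose D := grad f (xb k).
have n0 : 0 <= n by exact: sqrtr_ge0.
have ns : n <= s by rewrite /n /s ler_wsqrtr// nbM.
have xin : enorm (xi k) <= n by exact: path_enorm_xi.
have h0 : 0 <= h by apply: decorrelated_step_ge0.
have hE : h = eta / Num.sqrt (G0 ^+ 2 + q k + (enorm D + n) ^+ 2).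
  by rewrite /h /decorrelated_step (ger0_norm (path_q_ge0 k)).
have thE : th k = eta / Num.sqrt (G0 ^+ 2 + q k + enorm (g k) ^+ 2).
  by rewrite /th /b path_qS// addrA.
have gE : g k = D + xi k by rewrite /xi addrC subrK.
have gle : enorm (g k) <= enorm D + n.
  by rewrite gE; apply: le_trans (ler_enormD _ _) _; rewrite lerD2l.
have gge : enorm D + n - enorm (g k) <= 2 * n.
  have : enorm D <= enorm (g k) + enorm (xi k).
    have {1}-> : D = g k + - xi k by rewrite /xi opprB addrC subrK.
    by apply: le_trans (ler_enormD _ _) _; rewrite enormN.
  lra.
have := decorrelation (path_Gq_gt0 k) (enorm_ge0 (g k)) gle gge.
rewrite -hE -thE => /andP[hth0 hth].
have hn : h * (enorm D + n) <= eta.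
  rewrite hE mulrAC ler_pdivrMr; last first.
    by rewrite sqrtr_gt0 ltr_wpDr ?sqr_ge0// path_Gq_gt0.
  rewrite ler_wpM2l ?(ltW eta0)//.
  have m0 : 0 <= enorm D + n by rewrite addr_ge0 ?enorm_ge0.
  by rewrite -[leLHS](ger0_norm m0) -sqrtr_sqr ler_wsqrtr// lerDr ltW// path_Gq_gt0.
have D0 : 0 <= enorm D := enorm_ge0 D.
have hn' : h * n <= eta.
  by apply: le_trans hn; rewrite ler_wpM2l// lerDr.
have th0 := path_th_gt0 k.
have := descent_le df sf (x k) (- (th k *: g k)).
rewrite -xS// enormN enormZ (ger0_norm (ltW th0)) dotvNr dotvZr exprMn -/(p k) => H1.
have H2 : - (th k * dotv (grad f (x k)) (g k)) <=
    - (th k * dotv D (g k)) + L / 2 * enorm (u k) ^+ 2 + L / 2 * p k.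
  have e1 : dotv (D - grad f (x k)) (g k) <= L * enorm (u k) * enorm (g k).
    apply: le_trans (dotv_le_enorm _ _) _.
    by rewrite ler_wpM2r ?enorm_ge0// /D sf.
  have := ler_wpM2l (ltW th0) e1; rewrite dotvBl mulrBr.
  have : L * (enorm (u k) * (th k * enorm (g k))) <=
      L * ((enorm (u k) ^+ 2 + p k) / 2).
    rewrite ler_pM2l// /p -exprMn.
    have := sqr_ge0 (enorm (u k) - th k * enorm (g k)); rewrite sqrrB; lra.
  lra.
have H3 : - (th k * dotv D (g k)) <= - (h * dotv D (xi k)) - h / 2 * enorm D ^+ 2
    + 2 * s / eta * p k.
  have e1 : - (dotv D (g k)) <= enorm D * enorm (g k).
    by rewrite -dotvNl -enormN dotv_le_enorm.
  have e2 : - ((th k - h) * dotv D (g k)) <=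
     (2 * n / eta * h * th k) * (enorm D * enorm (g k)).
    rewrite -mulrN; apply: le_trans (_ : (th k - h) * (enorm D * enorm (g k)) <= _).
      by rewrite ler_wpM2l.
    by rewrite ler_wpM2r// mulr_ge0// enorm_ge0.
  have e3 : (2 * n / eta * h * th k) * (enorm D * enorm (g k)) <=
      h / 2 * enorm D ^+ 2 + h / 2 * (2 * n / eta * (th k * enorm (g k))) ^+ 2.
    have := sqr_ge0 (enorm D - 2 * n / eta * (th k * enorm (g k))).
    move=> /(ler_wpM2l h0); rewrite sqrrB; lra.
  have e4 : h / 2 * (2 * n / eta * (th k * enorm (g k))) ^+ 2 <= 2 * s / eta * p k.
    have -> : h / 2 * (2 * n / eta * (th k * enorm (g k))) ^+ 2 =
        (h * n) * n * (2 / eta ^+ 2 * p k).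
      by rewrite /p; field; rewrite gt_eqF.
    have -> : 2 * s / eta * p k = eta * s * (2 / eta ^+ 2 * p k).
      by field; rewrite gt_eqF.
    rewrite ler_wpM2r//.
      by rewrite mulr_ge0 ?path_p_ge0// divr_ge0 ?sqr_ge0.
    by apply: ler_pM => //; exact: mulr_ge0.
  have e5 : dotv D (g k) = enorm D ^+ 2 + dotv D (xi k).
    by rewrite gE dotvDr sqr_enorm.
  have e6 : - (th k * dotv D (g k)) = - (h * dotv D (g k)) - (th k - h) * dotv D (g k).
    by ring.
  rewrite e6 {1}e5; lra.
have H4 : - (h * dotv D (xi k)) - h / 2 * enorm D ^+ 2 <=
   eta * s * (dotv (- ((eta * s)^-1 * h) *: D) (g k - D) -
    ((eta * s)^-1 * h * enorm D * n) ^+ 2 / 2).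
  rewrite dotvZl -/(xi k).
  have -> : eta * s * (- ((eta * s)^-1 * h) * dotv D (xi k) -
     ((eta * s)^-1 * h * enorm D * n) ^+ 2 / 2) =
     - (h * dotv D (xi k)) - (h * enorm D ^+ 2) / 2 * ((h * n) * n / (eta * s)).
    by field; rewrite !gt_eqF.
  rewrite lerD2l lerN2 -[leRHS]mulr1 [h / 2 * _]mulrAC ler_wpM2l//.
    by rewrite divr_ge0// mulr_ge0// sqr_ge0.
  rewrite ler_pdivrMr ?mulr_gt0// mul1r.
  by apply: ler_pM => //; exact: mulr_ge0.
rewrite -/D -/h -/n; lra.
Qed.

Lemma path_descent l n : (n <= T)%N ->
  (forall k, (1 <= k <= n)%N -> Delta (xb k) <= cap) ->
  \sum_(1 <= k < n.+1)
    descent_process f A B C eta G0 fstar cap (eta * s)^-1 (xb k) (q k) (g k) <= l ->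
  f (x n.+1) <= f (x 1%N) + eta * s * l +
    (2 * s / eta + 2 * L) * \sum_(1 <= k < n.+1) p k.
Proof.
move=> nT hcap hl.
pose a k := descent_process f A B C eta G0 fstar cap (eta * s)^-1 (xb k) (q k) (g k).
suff H m : (m <= n)%N -> f (x m.+1) <= f (x 1%N) + eta * s * \sum_(1 <= k < m.+1) a k +
    (2 * s / eta + L) * \sum_(1 <= k < m.+1) p k +
    L / 2 * \sum_(1 <= k < m.+1) enorm (u k) ^+ 2.
  apply: le_trans (H n (leqnn n)) _.
  have es : 0 <= eta * s by rewrite mulr_ge0 ?ltW.
  have := ler_wpM2l es hl; rewrite -/a => h1.
  have L2 : 0 <= L / 2 by rewrite divr_ge0// ltW.
  have := ler_wpM2l L2 (sum_u nT); rewrite -/a in h1 *; lra.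
elim: m => [_|m IH mn]; first by rewrite !big_geq// !mulr0 !addr0.
have mn1 : (1 <= m.+1 <= n)%N by [].
have mT : (1 <= m.+1 <= T)%N by rewrite /= (leq_trans mn nT).
have := path_descent_step mT (hcap _ mn1); rewrite -/(a m.+1).
have := IH (ltnW mn); rewrite !(big_nat_recr m.+1)//=; lra.
Qed.

Lemma path_bounded l P : 0 <= l -> 
  (forall n, (n <= T)%N -> \sum_(1 <= k < n.+1)
    descent_process f A B C eta G0 fstar cap (eta * s)^-1 (xb k) (q k) (g k) <= l) ->
  (forall n, (n <= T)%N -> \sum_(1 <= k < n.+1) p k <= P) ->
  2 * (Delta (x 1%N) + eta * s * l + (2 * s / eta + 2 * L) * P) + L * eta ^+ 2 <= cap ->
  forall t, (1 <= t <= T)%N -> Delta (xb t) <= cap.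
Proof.
move=> l0 hl hP hcap; elim/ltn_ind => t IH tT.
have es : 0 <= eta * s by rewrite mulr_ge0 ?ltW.
have se : 0 <= 2 * s / eta + 2 * L.
  by rewrite addr_ge0 ?divr_ge0 ?mulr_ge0 ?ltW.
have [t1|t1] := leqP t 1.
  have -> : t = 1%N by case/andP: tT => t0 _; apply/eqP; rewrite eqn_leq t1.
  rewrite xb1; apply: le_trans hcap.
  have P0 : 0 <= P by apply: le_trans (hP 0%N isT); rewrite big_geq.
  have := mulr_ge0 es l0; have := mulr_ge0 se P0; have := path_Delta_ge0 (x 1%N).
  have := mulr_ge0 (ltW L0) (sqr_ge0 eta); lra.
case: t => // t in IH tT t1 *.
have tT' : (t <= T)%N by case/andP: tT => _ /ltnW.
have H1 : Delta (x t.+1) <= Delta (x 1%N) + eta * s * l + (2 * s / eta + 2 * L) * P.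
  have := path_descent tT' _ (hl t tT').
  have := ler_wpM2l se (hP t tT') => h1 h2.
  have : f (x t.+1) <= f (x 1%N) + eta * s * l +
     (2 * s / eta + 2 * L) * \sum_(1 <= k < t.+1) p k.
    apply: h2 => k /andP[k1 kt]; apply: IH => //.
    by rewrite k1 (leq_trans kt).
  rewrite /Delta; lra.
(* The inner product of [u] with the gradient is split by Young's inequality with weight [L]; its
   gradient part is at most one more gap at [x t.+1]. *)
have H2 : Delta (xb t.+1) <= 2 * Delta (x t.+1) + L * eta ^+ 2.
  have := descent_le df sf (x t.+1) (u t.+1); rewrite addrC subrK.
  have := dotv_young (u t.+1) (grad f (x t.+1)) L0; rewrite dotvC.
  have ule : enorm (u t.+1) ^+ 2 <= eta ^+ 2.
    by rewrite lerXn2r ?nnegrE ?enorm_ge0 ?(ltW eta0)// u_le.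
  have := ler_wpM2l (ltW L0) ule.
  have : enorm (grad f (x t.+1)) ^+ 2 / (2 * L) <= Delta (x t.+1).
    by rewrite ler_pdivrMr ?mulr_gt0// mulrC path_sqr_grad.
  rewrite /Delta; lra.
lra.
Qed.

Hypothesis Delta_cap : forall t, (1 <= t <= T)%N -> Delta (xb t) <= cap.

Lemma path_sqr_xi t : (1 <= t <= T)%N -> enorm (xi t) ^+ 2 <= M.
Proof. by move=> tT; apply: le_trans (noise tT) (nbM (Delta_cap tT)). Qed.

Lemma path_xi_s t : (1 <= t <= T)%N -> enorm (xi t) <= s.
Proof.
move=> tT; apply: le_trans (path_enorm_xi tT) _.
by rewrite ler_wsqrtr// nbM// Delta_cap.
Qed.

Lemma path_energy_step k : (1 <= k <= T)%N ->
  enorm (g k) ^+ 2 = enorm (xi k) ^+ 2 -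
    2 * M * energy_process f fstar cap M (xb k) (q k) (g k).
Proof.
move=> kT; rewrite /energy_process -/(Delta _) Delta_cap// -/(xi k) dotvZl.
have := sqr_enormD (xi k) (grad f (xb k)); rewrite {1}/xi subrK => ->.
rewrite (dotvC (xi k)) !exprMn (sqr_sqrtr (ltW M0)).
by field; rewrite gt_eqF.
Qed.

(** Summing [path_energy_step], the squared gradients dominate the squared noise up to [2 * M * l],
    which is the defect [K] of [sum_div_le_ln_defect]. The weights [eta / b k] lag one sample
    behind, as the distance process requires. *)
Lemma path_noise_sum l n : 0 <= l -> (n <= T)%N ->
  (forall m, (m <= T)%N ->
    \sum_(1 <= k < m.+1) energy_process f fstar cap M (xb k) (q k) (g k) <= l) ->
  \sum_(1 <= k < n.+1) (eta / b k) ^+ 2 * enorm (xi k) ^+ 2 <=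
  eta ^+ 2 * (2 * ln (1 + T%:R * M / (2 * G0 ^+ 2)) + 2 * (M + 2 * M * l) / G0 ^+ 2).
Proof.
move=> l0 nT hl.
have G2 : 0 < G0 ^+ 2 by rewrite exprn_gt0.
pose a k := enorm (xi k) ^+ 2.
have K0 : 0 <= 2 * M * l by rewrite !mulr_ge0// ltW.
have qE m : (m <= T)%N -> q m.+1 = \sum_(1 <= k < m.+1) a k -
    2 * M * \sum_(1 <= k < m.+1) energy_process f fstar cap M (xb k) (q k) (g k).
  move=> mT; rewrite mulr_sumr -sumrB /q !big_nat; apply: eq_bigr => k /andP[k1 km].
  by apply: path_energy_step; rewrite k1 (leq_trans _ mT).
have h1 k : (1 <= k <= n)%N -> 0 <= a k <= M.
  by move=> /andP[k1 kn]; rewrite sqr_ge0 path_sqr_xi// k1 (leq_trans kn).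
have h2 k : (1 <= k <= n)%N -> 0 <= q k by move=> _; exact: path_q_ge0.
have h3 k : (1 <= k <= n)%N -> \sum_(1 <= j < k) a j - 2 * M * l <= q k.
  case: k => // k /andP[_ kn]; have kT : (k <= T)%N by rewrite (leq_trans (ltnW kn)).
  have M2 : 0 <= 2 * M by rewrite mulr_ge0// ltW.
  by rewrite qE// lerD2l lerN2 ler_wpM2l// hl.
have := sum_div_le_ln_defect G2 (ltW M0) K0 h1 h2 h3.
move=> /(ler_wpM2l (sqr_ge0 eta)); rewrite mulr_sumr => H.
apply: le_trans (le_trans _ H) _.
  apply: ler_sum => k _; rewrite exprMn exprVn path_sqr_b.
  by rewrite -mulrA [X in _ * X]mulrC.
have SM : \sum_(1 <= k < n.+1) a k <= T%:R * M.
  apply: (@le_trans _ _ (\sum_(1 <= k < n.+1) M)).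
    by rewrite !big_nat ler_sum// => k kn; have /andP[] := h1 k kn.
  by rewrite sumr_const_nat subn1/= -[leLHS]mulr_natl ler_wpM2r ?(ltW M0)// ler_nat.
have S0 : 0 <= \sum_(1 <= k < n.+1) a k by apply: sumr_ge0 => k _; exact: sqr_ge0.
have d0 : 0 <= (2 * G0 ^+ 2)^-1 by rewrite invr_ge0 mulr_ge0// ltW.
have := mulr_ge0 S0 d0; have := ler_wpM2r d0 SM => h4 h5.
rewrite ler_wpM2l ?sqr_ge0// lerD2r ler_pM2l// ler_ln ?posrE; lra.
Qed.

(** * Distances to the minimizer and the linearized regret *)

Section Minimizer.
Variable xs : 'rV[R]_d.
Hypotheses (cf : convex_function [set: convex_lmodType 'rV[R]_d] f) (xsE : f xs = fstar).
Variables (V lam : R).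
Hypotheses (V0 : 0 < V) (lam0 : 0 < lam).

Let v t := xb t - xs.
Let Dist t := enorm (x t - xs) ^+ 2.

Lemma path_convex t : Delta (xb t) <= dotv (grad f (xb t)) (v t).
Proof.
have := convex_grad_le df sf cf (xb t) xs; rewrite xsE.
by rewrite -[xs - xb t]opprB dotvNr /Delta; lra.
Qed.

Lemma path_dist_step k : (1 <= k <= T)%N -> 
  Dist k.+1 = Dist k - 2 * th k * (dotv (g k) (v k) - dotv (g k) (u k)) + p k.
Proof.
move=> kT; rewrite /Dist xS//.
have -> : x k - th k *: g k - xs = (x k - xs) - th k *: g k by rewrite addrAC.
rewrite (sqr_enormB (x k - xs)) enormZ dotvZr exprMn.
rewrite (ger0_norm (ltW (path_th_gt0 k))) -/(p k).
have -> : dotv (x k - xs) (g k) = dotv (g k) (v k) - dotv (g k) (u k).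
  by rewrite -dotvBr dotvC; congr dotv; apply/rowP => i; rewrite !mxE; ring.
ring.
Qed.

(** Convexity discards the gradient part of the inner product. In the noise part [th k] is exchanged
    for the previous step; the cost, [2 * s * V] times the decrease of the step, telescopes. The
    term with [2 * lam * V ^ 2] restores the square subtracted in the process. *)
Lemma path_dist_descent k : (1 <= k <= T)%N -> enorm (v k) <= V ->
  Dist k.+1 <= Dist k +
    2 / lam * distance_process f eta G0 fstar cap lam V xs (xb k) (q k) (g k) +
    2 * lam * V ^+ 2 * ((eta / b k) ^+ 2 * enorm (xi k) ^+ 2) +
    2 * s * V * (eta / b k - eta / b k.+1) + 2 * p k + enorm (u k) ^+ 2.
Proof.
move=> kT vV; rewrite path_dist_step// /distance_process.
rewrite -/(Delta (xb k)) Delta_cap// -/(v k) vV/= (ger0_norm (path_q_ge0 k)) -/(b k) -/(xi k).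
have k0 : (0 < k)%N by case/andP: kT.
have th0 := path_th_gt0 k.
set th' := eta / b k; have th'0 : 0 < th' by rewrite divr_gt0// path_b_gt0.
have thth : th k <= th'.
  by rewrite ler_wpM2l ?(ltW eta0)// lef_pV2 ?posrE ?path_b_gt0// path_bS.
rewrite dotvZl (dotvC (v k)).
have gE : dotv (g k) (v k) = dotv (xi k) (v k) + dotv (grad f (xb k)) (v k).
  by rewrite -dotvDl /xi subrK.
have c0 : 0 <= dotv (grad f (xb k)) (v k).
  by apply: le_trans (path_convex k); exact: path_Delta_ge0.
have := mulr_ge0 (ltW th0) c0 => H0.
have H1 : th k * dotv (g k) (u k) <= (p k + enorm (u k) ^+ 2) / 2.
  rewrite -dotvZl; apply: le_trans (dotv_young _ _ ltr01) _.
  by rewrite enormZ (ger0_norm (ltW th0)) exprMn -/(p k); lra.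
have xv : `|dotv (xi k) (v k)| <= s * V.
  apply: le_trans (normr_dotv _ _) _; apply: ler_pM; rewrite ?enorm_ge0//.
  exact: path_xi_s.
have H2 : (th' - th k) * dotv (xi k) (v k) <= s * V * (th' - th k).
  rewrite [leRHS]mulrC ler_wpM2l ?subr_ge0//.
  by apply: le_trans (ler_norm _) xv.
have H3 : dotv (xi k) (v k) ^+ 2 <= V ^+ 2 * enorm (xi k) ^+ 2.
  rewrite -exprMn -(ger0_norm (sqr_ge0 (dotv _ _))) normrX lerXn2r ?nnegrE ?normr_ge0//.
    by rewrite mulr_ge0 ?enorm_ge0// ltW.
  by apply: le_trans (normr_dotv _ _) _; rewrite mulrC ler_wpM2r ?enorm_ge0.
have H4 := ler_wpM2l (mulr_ge0 (ltW lam0) (sqr_ge0 th')) H3.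
rewrite gE -/th' in H0 *; rewrite -/(th k).
have -> : 2 / lam * (- (lam * th') * dotv (xi k) (v k) -
    (- (lam * th') * dotv (xi k) (v k)) ^+ 2) =
    - (2 * th' * dotv (xi k) (v k)) - 2 * (lam * th' ^+ 2 * dotv (xi k) (v k) ^+ 2).
  by field; rewrite gt_eqF.
lra.
Qed.

Lemma path_distance l P Rb DL : 
  (forall n, (n <= T)%N -> \sum_(1 <= k < n.+1)
    distance_process f eta G0 fstar cap lam V xs (xb k) (q k) (g k) <= l) ->
  (forall n, (n <= T)%N -> \sum_(1 <= k < n.+1) p k <= P) ->
  (forall n, (n <= T)%N ->
    \sum_(1 <= k < n.+1) (eta / b k) ^+ 2 * enorm (xi k) ^+ 2 <= Rb) ->
  0 <= l -> 0 <= DL -> DL + eta <= V ->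
  Dist 1 + 2 / lam * l + 2 * lam * V ^+ 2 * Rb + 2 * s * V * (eta / G0) + 4 * P
    <= DL ^+ 2 ->
  forall t, (1 <= t <= T.+1)%N -> enorm (x t - xs) <= DL.
Proof.
move=> hl hP hR l0 DL0 DV hD.
have P0 : 0 <= P by apply: le_trans (hP 0%N isT); rewrite big_geq.
have R0 : 0 <= Rb by apply: le_trans (hR 0%N isT); rewrite big_geq.
have c1 : 0 <= 2 / lam by rewrite divr_ge0// ltW.
have c2 : 0 <= 2 * lam * V ^+ 2 by rewrite !mulr_ge0 ?sqr_ge0// ltW.
have c3 : 0 <= 2 * s * V by rewrite !mulr_ge0 ?ltW.
(* Bounds up to [n] keep the distance cut-off inactive up to [n], so the summed recursion reaches
   [n.+1]. *)
suff H n : (n <= T)%N -> (forall k, (1 <= k <= n)%N -> enorm (x k - xs) <= DL) ->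
    Dist n.+1 <= DL ^+ 2.
  elim/ltn_ind => -[//|t] IH tT.
  have : Dist t.+1 <= DL ^+ 2.
    apply: H; first by case/andP: tT.
    move=> k /andP[k1 kt]; apply: IH => //; rewrite k1/=.
    by case/andP: tT => _ tT; rewrite (leq_trans kt)// ltnW.
  by rewrite ler_pXn2r// nnegrE enorm_ge0.
move=> nT hx.
pose a k := distance_process f eta G0 fstar cap lam V xs (xb k) (q k) (g k).
have vV k : (1 <= k <= n)%N -> enorm (v k) <= V.
  move=> kn; apply: le_trans DV.
  have -> : v k = (x k - xs) + u k by apply/rowP => i; rewrite !mxE; ring.
  apply: le_trans (ler_enormD _ _) _; apply: lerD; first exact: hx.
  by apply: u_le; case/andP: kn => -> /= kn; rewrite (leq_trans kn).
suff {}H m : (m <= n)%N -> Dist m.+1 <= Dist 1 + 2 / lam * \sum_(1 <= k < m.+1) a k +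
    2 * lam * V ^+ 2 * \sum_(1 <= k < m.+1) ((eta / b k) ^+ 2 * enorm (xi k) ^+ 2) +
    2 * s * V * (eta / G0 - eta / b m.+1) + 2 * \sum_(1 <= k < m.+1) p k +
    \sum_(1 <= k < m.+1) enorm (u k) ^+ 2.
  apply: le_trans (H n (leqnn n)) _; apply: le_trans hD.
  have := ler_wpM2l c1 (hl _ nT); have := ler_wpM2l c2 (hR _ nT).
  have := sum_u nT; have := hP _ nT.
  have : 0 <= eta / b n.+1 by rewrite divr_ge0 ?ltW// path_b_gt0.
  move=> /(mulr_ge0 c3); rewrite -/a.
  lra.
elim: m => [_|m IH mn].
  by rewrite !big_geq// path_b1 subrr !mulr0 !addr0.
have mn1 : (1 <= m.+1 <= n)%N by [].
have mT : (1 <= m.+1 <= T)%N by rewrite /= (leq_trans mn nT).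
have := path_dist_descent mT (vV _ mn1); rewrite -/(a m.+1).
have := IH (ltnW mn); rewrite !(big_nat_recr m.+1)//=; lra.
Qed.

(** Dividing the distance recursion by twice the step puts the weight [b k.+1 / (2 * eta)] on the
    differences of squared distances. Summation by parts leaves the increments of the nondecreasing
    [b], each times at most [DL ^ 2]. *)
Lemma path_regret_linear DL P : 0 <= DL ->
  (forall n, (n <= T)%N -> \sum_(1 <= k < n.+1) p k <= eta ^+ 2 * P) ->
  (forall t, (1 <= t <= T)%N -> enorm (x t - xs) <= DL) ->
  \sum_(1 <= k < T.+1) dotv (g k) (v k) <=
    G0 / (2 * eta) * Dist 1 + eta * P * G0 +
    (DL ^+ 2 / (2 * eta) + 2 * eta + eta * P) * Num.sqrt (q T.+1).
Proof.
move=> DL0 hP hx.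
have bG n : b n - G0 <= Num.sqrt (q n).
  have := sqrtD_le (sqr_ge0 G0) (path_q_ge0 n).
  by rewrite sqrtr_sqr (ger0_norm (ltW G00)) -/(b n); lra.
have P0 : 0 <= P.
  have := hP 0%N isT; rewrite big_geq// => /=.
  by rewrite pmulr_rge0// exprn_gt0.
suff H n : (n <= T)%N -> \sum_(1 <= k < n.+1) dotv (g k) (v k) <=
    G0 / (2 * eta) * Dist 1 + (b n.+1 - G0) / (2 * eta) * DL ^+ 2 -
    b n.+1 / (2 * eta) * Dist n.+1 +
    \sum_(1 <= k < n.+1) th k * enorm (g k) ^+ 2 +
    b T.+1 / (2 * eta) * \sum_(1 <= k < n.+1) enorm (u k) ^+ 2.
  apply: le_trans (H T (leqnn T)) _.
  have h1 : 0 <= b T.+1 / (2 * eta) * Dist T.+1.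
    by rewrite mulr_ge0 ?sqr_ge0// divr_ge0 ?mulr_ge0 ?ltW// path_b_gt0.
  have h2 : \sum_(1 <= k < T.+1) th k * enorm (g k) ^+ 2 <= 2 * eta * (b T.+1 - G0).
    have G2 : 0 < G0 ^+ 2 by rewrite exprn_gt0.
    have := @sum_div_sqrt_le _ (fun k => enorm (g k) ^+ 2) _ T G2 (fun k => sqr_ge0 _).
    rewrite sqrtr_sqr (ger0_norm (ltW G00)) -/(q T.+1) -/(b T.+1).
    move=> /(ler_wpM2l (ltW eta0)); rewrite mulr_sumr.
    under eq_bigr => k _ do rewrite -/(q k.+1) -/(b k.+1) mulrA [eta * _]mulrC -mulrA [X in _ * X]mulrC.
    under [X in _ -> X <= _]eq_bigr => k _ do rewrite mulrC.
    under eq_bigr => k _ do rewrite [_^-1 * eta]mulrC -/(th k).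
    by rewrite mulrA [eta * 2]mulrC.
  have h3 : b T.+1 / (2 * eta) * \sum_(1 <= k < T.+1) enorm (u k) ^+ 2 <= eta * P * b T.+1.
    have c0 : 0 <= b T.+1 / (2 * eta).
      by rewrite divr_ge0 ?mulr_ge0 ?ltW// path_b_gt0.
    have := sum_u (leqnn T); have := hP T (leqnn T) => h4 h5.
    have h6 : \sum_(1 <= k < T.+1) enorm (u k) ^+ 2 <= 2 * (eta ^+ 2 * P) by lra.
    apply: le_trans (ler_wpM2l c0 h6) _; rewrite le_eqVlt; apply/orP; left; apply/eqP.
    by field; rewrite gt_eqF.
  have h7 : (b T.+1 - G0) / (2 * eta) * DL ^+ 2 <= DL ^+ 2 / (2 * eta) * Num.sqrt (q T.+1).
    have -> : (b T.+1 - G0) / (2 * eta) * DL ^+ 2 = DL ^+ 2 / (2 * eta) * (b T.+1 - G0).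
      by field; rewrite gt_eqF.
    by rewrite ler_wpM2l ?bG// divr_ge0 ?sqr_ge0// mulr_ge0// ltW.
  have h8 := ler_wpM2l (ltW eta0) (bG T.+1).
  have h9 := ler_wpM2l (mulr_ge0 (ltW eta0) P0) (bG T.+1).
  lra.
elim: n => [_|n IH nT].
  by rewrite !big_geq// path_b1 subrr mul0r mulr0 !addr0 mul0r addr0 subrr.
have n1T : (1 <= n.+1 <= T)%N by [].
have := IH (ltnW nT); rewrite !(big_nat_recr n.+1)//=.
have th0 := path_th_gt0 n.+1.
have b0 := path_b_gt0 n.+2; have bS := path_bS (t := n.+1) isT.
have e1 : b n.+2 / (2 * eta) * (Dist n.+1 - Dist n.+2) + th n.+1 * enorm (g n.+1) ^+ 2 / 2 +
    dotv (g n.+1) (u n.+1) = dotv (g n.+1) (v n.+1).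
  by rewrite (path_dist_step n1T) /p /th; field; rewrite !gt_eqF.
have e2 : dotv (g n.+1) (u n.+1) <= th n.+1 * enorm (g n.+1) ^+ 2 / 2 +
    b T.+1 / (2 * eta) * enorm (u n.+1) ^+ 2.
  apply: le_trans (dotv_young _ _ th0) _.
  have -> : enorm (u n.+1) ^+ 2 / (2 * th n.+1) = b n.+2 / (2 * eta) * enorm (u n.+1) ^+ 2.
    by rewrite /th; field; rewrite !gt_eqF.
  (* The weight is raised to its final value because [sum_u] controls unweighted sums. *)
  have bT : b n.+2 <= b T.+1.
    rewrite ler_wsqrtr// lerD2l /q [leRHS](big_cat_nat _ (n := n.+2))//=.
      by rewrite lerDl; apply: sumr_ge0 => k _; exact: sqr_ge0.
  have : b n.+2 / (2 * eta) * enorm (u n.+1) ^+ 2 <= b T.+1 / (2 * eta) * enorm (u n.+1) ^+ 2.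
    rewrite ler_wpM2r ?sqr_ge0// ler_wpM2r// invr_ge0 mulr_ge0// ltW//.
  lra.
have e3 : (b n.+2 - b n.+1) / (2 * eta) * Dist n.+1 <= (b n.+2 - b n.+1) / (2 * eta) * DL ^+ 2.
  rewrite ler_wpM2l//.
    by rewrite divr_ge0 ?subr_ge0// mulr_ge0// ltW.
  by rewrite /Dist lerXn2r ?nnegrE ?enorm_ge0// hx.
lra.
Qed.

End Minimizer.

End Trajectory.

(** * A self-bounding inequality for the sum of the gaps *)

Let S := \sum_(1 <= k < T.+1) Delta (xb k).

Lemma path_regret_noise xs V lam l : 0 <= lam -> 0 <= V ->
  (forall k, (1 <= k <= T)%N -> enorm (xb k - xs) <= V) ->
  \sum_(1 <= k < T.+1)
    regret_process f A B C fstar lam V xs (xb k) (q k) (g k) <= l ->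
  - (lam * \sum_(1 <= k < T.+1) dotv (xi k) (xb k - xs)) <=
  l + lam ^+ 2 * V ^+ 2 / 2 * ((A + 2 * B * L) * S + C * T%:R).
Proof.
move=> lam0 V0 hV hl.
have CT : C * T%:R = \sum_(1 <= k < T.+1) C.
  by rewrite sumr_const_nat subn1/= mulr_natr.
suff : - (lam * \sum_(1 <= k < T.+1) dotv (xi k) (xb k - xs)) <=
  \sum_(1 <= k < T.+1) regret_process f A B C fstar lam V xs (xb k) (q k) (g k) +
  lam ^+ 2 * V ^+ 2 / 2 * ((A + 2 * B * L) * S + C * T%:R) by lra.
rewrite CT /S [_ * \sum_(_ <= _ < _) Delta _]mulr_sumr -big_split/= !mulr_sumr.
rewrite -sumrN -big_split/= !big_nat; apply: ler_sum => k /andP[k1 kT].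
have kT' : (1 <= k <= T)%N by rewrite k1.
rewrite /regret_process hV// -/(xi k) dotvZl (dotvC _ (xi k)) !exprMn.
rewrite (sqr_sqrtr (path_nb_ge0 (xb k))).
have c0 : 0 <= lam ^+ 2 * V ^+ 2 / 2 by rewrite divr_ge0// mulr_ge0 ?sqr_ge0.
have := ler_wpM2l c0 (path_nb_le (xb k)); rewrite -/(nb (xb k)); lra.
Qed.

Lemma path_sum_sqr_g :
  q T.+1 <= 2 * (A + 2 * (B + 1) * L) * S + 2 * C * T%:R.
Proof.
have -> : 2 * C * T%:R = \sum_(1 <= k < T.+1) 2 * C.
  by rewrite sumr_const_nat subn1/= mulr_natr.
rewrite /S mulr_sumr -big_split/= /q !big_nat.
by apply: ler_sum => k /andP[k1 kT]; apply: path_sqr_g; rewrite k1.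
Qed.

Lemma path_sum_Delta_ge0 : 0 <= S.
Proof. by apply: sumr_ge0 => k _; exact: path_Delta_ge0. Qed.

(** In [lam^-1] the summand [2 * V ^ 2 * a] makes the part of the compensator proportional to [S] at
    most [S / 4], and [V * w / l] balances [l / lam] against the part from [C]. The root of the sum
    of squared gradients costs another [S / 4] by Young's inequality with weight [4 * a']; the
    remaining half of [S] is then doubled. *)
Lemma path_average xs (DL P l : R) :
  convex_function [set: convex_lmodType 'rV[R]_d] f -> f xs = fstar ->
  (0 < T)%N -> 0 < DL -> 0 < l ->
  (forall n, (n <= T)%N -> \sum_(1 <= k < n.+1) p k <= eta ^+ 2 * P) ->
  (forall t, (1 <= t <= T)%N -> enorm (x t - xs) <= DL) ->
  let V := DL + eta in
  let a := A + 2 * B * L in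
  let lam := (2 * V ^+ 2 * a + V * Num.sqrt (C * T%:R * l) / l)^-1 in
  \sum_(1 <= k < T.+1)
    regret_process f A B C fstar lam V xs (xb k) (q k) (g k) <= l ->
  forall K, K = 2 * eta + DL ^+ 2 / eta + eta * P ->
  S <= G0 / eta * enorm (x 1%N - xs) ^+ 2 + 2 * eta * P * G0 +
    4 * K ^+ 2 * (A + 2 * (B + 1) * L) + 2 * K * Num.sqrt (2 * C * T%:R) +
    4 * V ^+ 2 * a * l + 3 * V * Num.sqrt (C * T%:R * l).
Proof.
move=> cf xsE T0 DL0 l0 hP hx V a lam hl K KE.
have V0 : 0 < V by rewrite addr_gt0.
have a0 : 0 < a by rewrite addr_gt0// !mulr_gt0.
have TR0 : 0 < T%:R :> R by rewrite ltr0n.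
pose w := Num.sqrt (C * T%:R * l).
have w0 : 0 < w by rewrite sqrtr_gt0 !mulr_gt0.
have w2 : w ^+ 2 = C * T%:R * l by rewrite sqr_sqrtr// ltW// !mulr_gt0.
pose j := 2 * V ^+ 2 * a + V * w / l.
have j0 : 0 < j by rewrite addr_gt0 ?divr_gt0 ?mulr_gt0 ?exprn_gt0.
have lamE : lam = j^-1 by [].
have lam0 : 0 < lam by rewrite lamE invr_gt0.
have hV k : (1 <= k <= T)%N -> enorm (xb k - xs) <= V.
  move=> kT; have -> : xb k - xs = (x k - xs) + u k.
    by apply/rowP => i; rewrite !mxE; ring.
  apply: le_trans (ler_enormD _ _) _; apply: lerD; first exact: hx.
  exact: u_le.
have N1 := path_regret_noise (ltW lam0) (ltW V0) hV hl.
have N2 := path_regret_linear (ltW DL0) hP hx.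
rewrite -/a in N1; have S0 := path_sum_Delta_ge0.
have P0 : 0 <= P.
  have := hP 0%N isT; rewrite big_geq// => /=.
  by rewrite pmulr_rge0// exprn_gt0.
have N3 : S <= \sum_(1 <= k < T.+1) dotv (g k) (xb k - xs) -
    \sum_(1 <= k < T.+1) dotv (xi k) (xb k - xs).
  rewrite -sumrB /S !big_nat; apply: ler_sum => k _.
  apply: le_trans (path_convex cf xsE k) _.
  by rewrite -dotvBl (_ : g k - xi k = grad f (xb k))// /xi opprB addrC subrK.
set N := \sum_(1 <= k < T.+1) dotv (xi k) _ in N1 N3.
have N4 : - N <= 2 * V ^+ 2 * a * l + 3 / 2 * V * w + S / 4.
  have : - N <= j * l + lam * V ^+ 2 / 2 * (a * S + C * T%:R).
    have := ler_wpM2l (ltW j0) N1; rewrite lamE.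
    have -> : j * - (j^-1 * N) = - N by field; rewrite gt_eqF.
    have -> : j * (l + j^-1 ^+ 2 * V ^+ 2 / 2 * (a * S + C * T%:R)) =
       j * l + j^-1 * V ^+ 2 / 2 * (a * S + C * T%:R) by field; rewrite gt_eqF.
    by [].
  have -> : j * l = 2 * V ^+ 2 * a * l + V * w by rewrite /j; field; rewrite gt_eqF.
  have e1 : lam * V ^+ 2 / 2 * (a * S) <= S / 4.
    have -> : lam * V ^+ 2 / 2 * (a * S) = (V ^+ 2 * a * S / 2) / j.
      by rewrite lamE; field; rewrite gt_eqF.
    rewrite ler_pdivrMr// /j (mulrDr (S / 4)).
    have c1 : 0 <= V * w / l by apply: ltW; rewrite divr_gt0 ?mulr_gt0.
    have : 0 <= S / 4 * (V * w / l) by rewrite mulr_ge0// divr_ge0.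
    lra.
  have e2 : lam * V ^+ 2 / 2 * (C * T%:R) <= V * w / 2.
    have -> : lam * V ^+ 2 / 2 * (C * T%:R) = (V ^+ 2 * (w ^+ 2 / l) / 2) / j.
      by rewrite lamE w2; field; rewrite !gt_eqF.
    rewrite ler_pdivrMr// /j (mulrDr (V * w / 2)).
    have : 0 < V * w / 2 * (2 * V ^+ 2 * a).
      by rewrite !mulr_gt0 ?invr_gt0 ?exprn_gt0.
    have -> : V * w / 2 * (V * w / l) = V ^+ 2 * (w ^+ 2 / l) / 2.
      by field; rewrite gt_eqF.
    lra.
  lra.
pose a' := A + 2 * (B + 1) * L.
have a'0 : 0 < a' by rewrite addr_gt0// !mulr_gt0// addr_gt0.
have N5 : Num.sqrt (q T.+1) <= Num.sqrt (2 * a' * S) + Num.sqrt (2 * C * T%:R).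
  apply: le_trans (sqrtD_le _ _); first exact: ler_wsqrtr path_sum_sqr_g.
    by rewrite !mulr_ge0// ltW.
  by rewrite !mulr_ge0// ltW.
have K0 : 0 <= K.
  by rewrite KE !addr_ge0 ?divr_ge0 ?mulr_ge0 ?sqr_ge0// ltW.
have N6 : K * Num.sqrt (2 * a' * S) <= S / 4 + 2 * a' * K ^+ 2.
  have aS : 0 <= 2 * a' * S by rewrite !mulr_ge0// ltW.
  have c0 : 0 < 4 * a' by rewrite mulr_gt0.
  have := young K (Num.sqrt (2 * a' * S)) c0; rewrite sqr_sqrtr//.
  have -> : 2 * a' * S / (2 * (4 * a')) = S / 4 by field; rewrite gt_eqF.
  lra.
have N7 : (DL ^+ 2 / (2 * eta) + 2 * eta + eta * P) * Num.sqrt (q T.+1) <=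
    K * Num.sqrt (q T.+1).
  rewrite ler_wpM2r ?sqrtr_ge0// KE.
  have -> : DL ^+ 2 / (2 * eta) = DL ^+ 2 / eta / 2 by field; rewrite gt_eqF.
  have : 0 <= DL ^+ 2 / eta by rewrite divr_ge0 ?sqr_ge0// ltW.
  lra.
have N8 := ler_wpM2l K0 N5.
have -> : G0 / eta = 2 * (G0 / (2 * eta)) by field; rewrite gt_eqF.
rewrite -/w -/a'; lra.
Qed.

Lemma path_main (xs : 'rV[R]_d) (l lT ll F cap Rb DL : R) :
  (1 <= T)%N -> convex_function [set: convex_lmodType 'rV[R]_d] f -> f xs = fstar ->
  3 / 4 <= l -> l <= lT -> l <= ll ->
  let D1 := Delta (x 1%N) in
  let X := 2 * A + 4 * L * B + 4 * L in
  F = ln (1 + ((X * D1 + 2 * C) * T%:R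
      + X * (3 * eta * enorm (grad f (x 1%N)) + 9 * L * eta ^+ 2 / 2) * T%:R ^+ 2
      + 9 * L * eta ^+ 2 / 2 * X * T%:R ^+ 3) / G0 ^+ 2) ->
  let m := A + 2 * B * L in
  cap = 4 * D1 + 8 * L * eta ^+ 2 * F + 36 * eta ^+ 2 * m * lT ^+ 2
      + 12 * eta * Num.sqrt C * lT + 64 * eta ^+ 2 * m * F ^+ 2
      + 16 * eta * Num.sqrt C * F + 10 * L * eta ^+ 2 ->
  let M := m * cap + C in
  Rb = 2 * eta ^+ 2 * ln (1 + T%:R * M / (2 * G0 ^+ 2))
      + 7 * eta ^+ 2 / G0 ^+ 2 * M * lT ->
  0 < DL ->
  2 * enorm (x 1%N - xs) ^+ 2 + 4 * Rb + 10 * eta ^+ 2 * F + eta ^+ 2 / 2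
    + 512 * ll * Rb <= DL ^+ 2 ->
  let V := DL + eta in
  (forall n, (n <= T)%N -> \sum_(1 <= k < n.+1) descent_process f A B C eta G0
    fstar cap (eta * Num.sqrt M)^-1 (xb k) (q k) (g k) <= l) ->
  (forall n, (n <= T)%N -> \sum_(1 <= k < n.+1)
    energy_process f fstar cap M (xb k) (q k) (g k) <= l) ->
  (forall n, (n <= T)%N -> \sum_(1 <= k < n.+1) distance_process f eta G0
    fstar cap (16 * l / V ^+ 2) V xs (xb k) (q k) (g k) <= l) ->
  (forall n, (n <= T)%N -> \sum_(1 <= k < n.+1) regret_process f A B C fstar
    (2 * V ^+ 2 * m + V * Num.sqrt (C * T%:R * l) / l)^-1 V xs
    (xb k) (q k) (g k) <= l) ->
  f (T%:R^-1 *: \sum_(1 <= t < T.+1) xb t) - fstar <=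
    (12 * m * V ^+ 2 * l + 2 * G0 * enorm (x 1%N - xs) ^+ 2 / eta) * (1 / T%:R)
    + (4 * (2 * eta + DL ^+ 2 / eta + eta * F) ^+ 2 * (A + 2 * (B + 1) * L)
       + 4 * eta * F * G0) * (1 / T%:R)
    + (7 * V * Num.sqrt (C * l)
       + 4 * (2 * eta + DL ^+ 2 / eta + eta * F) * Num.sqrt (2 * C)) / Num.sqrt T%:R.
Proof.
move=> T1 cf xsE l34 llT lth D1 X FE m capE M RbE DL0 hDL V hA hB hC hD.
have l0 : 0 < l by lra.
have lT0 : 0 <= lT by lra.
have m0 : 0 < m by rewrite addr_gt0// !mulr_gt0.
have G2 : 0 < G0 ^+ 2 by rewrite exprn_gt0.
have T0 : 0 < T%:R :> R by rewrite ltr0n.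
have D10 : 0 <= D1 := path_Delta_ge0 _.
have Gi : 0 <= (G0 ^+ 2)^-1 by rewrite invr_ge0 ltW.
have q0 n : 0 <= q n / G0 ^+ 2 by rewrite mulr_ge0 ?path_q_ge0.
have qF n : (n <= T)%N -> ln (1 + q n.+1 / G0 ^+ 2) <= F.
  move=> nT; have := ler_wpM2r Gi (path_growth nT); rewrite FE => h.
  by rewrite ler_ln ?posrE ?lerD2l// ltr_wpDr//; apply: le_trans h.
have F0 : 0 <= F by apply: le_trans (qF T (leqnn T)); rewrite ln_ge0// lerDl.
have hP n : (n <= T)%N -> \sum_(1 <= k < n.+1) p k <= eta ^+ 2 * F.
  by move=> nT; apply: le_trans (path_sum_p n) _; rewrite ler_wpM2l ?sqr_ge0// qF.
have capC := cap_closed D10 eta0 L0 m0 C0 (ltW l0) llT F0 capE.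
have cap0 := cap_ge0 D10 eta0 L0 m0 lT0 F0 capE.
have M0 : 0 < M by rewrite ltr_wpDl// mulr_ge0// ltW.
have nbM y : Delta y <= cap -> nb y <= M.
  move=> hy; apply: le_trans (path_nb_le y) _.
  by rewrite lerD2r ler_wpM2l// ltW.
have hcap := path_bounded M0 nbM (ltW l0) hA hP capC.
have s0 := sqrtr_ge0 M.
have WR := noise_sum_ge G00 M0 RbE.
have hR n : (n <= T)%N ->
    \sum_(1 <= k < n.+1) (eta / b k) ^+ 2 * enorm (xi k) ^+ 2 <= Rb.
  move=> nT; apply: le_trans (path_noise_sum M0 nbM hcap (ltW l0) nT hB) _.
  rewrite RbE mulrDr; apply: lerD; first by rewrite le_eqVlt; apply/orP; left; apply/eqP; ring.
  (* The factor 7 arises from [2 + 4 * l <= 7 * l], valid since [3 / 4 <= l]. *)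
  have -> : eta ^+ 2 * (2 * (M + 2 * M * l) / G0 ^+ 2) =
    (2 + 4 * l) * (eta ^+ 2 / G0 ^+ 2 * M) by ring.
  have -> : 7 * eta ^+ 2 / G0 ^+ 2 * M * lT = 7 * lT * (eta ^+ 2 / G0 ^+ 2 * M) by ring.
  apply: ler_wpM2r; last lra.
  by rewrite mulr_ge0 ?(ltW M0)// mulr_ge0 ?sqr_ge0.
have V0 : 0 < V by rewrite addr_gt0.
have lam0 : 0 < 16 * l / V ^+ 2 by rewrite divr_gt0 ?exprn_gt0// mulr_gt0.
have d10 : 0 <= enorm (x 1%N - xs) ^+ 2 := sqr_ge0 _.
have [_ hdist] := distance_closed d10 eta0 G00 s0 l34 llT lth F0 WR DL0 hDL.
have hx := path_distance M0 nbM hcap cf xsE V0 lam0 hC hP hR (ltW l0) (ltW DL0)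
  (lexx _) hdist.
have hx' t : (1 <= t <= T)%N -> enorm (x t - xs) <= DL.
  by move=> tT; apply: hx; case/andP: tT => -> /leqW.
have K0 : 0 <= 2 * eta + DL ^+ 2 / eta + eta * F.
  have e0 := ltW eta0; apply: addr_ge0; last exact: mulr_ge0.
  apply: addr_ge0; first exact: mulr_ge0.
  by apply: divr_ge0 => //; exact: sqr_ge0.
have Sle := path_average cf xsE T1 DL0 l0 hP hx' (hD T (leqnn T)) erefl.
have := average_bound T1 d10 eta0 G00 (ltW l0) F0 (ltW C0) K0 (ltW V0) (ltW m0) Sle.
apply: le_trans.
have := convex_average xb cf T1.
have -> : S = (\sum_(1 <= t < T.+1) f (xb t)) - T%:R * fstar.
  rewrite /S sumrB sumr_const_nat subn1/=; congr (_ - _).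
  by rewrite mulr_natl.
rewrite mulrBl => h.
have -> : T%:R * fstar / T%:R = fstar by field; rewrite gt_eqF.
by rewrite lerD2r.
Qed.

End Path.

(** * Measurability along a run *)

Section ProcessMeasurability.
Context {R : realType} {d : nat}.

Lemma enorm_lipschitz_continuous (h : 'rV[R]_d -> R) (K : R) :
  (forall x y, `|h x - h y| <= K * enorm (x - y)) -> continuous h.
Proof.
move=> hK x s /= /(nbhs_ballP (h x)) [e /= e0 es].
(* Balls are those of the sup norm, and the Euclidean norm is at most [Num.sqrt d] times it; the
   [+ 1] keeps the divisor positive. *)
pose r := e / (`|K| * Num.sqrt d%:R + 1).
have c0 : 0 <= `|K| * Num.sqrt d%:R by rewrite mulr_ge0// sqrtr_ge0.
have r0 : 0 < r by rewrite divr_gt0// ltr_wpDl.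
apply/nbhs_ballP; exists r => //= y [_ xy].
apply: es; apply: le_lt_trans (hK x y) _.
have n1 : enorm (x - y) <= Num.sqrt d%:R * r.
  rewrite -[r](ger0_norm (ltW r0)) -sqrtr_sqr -sqrtrM// ler_wsqrtr//.
  apply: (@le_trans _ _ (\sum_(i < d) r ^+ 2)); last first.
    by rewrite sumr_const card_ord mulr_natl.
  apply: ler_sum => i _; rewrite -[leLHS]real_normK ?num_real// lerXn2r ?nnegrE ?(ltW r0)//.
  have -> : (x - y) 0 i = x 0 i - y 0 i by rewrite !mxE.
  by have := xy 0 i; rewrite /ball/= => /ltW.
have : K * enorm (x - y) <= `|K| * (Num.sqrt d%:R * r).
  apply: le_trans (ler_wpM2r (enorm_ge0 _) (ler_norm K)) _.
  by rewrite ler_wpM2l.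
move=> /le_lt_trans; apply.
have -> : `|K| * (Num.sqrt d%:R * r) = `|K| * Num.sqrt d%:R * e / (`|K| * Num.sqrt d%:R + 1).
  by rewrite /r !mulrA.
rewrite ltr_pdivrMr ?ltr_wpDl//; nra.
Qed.

Variables (f : 'rV[R]_d -> R) (L : R).
Hypotheses (df : forall y, differentiable f y) (sf : L_smooth L f).

Lemma measurable_f : measurable_fun [set: borel_rV R d] (f : borel_rV R d -> R).
Proof.
by apply: measurable_continuous_rV => y; exact: differentiable_continuous.
Qed.

Lemma measurable_grad :
  measurable_fun [set: borel_rV R d] (grad f : borel_rV R d -> borel_rV R d).
Proof.
apply: measurable_rV => i; apply: measurable_continuous_rV.
apply: (@enorm_lipschitz_continuous _ L) => x y.
apply: le_trans (sf x y).
have -> : grad f x 0 i - grad f y 0 i = (grad f x - grad f y) 0 i by rewrite !mxE.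
exact: coord_le_enorm.
Qed.

Context {dT : measure_display} {T : measurableType dT}.
Variables (y gv : T -> borel_rV R d) (q : T -> R).
Hypotheses (my : measurable_fun setT y) (mg : measurable_fun setT gv).
Hypothesis mq : measurable_fun setT q.
Variables (A B C eta G0 fstar cap M lam V : R) (xs : 'rV[R]_d).
Hypothesis G00 : 0 < G0.

Let mf : measurable_fun setT (fun t => f (y t)).
Proof. exact: (measurableT_comp measurable_f my). Qed.

Let mgr : measurable_fun setT (fun t => grad f (y t) : borel_rV R d).
Proof. exact: (measurableT_comp measurable_grad my). Qed.

Let mgap : measurable_fun setT (fun t => f (y t) - fstar <= cap).
Proof.
by apply: measurable_fun_ler; [apply: measurable_funB|exact: measurable_cst].
Qed.

Let mxi : measurable_fun setT (fun t => (gv t : 'rV[R]_d) - grad f (y t) : borel_rV R d).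
Proof. exact: measurable_rVB. Qed.

Let mv : measurable_fun setT (fun t => (y t : 'rV[R]_d) - xs : borel_rV R d).
Proof. by apply: measurable_rVB => //; exact: measurable_cst. Qed.

Let mV : measurable_fun setT (fun t => enorm ((y t : 'rV[R]_d) - xs) <= V).
Proof.
by apply: measurable_fun_ler; [exact: measurable_enorm|exact: measurable_cst].
Qed.

Lemma measurable_noise_bound :
  measurable_fun setT (fun t => noise_bound f A B C fstar (y t)).
Proof.
apply: measurable_funD => //; apply: measurable_funD.
  by apply: measurable_funM => //; exact: measurable_funB.
by apply: measurable_funM => //; apply: measurable_funX; exact: measurable_enorm.
Qed.

Let mnb : measurable_fun setT (fun t => Num.sqrt (noise_bound f A B C fstar (y t))).
Proof. exact: measurable_sqrtr measurable_noise_bound. Qed.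

Lemma measurable_inv_sqrt (a : T -> R) : measurable_fun setT a ->
  (forall t, 0 < a t) -> measurable_fun setT (fun t => eta / Num.sqrt (a t)).
Proof.
move=> ma a0; apply: measurable_funM => //; apply: measurable_invr.
  exact: measurable_sqrtr.
by move=> t; rewrite sqrtr_gt0.
Qed.

Let G0q (t : T) : 0 < G0 ^+ 2 + `|q t|.
Proof. by rewrite ltr_wpDr// exprn_gt0. Qed.

Let mG0q : measurable_fun setT (fun t => G0 ^+ 2 + `|q t|).
Proof. by apply: measurable_funD => //; exact: measurableT_comp. Qed.

Lemma measurable_descent_process : measurable_fun setT
  (fun t => descent_process f A B C eta G0 fstar cap lam (y t) (q t) (gv t)).
Proof.
have mh : measurable_fun setT
    (fun t => lam * decorrelated_step f A B C eta G0 fstar (y t) (q t)).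
  apply: measurable_funM => //; apply: measurable_inv_sqrt.
    apply: measurable_funD => //; apply: measurable_funX; apply: measurable_funD => //.
    exact: measurable_enorm.
  by move=> t; rewrite ltr_wpDr ?sqr_ge0.
apply: measurable_fun_ifT => //.
apply: measurable_funB.
  by apply: measurable_dotv => //; apply: measurable_rVZ => //; exact: measurableT_comp.
apply: measurable_funM => //; apply: measurable_funX; apply: measurable_funM => //.
by apply: measurable_funM => //; exact: measurable_enorm.
Qed.

Lemma measurable_energy_process : measurable_fun setT
  (fun t => energy_process f fstar cap M (y t) (q t) (gv t)).
Proof.
apply: measurable_fun_ifT => //; apply: measurable_funB.
  by apply: measurable_dotv => //; exact: measurable_rVZ.
apply: measurable_funM => //; apply: measurable_funX; apply: measurable_funM => //.
by apply: measurable_funM => //; exact: measurable_enorm.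
Qed.

Lemma measurable_distance_process : measurable_fun setT
  (fun t => distance_process f eta G0 fstar cap lam V xs (y t) (q t) (gv t)).
Proof.
have ms : measurable_fun setT (fun t => dotv
    (- (lam * (eta / Num.sqrt (G0 ^+ 2 + `|q t|))) *: ((y t : 'rV[R]_d) - xs))
    ((gv t : 'rV[R]_d) - grad f (y t))).
  apply: measurable_dotv => //; apply: measurable_rVZ => //.
  apply: measurableT_comp => //; apply: measurable_funM => //.
  exact: measurable_inv_sqrt.
apply: measurable_fun_ifT => //; first exact: measurable_and.
by apply: measurable_funB => //; exact: measurable_funX.
Qed.

Lemma measurable_regret_process : measurable_fun setT
  (fun t => regret_process f A B C fstar lam V xs (y t) (q t) (gv t)).
Proof.
apply: measurable_fun_ifT => //; apply: measurable_funB.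
  by apply: measurable_dotv => //; exact: measurable_rVZ.
by apply: measurable_funM => //; apply: measurable_funX; exact: measurable_funM.
Qed.

End ProcessMeasurability.

(** * A run as a Markov chain driven by the samples *)

Section Run.
Context {R : realType} {d : nat} {dO dZ : measure_display}.
Context {Omega : measurableType dO} {Z : measurableType dZ}.
Variables (P : probability Omega R) (D : probability Z R).
Variables (f : 'rV[R]_d -> R) (G : 'rV[R]_d -> Z -> 'rV[R]_d).
Variables (L A B C eta G0 : R) (T : nat) (z : nat -> {RV P >-> Z}).
Variables (alpha c : nat -> R) (theta gamma : nat -> Omega -> R).
Variables (x1 : 'rV[R]_d) (x xt xb g : nat -> Omega -> 'rV[R]_d).
Hypotheses (df : forall y, differentiable f y) (sf : L_smooth L f).
Hypothesis mG : forall i, measurable_fun [set: borel_rV R d * Z]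
    (fun p : borel_rV R d * Z => G p.1 p.2 0 i).
Hypotheses (unb : unbiased D G f) (hnoise : relaxed_noise D G f A B C).
Hypotheses (iid : iid_samples D T z) (G00 : 0 < G0).
Hypothesis run : agd_run G (fun t w => z t w) T x1 alpha theta gamma x xt xb g.
Hypothesis thE : forall t w, (1 <= t <= T)%N -> theta t w = adaptive_step eta G0 g t w.
Hypothesis gmE : forall t w, (1 <= t <= T)%N -> gamma t w = c t * theta t w.

(** The third component is the sum of squared gradients: with it the adaptive step is a function of
    the state and the fresh sample, which makes the chain Markov. *)
Let S := (borel_rV R d * borel_rV R d * R)%type.
Let bar t (p : S) : 'rV[R]_d :=
  alpha t *: (p.1.1 : 'rV[R]_d) + (1 - alpha t) *: (p.1.2 : 'rV[R]_d).
Let samp t (p : S * Z) : 'rV[R]_d := G (bar t p.1) p.2.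
Let nextq t (p : S * Z) : R := p.1.2 + enorm (samp t p) ^+ 2.
Let step t (p : S * Z) : R := eta / Num.sqrt (G0 ^+ 2 + `|nextq t p|).
Let Psi t (p : S * Z) : S :=
  (((p.1.1.1 : 'rV[R]_d) - step t p *: samp t p : borel_rV R d,
    bar t p.1 - (c t * step t p) *: samp t p : borel_rV R d), nextq t p).
Let q t w := \sum_(1 <= k < t) enorm (g k w) ^+ 2.
Let s t w : S := ((x t w : borel_rV R d, xt t w : borel_rV R d), q t w).

Lemma run_bar t w : (1 <= t <= T)%N -> bar t (s t w) = xb t w.
Proof. by move=> tT; rewrite (agd_xb run). Qed.

Lemma run_samp t w : (1 <= t <= T)%N -> samp t (s t w, z t w) = g t w.
Proof. by move=> tT; rewrite /samp run_bar// (agd_g run). Qed.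

Lemma run_nextq t w : (1 <= t <= T)%N -> nextq t (s t w, z t w) = q t.+1 w.
Proof.
move=> tT; rewrite /nextq run_samp// /q big_nat_recr//.
by case/andP: tT.
Qed.

Lemma run_q_ge0 t w : 0 <= q t w.
Proof. by apply: sumr_ge0 => k _; exact: sqr_ge0. Qed.

Lemma run_step t w : (1 <= t <= T)%N -> step t (s t w, z t w) = theta t w.
Proof.
by move=> tT; rewrite /step run_nextq// (ger0_norm (run_q_ge0 _ _)) thE.
Qed.

Lemma run_state1 w : s 1%N w = ((x1 : borel_rV R d, x1 : borel_rV R d), 0).
Proof. by rewrite /s (agd_x1 run) (agd_xt1 run) /q big_geq. Qed.

Lemma run_stateS t w : (1 <= t <= T)%N -> s t.+1 w = Psi t (s t w, z t w).
Proof.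
move=> tT; rewrite /Psi run_step// run_samp// run_nextq// run_bar//.
by rewrite /s (agd_x run)// (agd_xt run)// gmE.
Qed.

Let mx1 : measurable_fun [set: S] (fun p : S => p.1.1).
Proof. exact: (measurableT_comp measurable_fst measurable_fst). Qed.

Let mx2 : measurable_fun [set: S] (fun p : S => p.1.2).
Proof. exact: (measurableT_comp measurable_snd measurable_fst). Qed.

Lemma measurable_bar t : measurable_fun [set: S] (bar t : S -> borel_rV R d).
Proof.
by apply: measurable_rVD; apply: measurable_rVZ => //; exact: measurable_cst.
Qed.

Let mbar t : measurable_fun [set: S * Z] (fun p : S * Z => bar t p.1 : borel_rV R d).
Proof. exact: (measurableT_comp (measurable_bar t) measurable_fst). Qed.

Lemma measurable_samp t : measurable_fun [set: S * Z] (samp t : S * Z -> borel_rV R d).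
Proof.
apply: measurable_rV => i.
apply: (measurableT_comp (mG i) (g := fun p : S * Z => (bar t p.1 : borel_rV R d, p.2))).
exact: measurable_fun_pair.
Qed.

Let mq : measurable_fun [set: S * Z] (fun p : S * Z => p.1.2).
Proof. exact: (measurableT_comp measurable_snd measurable_fst). Qed.

Let mnextq t : measurable_fun [set: S * Z] (nextq t).
Proof.
apply: measurable_funD => //; apply: measurable_funX; apply: measurable_enorm.
exact: measurable_samp.
Qed.

Lemma measurable_Psi t : measurable_fun [set: S * Z] (Psi t).
Proof.
have mstep : measurable_fun [set: S * Z] (step t).
  apply: measurable_inv_sqrt; last by move=> p; rewrite ltr_wpDr// exprn_gt0.
  by apply: measurable_funD => //; apply: measurableT_comp.
apply: measurable_fun_pair => //; apply: measurable_fun_pair.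
  apply: measurable_rVB; first exact: (measurableT_comp mx1 measurable_fst).
  by apply: measurable_rVZ => //; exact: measurable_samp.
apply: measurable_rVB => //; apply: measurable_rVZ; last exact: measurable_samp.
exact: measurable_funM.
Qed.

Lemma measurable_run_xb t : (1 <= t <= T)%N ->
  measurable_fun setT (xb t : Omega -> borel_rV R d).
Proof.
move=> tT; rewrite (_ : xb t = bar t \o s t); last first.
  by apply/funext => w; rewrite /= run_bar.
apply: (measurableT_comp (measurable_bar t)).
apply: (measurable_state measurable_Psi run_state1 run_stateS).
by case/andP: tT => -> /leqW.
Qed.

(** The noise assumption has a null set for each fixed point, whereas [xb t] is random; [null_step]
    bridges the two at each time, and the union runs over finitely many times. *)
Lemma run_noise : exists2 N : set Omega, measurable N /\ P N = 0%E &
  forall w, ~ N w -> forall t, (1 <= t <= T)%N ->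
    enorm (g t w - grad f (xb t w)) ^+ 2 <=
    noise_bound f A B C (inf (range f)) (xb t w).
Proof.
pose bad t : set (S * Z) := [set p |
  noise_bound f A B C (inf (range f)) (bar t p.1) <
  enorm (samp t p - grad f (bar t p.1)) ^+ 2].
have mbad t : measurable (bad t).
  rewrite -[bad t]setTI.
  have mb : measurable_fun [set: S * Z] (fun p : S * Z =>
     noise_bound f A B C (inf (range f)) (bar t p.1) <
     enorm (samp t p - grad f (bar t p.1)) ^+ 2).
    apply: measurable_fun_ltr.
      exact: (measurable_noise_bound df sf (mbar t)).
    have mgb : measurable_fun [set: S * Z]
        (fun p : S * Z => grad f (bar t p.1) : borel_rV R d).
      exact: (measurableT_comp (measurable_grad sf) (mbar t)).
    apply: measurable_funX; apply: measurable_enorm.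
    exact: (measurable_rVB (measurable_samp t) mgb).
  rewrite (_ : bad t = (fun p : S * Z =>
     noise_bound f A B C (inf (range f)) (bar t p.1) <
     enorm (samp t p - grad f (bar t p.1)) ^+ 2) @^-1` [set true]).
    exact: mb.
  by apply/seteqP; split.
have bad0 t : (1 <= t <= T)%N -> P ((fun w => (s t w, z t w)) @^-1` bad t) = 0%E.
  move=> tT; apply: (null_step iid measurable_Psi run_state1 run_stateS) => // p.
  have mX : measurable (xsection (bad t) p) by exact: measurable_xsection.
  apply: (measure_negligible mX).
  apply: negligibleS (hnoise (bar t p)) => y /=.
  rewrite /xsection/= inE /bad/= /samp/=; rewrite ltNge => /negP; exact.
have mXY t : (1 <= t <= T)%N -> measurable_fun setT (fun w => (s t w, z t w)).
  move=> tT; apply: measurable_fun_pair => //.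
  apply: (measurable_state measurable_Psi run_state1 run_stateS).
  by case/andP: tT => -> /leqW.
pose N := \bigcup_(t in [set t | (1 <= t <= T)%N]) ((fun w => (s t w, z t w)) @^-1` bad t).
have mN : measurable N.
  apply: bigcup_measurable => t tT; rewrite -[X in measurable X]setTI.
  exact: mXY.
exists N.
  split=> //; apply: (measure_negligible mN); rewrite /N bigcup_mkcond.
  apply: negligible_bigcup => t; case: ifPn => [|_]; last exact: negligible_set0.
  rewrite inE => tT; apply/negligibleP; last exact: bad0.
  by rewrite -[X in measurable X]setTI; exact: mXY.
move=> w wN t tT; rewrite leNgt; apply/negP => lt; apply: wN; exists t; first exact: tT.
suff : noise_bound f A B C (inf (range f)) (bar t (s t w)) <
  enorm (samp t (s t w, z t w) - grad f (bar t (s t w))) ^+ 2 by exact.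
by rewrite (run_samp w tT) (run_bar w tT).
Qed.

Lemma run_process (phi : 'rV[R]_d -> R -> 'rV[R]_d -> R) (delta : R) :
  0 < delta < 1 ->
  fair f A B C (inf (range f)) phi ->
  (forall (dU : measure_display) (U : measurableType dU)
      (y gv : U -> borel_rV R d) (r : U -> R),
    measurable_fun setT y -> measurable_fun setT gv -> measurable_fun setT r ->
    measurable_fun setT (fun v => phi (y v) (r v) (gv v))) ->
  exists2 E : set Omega, measurable E /\ (P E <= delta%:E)%E &
    forall w, ~ E w -> forall n, (n <= T)%N ->
      \sum_(1 <= k < n.+1) phi (xb k w) (q k w) (g k w) <= ln (1 / delta).
Proof.
move=> /andP[d0 d1] hphi mphi'.
have mphi t : measurable_fun [set: S * Z]
    (fun p : S * Z => phi (bar t p.1) p.1.2 (samp t p)).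
  exact: (mphi' _ _ _ _ _ (mbar t) (measurable_samp t) mq).
have [||E [mE PE] hE] := @exp_supermartingale_bound _ _ _ _ _ _ _ P D T z _ s Psi
  (fun t p => phi (bar t p.1) p.1.2 (samp t p)) (ln (1 / delta))
  iid measurable_Psi run_state1 run_stateS mphi.
- move=> t p; have [a ha] := hphi (bar t p) p.2.
  apply: (expR_noise_le1 (c := a) (nu := noise_bound f A B C (inf (range f)) (bar t p))
    (phi := phi (bar t p) p.2) unb (hnoise (bar t p)) _ ha).
  exact: (measurable_fun_pair2 p (mphi t)).
- by rewrite ln_ge0// ler_pdivlMr// mul1r ltW.
exists E.
  by split=> //; apply: le_trans PE _; rewrite div1r lnV ?posrE// opprK lnK ?posrE.
move=> w wE n nT; apply: le_trans (hE w wE n nT).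
rewrite le_eqVlt; apply/orP; left; apply/eqP; rewrite !big_nat.
apply: eq_bigr => k /andP[k1 kn]; have kT : (1 <= k <= T)%N.
  by rewrite k1 (leq_trans _ nT).
by rewrite run_samp// run_bar.
Qed.

End Run.

(** * The convergence rate *)

Lemma inf_range_min (R : realType) (U : Type) (f : U -> R) (xs : U) :
  (forall y, f xs <= f y) -> f xs = inf (range f).
Proof.
move=> hxs; apply/eqP; rewrite eq_le; apply/andP; split.
  by apply: lb_le_inf; [exists (f xs); exists xs|move=> _ [y _ <-]].
by apply: ge_inf; [exists (f xs) => _ [y _ <-]|exists xs].
Qed.

Lemma probability_ge_of_subset5 (R : realType) (dO : measure_display)
    (Omega : measurableType dO) (P : probability Omega R) (delta : R)
    (E N B1 B2 B3 B4 : set Omega) :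
  measurable E -> measurable N -> P N = 0%E ->
  measurable B1 /\ (P B1 <= delta%:E)%E -> measurable B2 /\ (P B2 <= delta%:E)%E ->
  measurable B3 /\ (P B3 <= delta%:E)%E -> measurable B4 /\ (P B4 <= delta%:E)%E ->
  (forall w, ~ N w -> ~ B1 w -> ~ B2 w -> ~ B3 w -> ~ B4 w -> E w) ->
  ((1 - 4 * delta)%:E <= P E)%E.
Proof.
move=> mE mN N0 [m1 p1] [m2 p2] [m3 p3] [m4 p4] H.
pose U := N `|` (B1 `|` (B2 `|` (B3 `|` B4))).
have mU : measurable U by do 4 apply: measurableU => //.
have EU : ~` E `<=` U.
  move=> w wE; apply: contrapT => wU; apply: wE; apply: H => hw; apply: wU.
  - by left.
  - by right; left.
  - by right; right; left.
  - by right; right; right; left.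
  - by right; right; right; right.
have PU : (P U <= (4 * delta)%:E)%E.
  have -> : (4 * delta)%:E = (0 + (delta%:E + (delta%:E + (delta%:E + delta%:E))))%E.
    by rewrite add0e -!EFinD; congr EFin; ring.
  have m34 : measurable (B3 `|` B4) by exact: measurableU.
  have m234 : measurable (B2 `|` (B3 `|` B4)) by exact: measurableU.
  have m1234 : measurable (B1 `|` (B2 `|` (B3 `|` B4))) by exact: measurableU.
  have PN : (P N <= 0)%E by rewrite N0.
  apply: le_trans (measureU2 _ mN m1234) _; apply: leeD => //.
  apply: le_trans (measureU2 _ m1 m234) _; apply: leeD => //.
  apply: le_trans (measureU2 _ m2 m34) _; apply: leeD => //.
  by apply: le_trans (measureU2 _ m3 m4) _; apply: leeD.
have PE : (P (~` E) <= (4 * delta)%:E)%E.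
  by apply: le_trans PU; apply: le_measure; rewrite ?inE//; exact: measurableC.
have := probability_setC P (measurableC mE); rewrite setCK => ->.
by rewrite EFinB leeB.
Qed.

Theorem theorem6 (R : realType) (d : nat) (dO dZ : measure_display)
  (Omega : measurableType dO) (P : probability Omega R)
  (Z : measurableType dZ) (D : probability Z R)
  (fz : 'rV[R]_d -> Z -> R) (f : 'rV[R]_d -> R) (G : 'rV[R]_d -> Z -> 'rV[R]_d)
  (L A B C eta G0 delta : R) (T : nat) (z : nat -> {RV P >-> Z})
  (alpha : nat -> R) (theta gamma : nat -> Omega -> R)
  (x1 xstar : 'rV[R]_d) (x xt xb g : nat -> Omega -> 'rV[R]_d) :
  (1 <= T)%N -> 0 < delta < 1 -> 0 < eta -> 0 < G0 -> 0 < L ->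
  0 < A -> 0 < B -> 0 < C ->
  is_mean_of D fz f ->
  stochastic_gradient fz G ->
  (forall y, differentiable f y) ->
  L_smooth L f ->
  convex_function [set: convex_lmodType 'rV[R]_d] f ->
  (forall y, f xstar <= f y) ->
  has_lbound (range f) ->
  unbiased D G f ->
  relaxed_noise D G f A B C ->
  iid_samples D T z ->
  agd_run G (fun t w => z t w) T x1 alpha theta gamma x xt xb g ->
  adagrad_norm eta G0 T theta gamma g \/ rsag eta G0 T alpha theta gamma g ->
  let fstar := inf (range f) in
  let T' : R := T%:R in
  let Delta1 := f x1 - fstar in
  let X := 2 * A + 4 * L * B + 4 * L in
  let F := ln (1 + ((X * Delta1 + 2 * C) * T'
      + X * (3 * eta * enorm (grad f x1) + 9 * L * eta ^+ 2 / 2) * T' ^+ 2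
      + 9 * L * eta ^+ 2 / 2 * X * T' ^+ 3) / G0 ^+ 2) in
  let DeltaL := 4 * Delta1 + 8 * L * eta ^+ 2 * F
      + 36 * eta ^+ 2 * (A + 2 * B * L) * ln (T' / delta) ^+ 2
      + 12 * eta * Num.sqrt C * ln (T' / delta)
      + 64 * eta ^+ 2 * (A + 2 * B * L) * F ^+ 2
      + 16 * eta * Num.sqrt C * F + 10 * L * eta ^+ 2 in
  let log2 (y : R) := ln y / ln 2 in
  let AT := 16 * ln (60 * log2 (4 * T') * ln (6 * T') / delta) in
  let BT := 16 * ln (60 * log2 (4 * T') * ln (6 * T') / delta) ^+ 2 in
  let WL := eta * Num.sqrt (A * DeltaL + C) / G0 + eta * Num.sqrt B in
  let RL := 2 * eta ^+ 2
        * ln (1 + T' * (A * DeltaL + 2 * B * L * DeltaL + C) / (2 * G0 ^+ 2))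
      + 7 * eta ^+ 2 / G0 ^+ 2 * (A * DeltaL + 2 * B * L * DeltaL + C)
        * ln (T' / delta) in
  forall DL : R, 0 < DL ->
  DL ^+ 2 = 2 * enorm (x1 - xstar) ^+ 2 + 4 * RL + 10 * eta ^+ 2 * F
      + eta ^+ 2 / 2 + 32 * (AT * RL + WL ^+ 2 * BT)
      + 8 / eta ^+ 2 * RL ^+ 2 ->
  ((1 - 4 * delta)%:E <=
   P [set w | (f (T'^-1 *: \sum_(1 <= t < T.+1) xb t w) - fstar <=
       (12 * (A + 2 * B * L) * (DL + eta) ^+ 2 * ln (1 / delta)
         + 2 * G0 * enorm (x1 - xstar) ^+ 2 / eta) * (1 / T')
     + (4 * (2 * eta + DL ^+ 2 / eta + eta * F) ^+ 2 * (A + 2 * (B + 1) * L)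
         + 4 * eta * F * G0) * (1 / T')
     + (7 * (DL + eta) * Num.sqrt (C * ln (1 / delta))
         + 4 * (2 * eta + DL ^+ 2 / eta + eta * F) * Num.sqrt (2 * C))
       / Num.sqrt T')%R])%E.
Proof.
move=> T1 /andP[d0 d1] eta0 G00 L0 A0 B0 C0 _ [_ mG] df sf cf xsmin lbf unb noise iid.
move=> run hmode fstar T' Delta1 X F DeltaL log2 AT BT WL RL DL DL0 DLE.
set l := ln (1 / delta); set E := [set w | _].
have [d4|d4] := leP (1 / 4) delta.
  by apply: le_trans (measure_ge0 P E); rewrite lee_fin; lra.
have [l34 llT lll] := log_terms T1 d0 d4.
rewrite -/l in l34 llT lll.
have xsE : f xstar = fstar by exact: inf_range_min.
have fmin y : fstar <= f y by rewrite -xsE.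
(* A deterministic ratio of [gamma] to [theta], 1 or [1 + alpha t], lets one Markov chain represent
   both methods. *)
have [c [thE gmE]] : exists c : nat -> R,
    (forall t w, (1 <= t <= T)%N -> theta t w = adaptive_step eta G0 g t w) /\
    (forall t w, (1 <= t <= T)%N -> gamma t w = c t * theta t w).
  case: hmode => h.
    exists (fun=> 1); split=> t w /(h t w)[e1 e2] //.
    by rewrite e1 e2 mul1r.
  by exists (fun t => 1 + alpha t); split=> t w /(h t w)[].
pose V := DL + eta.
pose m := A + 2 * B * L.
pose M := m * DeltaL + C.
have m0 : 0 < m by rewrite addr_gt0// !mulr_gt0.
have l0 : 0 < l by lra.
have V0 : 0 < V by rewrite addr_gt0.
have ME : A * DeltaL + 2 * B * L * DeltaL + C = M by rewrite /M /m; ring.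
have T0 : 0 < T' by rewrite ltr0n.
have D10 : 0 <= Delta1 by rewrite subr_ge0.
have X0 : 0 < X by rewrite /X !addr_gt0 ?mulr_gt0.
have G2 : 0 < G0 ^+ 2 by rewrite exprn_gt0.
have e1 : 0 <= enorm (grad f x1) := enorm_ge0 _.
have F0 : 0 <= F.
  have eta0' := ltW eta0; have X0' := ltW X0; have C0' := ltW C0.
  have L0' := ltW L0; have T0' := ltW T0.
  rewrite /F ln_ge0// lerDl; apply: divr_ge0; last exact: ltW.
  have h1 : 0 <= 9 * L * eta ^+ 2 / 2 by rewrite divr_ge0 ?mulr_ge0 ?sqr_ge0.
  apply: addr_ge0; first apply: addr_ge0.
  - by apply: mulr_ge0 => //; apply: addr_ge0; exact: mulr_ge0.
  - apply: mulr_ge0; last exact: sqr_ge0.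
    by apply: mulr_ge0 => //; apply: addr_ge0 => //; do 2 apply: mulr_ge0 => //.
  - by apply: mulr_ge0; [exact: mulr_ge0|exact: exprn_ge0].
have lT0 : 0 <= ln (T' / delta) by lra.
have cap0 : 0 <= DeltaL by exact: (cap_ge0 D10 eta0 L0 m0 lT0 F0 erefl).
have M0 : 0 < M by rewrite ltr_wpDl// mulr_ge0// ltW.
have nbM y : f y - fstar <= DeltaL -> noise_bound f A B C fstar y <= M.
  move=> hy; apply: le_trans (path_nb_le A C df sf L0 B0 fmin y) _.
  by rewrite lerD2r ler_wpM2l// ltW.
have d01 : 0 < delta < 1 by rewrite d0.
have RLE : RL = 2 * eta ^+ 2 * ln (1 + T%:R * M / (2 * G0 ^+ 2))
      + 7 * eta ^+ 2 / G0 ^+ 2 * M * ln (T' / delta) by rewrite /RL ME.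
have hRL := noise_sum_ge G00 M0 RLE.
set ll := ln (60 * log2 (4 * T') * ln (6 * T') / delta) in lll.
have hDL : 2 * enorm (x1 - xstar) ^+ 2 + 4 * RL + 10 * eta ^+ 2 * F + eta ^+ 2 / 2
    + 512 * ll * RL <= DL ^+ 2.
  have h1 : 0 <= 8 / eta ^+ 2 * RL ^+ 2 by rewrite mulr_ge0 ?divr_ge0 ?sqr_ge0.
  have h2 : 0 <= WL ^+ 2 * BT by rewrite mulr_ge0 ?sqr_ge0// mulr_ge0 ?sqr_ge0.
  rewrite DLE /AT -/ll; lra.
have e2 : 0 <= enorm (x1 - xstar) ^+ 2 := sqr_ge0 _.
have [hfair _] := distance_closed e2 eta0 G00 (sqrtr_ge0 M) l34 llT lll F0 hRL DL0 hDL.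
pose lamA := (eta * Num.sqrt M)^-1.
pose lamC := 16 * l / V ^+ 2.
pose lamD := (2 * V ^+ 2 * m + V * Num.sqrt (C * T' * l) / l)^-1.
have lamA0 : 0 <= lamA by rewrite invr_ge0 mulr_ge0 ?sqrtr_ge0 ?(ltW eta0).
have lamC0 : 0 <= lamC by rewrite divr_ge0 ?sqr_ge0// mulr_ge0// ltW.
have lamD0 : 0 <= lamD.
  rewrite invr_ge0; apply: addr_ge0; last first.
    by apply: divr_ge0; rewrite ?(ltW l0)// mulr_ge0 ?sqrtr_ge0 ?(ltW V0).
  by apply: mulr_ge0; rewrite ?(ltW m0)// mulr_ge0 ?sqr_ge0.
have fA : fair f A B C fstar (descent_process f A B C eta G0 fstar DeltaL lamA).
  exact: fair_descent.
have fB : fair f A B C fstar (energy_process f fstar DeltaL M) by exact: fair_energy.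
have fC : fair f A B C fstar (distance_process f eta G0 fstar DeltaL lamC V xstar).
  exact: (fair_distance xstar eta0 G00 lamC0 nbM hfair).
have fD : fair f A B C fstar (regret_process f A B C fstar lamD V xstar).
  exact: (fair_regret f A B C fstar xstar lamD0 (ltW V0)).
have [N [mN N0] hN] := run_noise df sf mG noise iid G00 run thE gmE.
have ev := run_process mG unb noise iid G00 run thE gmE d01.
have [B1 p1 h1] := ev _ fA (fun _ _ _ _ _ my mg mq =>
  measurable_descent_process df sf my mg mq A B C eta fstar DeltaL lamA G00).
have [B2 p2 h2] := ev _ fB (fun _ _ _ _ r my mg _ =>
  measurable_energy_process df sf r my mg fstar DeltaL M).
have [B3 p3 h3] := ev _ fC (fun _ _ _ _ _ my mg mq =>
  measurable_distance_process df sf my mg mq eta fstar DeltaL lamC V xstar G00).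
have [B4 p4 h4] := ev _ fD (fun _ _ _ _ r my mg _ =>
  measurable_regret_process df sf r my mg A B C fstar lamD V xstar).
have mE : measurable E.
  have mxb : measurable_fun setT (fun w => T'^-1 *: \sum_(1 <= t < T.+1) xb t w : borel_rV R d).
    apply: measurable_rVZ; first exact: measurable_cst.
    apply: measurable_rV => i.
    rewrite (_ : (fun w => _) = fun w => \sum_(t < T) (xb t.+1 w : 'rV[R]_d) 0 i); last first.
      by apply/funext => w; rewrite summxE big_add1 big_mkord.
    apply: measurable_sum => t.
    exact: (measurable_coord i (measurable_run_xb mG G00 run thE gmE (t := t.+1) (ltn_ord t))).
  rewrite -[E]setTI.
  have mb := measurable_fun_ler (measurable_funB
    (measurableT_comp (measurable_f df) mxb) (measurable_cst fstar))
    (measurable_cst (_ : R)).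
  exact: (mb _ measurableT [set true]).
apply: (probability_ge_of_subset5 mE mN N0 p1 p2 p3 p4) => w wN w1 w2 w3 w4.
have x1E := agd_x1 run w; have xt1E := agd_xt1 run w.
have xt1E' : xt 1%N w = x 1%N w by rewrite x1E xt1E.
have xb1 : xb 1%N w = x 1%N w.
  by rewrite (agd_xb run)// xt1E' -scalerDl addrC subrK scale1r.
pose b t := Num.sqrt (G0 ^+ 2 + \sum_(1 <= k < t) enorm (g k w) ^+ 2).
have b0 t : 0 < b t.
  by rewrite sqrtr_gt0 ltr_wpDr ?exprn_gt0// sumr_ge0// => k _; exact: sqr_ge0.
have thbE t : (1 <= t <= T)%N -> theta t w = eta / b t.+1 by exact: thE.
have xS t : (1 <= t <= T)%N -> x t.+1 w = x t w - (eta / b t.+1) *: g t w.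
  by move=> tT; rewrite -thbE// (agd_x run).
have stepg t : (1 <= t <= T)%N -> eta / b t.+1 * enorm (g t w) <= eta.
  case/andP=> t1 _; rewrite mulrAC ler_pdivrMr// ler_wpM2l ?(ltW eta0)//.
  rewrite -[leLHS]ger0_norm ?enorm_ge0// -sqrtr_sqr ler_wsqrtr// big_nat_recr//=.
  rewrite addrA lerDr addr_ge0 ?sqr_ge0// sumr_ge0// => k _; exact: sqr_ge0.
have md : (forall t, (1 <= t <= T)%N -> gamma t w = eta / b t.+1) \/
  (forall t, (1 <= t <= T)%N -> alpha t = 2 / (t%:R + 1) /\
    gamma t w = (1 + alpha t) * (eta / b t.+1)).
  case: hmode => h; [left|right] => t tT; have := h t w tT; first by case.
  by case=> _ -> ->; rewrite thbE.
have [u_le sum_u] := template_gap (x := x^~ w) (xt := xt^~ w) (xb := xb^~ w)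
  (g := g^~ w) (th := fun t => eta / b t.+1) (ltW eta0) (agd_alpha run) xt1E'
  (fun t tT => agd_xb run w tT) xS
  (fun t tT => agd_xt run w tT) (fun t _ => ltW (divr_gt0 eta0 (b0 t.+1))) stepg md.
have := path_main (x := x^~ w) (xb := xb^~ w) (g := g^~ w) df sf L0 A0 B0 C0 eta0 G00
  fmin xS xb1 u_le sum_u (hN w wN) T1 cf xsE l34 llT lll.
cbv beta; rewrite x1E => pm.
exact: (pm _ _ _ _ erefl erefl RLE DL0 hDL (h1 w w1) (h2 w w2) (h3 w w3) (h4 w w4)).
Qed.
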